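(* Let $G$ be a finite simple graph and let $X\subseteq V(G)$ with $1\le |X|\le 5$ such that $(G,X)$ is $5$-massed. Suppose $(G,X)$ is not cycle-linked. Then $|X|=5$, $\rho(V(G)\setminus X)=5|V(G)\setminus X|+1$, the vertices of $X$ can be labeled $x_1,\dots,x_5$ so that $x_ix_{i+1}\notin E(G)$ for all $i\in[5]$ (indices mod 5, so $x_6=x_1$, $x_7=x_2$), and there exist vertices $a,b\in V(G)\setminus X$ such that (1) $ab\in E(G)$ and $a,b\in N(x_i)$ for all $i\in[5]$; and (2) for every connected component $C$ of $G-(X\cup\{a,b\})$, we have $\rho_G(V(C))=5|V(C)|$ and $N_G(V(C))\subseteq\{a,b,x_i,x_{i+2}\}$ for some $i\in[5]$.
   Context: For $Y\subseteq V(G)$: $\rho_G(Y)$ is the number of edges of $G$ with at least one end in $Y$; $N_G(Y)$ is the set of vertices outside $Y$ adjacent to a vertex of $Y$; $G[Y]$ is the induced subgraph; $G-Y$ is obtained by deleting $Y$. For $Y,Z\subseteq V(G)$, $e(Y,Z)$ is the number of edges with one end in $Y$ and one in $Z$. $C_k$-minor: for distinct vertices $x_1,\dots,x_k$ ($k\ge3$), $(G,x_1\dots x_k)$ has a $C_k$-minor if there exist pairwise disjoint $X_1,\dots,X_k\subseteq V(G)$ with $G[X_i]$ connected, $x_i\in X_i$, and $e(X_i,X_{i+1})>0$ for all $i\in[k]$ (with $X_{k+1}=X_1$). Cycle-linked: $(G,X)$ is cycle-linked if $|X|\ge3$ and for every ordering $x_1,\dots,x_{|X|}$ of $X$, $(G,x_1\dots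 x_{|X|})$ has a $C_{|X|}$-minor; or if $|X|\in\{1,2\}$ and $G$ contains a path between the vertices of $X$. Separation: an ordered pair $(A,B)$ of subsets of $V(G)$ is a separation of $(G,X)$ if $A\cup B=V(G)$, $X\subseteq A$, and $e(A\setminus B,B\setminus A)=0$; its order is $|A\cap B|$. $\lambda$-massed: $(G,X)$ is $\lambda$-massed if (M1) $\rho(V(G)\setminus X)>\lambda|V(G)\setminus X|$, and (M2) $\rho(B\setminus A)\le\lambda|B\setminus A|$ for every separation $(A,B)$ of $(G,X)$ of order less than $|X|$. *)

(* Defs.v *)
(* A finite simple graph is a symmetric irreflexive relation
   adj on a finType T (vertex set V(G) = T). *)
From mathcomp Require Import all_boot all_order.
Set Implicit Arguments. Unset Strict Implicit. Unset Printing Implicit Defensive.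

Section Graph.
Variable T : finType.
Variable adj : rel T.

Definition edges : {set {set T}} :=
  [set e : {set T} | [exists x, exists y, adj x y && (e == [set x; y])]].

Definition rho (Y : {set T}) : nat :=
  #|[set e in edges | e :&: Y != set0]|.

Definition nbhd (Y : {set T}) : {set T} :=
  [set u | (u \notin Y) && [exists y in Y, adj y u]].

Definition has_edge_between (Y Z : {set T}) : bool :=
  [exists y in Y, exists z in Z, adj y z].

Definition adj_in (S : {set T}) : rel T :=
  [rel x y | adj x y && (x \in S) && (y \in S)].

Definition connected_in (S : {set T}) : Prop :=
  forall x y, x \in S -> y \in S -> connect (adj_in S) x y.

(* (G, x_1 ... x_k) has a C_k-minor; s = [:: x_1; ...; x_k] (0-indexed) *)
Definition Ck_minor (s : seq T) : Prop :=
  let k := size s in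
  exists Xs : nat -> {set T},
    (forall i j, i < k -> j < k -> i != j -> [disjoint Xs i & Xs j]) /\
    (forall i, i < k -> connected_in (Xs i)) /\
    (forall x0 i, i < k -> nth x0 s i \in Xs i) /\
    (forall i, i < k -> has_edge_between (Xs i) (Xs ((i.+1) %% k))).

Definition cycle_linked (X : {set T}) : Prop :=
  (3 <= #|X| /\ forall s : seq T, uniq s -> [set x in s] = X -> Ck_minor s)
  \/ ((#|X| == 1) || (#|X| == 2)) /\
     (forall x y, x \in X -> y \in X -> connect adj x y).

Definition separation (X A B : {set T}) : Prop :=
  A :|: B = [set: T] /\ X \subset A /\ ~~ has_edge_between (A :\: B) (B :\: A).

Definition massed (lambda : nat) (X : {set T}) : Prop :=
  rho (~: X) > lambda * #|~: X| /\
  (forall A B, separation X A B -> #|A :&: B| < #|X| ->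
     rho (B :\: A) <= lambda * #|B :\: A|).

Definition component_in (S : {set T}) (v : T) : {set T} :=
  [set u in S | connect (adj_in S) v u].

End Graph.

(* Main.v *)
(* Two vertices a, b adjacent to all five roots already serve every pair of consecutive roots
   but one, so if no C_5-minor exists for some order of X then the roots are consecutively
   non-adjacent and each component of G - (X + a + b) attaches to at most two non-consecutive
   roots. Then (M2) bounds the density of each component by 5, and (M1) forces all the equalities
   of the theorem. It remains to find a and b in every massed pair that is not cycle-linked.

   A minimal counterexample has no separation (A, B) of order at most |X| for which
   (G[B], A cap B) is linked: B could be replaced by a clique, and by Menger's theorem the roots
   could be carried to A cap B. By induction, dense sides of small separations are linked, so
   there are none. Hence contracting an edge uv keeps the pair massed unless u and v have at least
   five common neighbours (edges inside X counting as present). As rho = 5 |V - X| + 1, some v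
   outside X satisfies deg v + |N(v) cap X| <= 10, so N(v) has at most ten vertices and minimum
   degree at least five, edges inside X counting as present. A finite case analysis shows that any
   five vertices of N(v) containing N(v) cap X are then linked, in any order, inside N[v], so the
   separation (V - v, N[v]) yields the contradiction. *)
From Stdlib Require Import Ascii String Classical_Prop.
Require Import Defs.
From mathcomp Require Import all_boot all_order.
From mathcomp Require Import zify.
Set Implicit Arguments. Unset Strict Implicit. Unset Printing Implicit Defensive.

(** * Connected sets and rooted cycle minors *)

(** The induction cannot aim at linkedness alone: contracting an edge or replacing a side by a
    clique may create two dominating vertices. The inductive claim is therefore linked or
    [dominated], and each use has to dispose of the second outcome, by comparing edge counts or by
    finding three vertices too densely joined to the roots. The equalities of the theorem are read
    off [dominated] only at the end.

    The number of vertices decreases first, the number of edges second; deleting edges outside X is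
    what makes the density exact in a minimal counterexample. Both contraction and deletion can
    spoil (M2) by turning a separation of order |X| into a smaller one, so dense proper separations
    of that order have to be excluded as well.

    The constants come from one budget. Contraction removes one vertex and may thus lose five edges:
    the contracted one and four at common neighbours. The sum of deg v + |N(v) cap X| over V - X is
    twice the density, so its average exceeds 10 by a term that matters only when |V - X| is at most
    2. *)

Section Connectivity.
Variable T : finType.
Implicit Types (e : rel T) (x y z : T) (Y Z U D : {set T}).

Lemma touchP e Y Z :
  reflect (exists y z, [/\ y \in Y, z \in Z & e y z]) (has_edge_between e Y Z).
Proof.
apply: (iffP existsP) => [[y /andP[yY /existsP[z /andP[zZ yz]]]]|[y [z [yY zZ yz]]]].
  by exists y, z.
by exists y; rewrite yY /=; apply/existsP; exists z; rewrite zZ.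
Qed.

Lemma touchC e Y Z : symmetric e -> has_edge_between e Y Z = has_edge_between e Z Y.
Proof.
move=> sym; apply/touchP/touchP => -[y [z [? ? ?]]]; exists z, y; split=> //; by rewrite sym.
Qed.

Lemma touchS e e' Y Y' Z Z' : subrel e e' -> Y \subset Y' -> Z \subset Z' ->
  has_edge_between e Y Z -> has_edge_between e' Y' Z'.
Proof.
move=> ee /subsetP YY /subsetP ZZ /touchP[y [z [yY zZ yz]]].
by apply/touchP; exists y, z; split; [apply: YY | apply: ZZ | apply: ee].
Qed.

Lemma touchSE e Y Y' Z Z' : Y \subset Y' -> Z \subset Z' ->
  has_edge_between e Y Z -> has_edge_between e Y' Z'.
Proof. exact: touchS. Qed.

Lemma adj_in_sym e Y : symmetric e -> symmetric (adj_in e Y).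
Proof. by move=> sym x y; rewrite /adj_in /= sym; case: (x \in Y); case: (y \in Y);
  rewrite ?andbT ?andbF. Qed.

Lemma connect_adj_inS e e' Y Z x y : subrel e e' -> Y \subset Z ->
  connect (adj_in e Y) x y -> connect (adj_in e' Z) x y.
Proof.
move=> ee /subsetP YZ; apply: connect_sub => {}x {}y /= /andP[/andP[xy xY] yY].
by apply: connect1; rewrite /adj_in /= ee // !YZ.
Qed.

Lemma connS e e' Y : subrel e e' -> connected_in e Y -> connected_in e' Y.
Proof. by move=> ee cY x y xY yY; apply: connect_adj_inS (cY _ _ xY yY). Qed.

Lemma conn1 e x : connected_in e [set x].
Proof. by move=> y z /set1P-> /set1P->; apply: connect0. Qed.

Lemma conn0 e : connected_in e set0.
Proof. by move=> y z; rewrite inE. Qed.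

Lemma conn_root e Y x : symmetric e ->
  (forall y, y \in Y -> connect (adj_in e Y) x y) -> connected_in e Y.
Proof.
move=> sym H y z /H xy /H; apply: connect_trans.
by rewrite (sym_connect_sym (adj_in_sym Y sym)).
Qed.

Lemma connU e Y Z : symmetric e -> connected_in e Y -> connected_in e Z ->
  (exists x, x \in Y :&: Z) \/ has_edge_between e Y Z -> connected_in e (Y :|: Z).
Proof.
move=> sym cY cZ H.
have [y [z [yY zZ yz]]] : exists y z, [/\ y \in Y, z \in Z & connect (adj_in e (Y :|: Z)) y z].
  case: H => [[x /setIP[xY xZ]]|/touchP[y [z [yY zZ yz]]]].
    by exists x, x; split.
  by exists y, z; split=> //; apply: connect1; rewrite /adj_in /= yz !inE yY zZ orbT.
apply: (@conn_root _ _ y) => // x /setUP[xY|xZ].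
  by apply: connect_adj_inS (cY _ _ yY xY) => //; apply: subsetUl.
apply: connect_trans yz _; apply: connect_adj_inS (cZ _ _ zZ xZ) => //; apply: subsetUr.
Qed.

Lemma connU1 e Y x : symmetric e -> connected_in e Y -> has_edge_between e [set x] Y ->
  connected_in e (x |: Y).
Proof. by move=> sym cY H; apply: connU => //; [exact: conn1 | right]. Qed.

Lemma conn_cross e Y Z x y : connected_in e Y -> x \in Y :&: Z -> y \in Y :\: Z ->
  exists u v, [/\ u \in Y :&: Z, v \in Y :\: Z & e u v].
Proof.
move=> cY /setIP[xY xZ] /setDP[yY yZ].
have /connectP[p] := cY _ _ xY yY.
elim: p x xY xZ => [|z p IH] x xY xZ /=; first by move=> _ yx; rewrite yx xZ in yZ.
case/andP=> /andP[/andP[xz _] zY] pp lp.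
have [zZ|zZ] := boolP (z \in Z); first exact: IH pp lp.
by exists x, z; split=> //; rewrite inE ?xY ?zY ?zZ.
Qed.

Lemma component_sub e U v : component_in e U v \subset U.
Proof. by apply/subsetP=> x; rewrite inE => /andP[]. Qed.

Lemma component_self e U v : v \in U -> v \in component_in e U v.
Proof. by move=> vU; rewrite inE vU connect0. Qed.

Lemma component_conn e U v : symmetric e -> v \in U -> connected_in e (component_in e U v).
Proof.
move=> sym vU; set D := component_in e U v.
apply: (@conn_root _ _ v) => // y; rewrite inE => /andP[yU /connectP[p pp ->]].
elim/last_ind: p pp => [|p z IH]; first by rewrite connect0.
rewrite rcons_path last_rcons => /andP[pp lz]; apply: connect_trans (IH pp) _.
have lv : connect (adj_in e U) v (last v p) by apply/connectP; exists p.
have := lz; rewrite /adj_in /= => /andP[/andP[ez lU] zU].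
apply: connect1; rewrite /adj_in /= ez !inE lU zU lv /=.
by apply: connect_trans lv _; apply: connect1.
Qed.

Lemma component_closed e U v x y : x \in component_in e U v -> y \in U -> e x y ->
  y \in component_in e U v.
Proof.
rewrite !inE => /andP[xU vx] yU xy; rewrite yU /=; apply: connect_trans vx _.
by apply: connect1; rewrite /adj_in /= xy xU yU.
Qed.

End Connectivity.

Section Models.
Variable T : finType.
Implicit Types (e : rel T) (x y z : T) (s : seq T) (V X Y Z A B S : {set T}) (F : T -> {set T}).

Lemma disjointUs A B S : [disjoint A & S] -> [disjoint B & S] -> [disjoint A :|: B & S].
Proof. by rewrite -!setI_eq0 setIUl => /eqP-> /eqP->; rewrite setU0. Qed.

Definition tie e F : rel T := fun x y => (x == y) || has_edge_between e (F x) (F y).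

(* A C_k-minor of (G[V], s) whose bags are indexed by the roots. The case [x == y] of [tie]
   only occurs when there is a single root. *)
Definition mlinked V e s := exists F : T -> {set T},
  [/\ {in s, forall x, x \in F x}, {in s, forall x, F x \subset V},
      {in s, forall x, connected_in e (F x)},
      {in s &, forall x y, x != y -> [disjoint F x & F y]} & cycle (tie e F) s].

Definition Linked V e X := forall s, uniq s -> s =i X -> mlinked V e s.

Lemma mlinkedS V V' e e' s : V \subset V' -> subrel e e' -> mlinked V e s -> mlinked V' e' s.
Proof.
move=> VV ee [F [Fx FV Fc Fd Fcy]]; exists F; split=> //.
- by move=> x xs; apply: subset_trans (FV x xs) VV.
- by move=> x xs; apply: connS (Fc x xs).
- apply: sub_cycle Fcy => x y /orP[xy|xy]; rewrite /tie ?xy //.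
  by rewrite (touchS ee _ _ xy) ?orbT.
Qed.

Lemma mlinked_rot n V e s : mlinked V e (rot n s) -> mlinked V e s.
Proof.
move=> [F [Fx FV Fc Fd Fcy]]; exists F; rewrite rot_cycle in Fcy; split=> //.
- by move=> x xs; apply: Fx; rewrite mem_rot.
- by move=> x xs; apply: FV; rewrite mem_rot.
- by move=> x xs; apply: Fc; rewrite mem_rot.
- by move=> x y xs ys; apply: Fd; rewrite mem_rot.
Qed.

(** Merging the bag of the last root into that of its predecessor keeps the bag connected and passes
    on the contact with the first root. *)
Lemma mlinked_rcons V e s z : symmetric e -> uniq (rcons s z) -> mlinked V e (rcons s z) ->
  mlinked V e s.
Proof.
move=> sym us [F [Fx FV Fc Fd Fcy]].
case/lastP: s us Fx FV Fc Fd Fcy => [|s y] us Fx FV Fc Fd Fcy.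
  by exists F; split.
have ys : y \in rcons (rcons s y) z by rewrite !(mem_rcons, inE) eqxx orbT.
have zs : z \in rcons (rcons s y) z by rewrite mem_rcons inE eqxx.
have yz : y != z.
  by move: us; rewrite rcons_uniq mem_rcons inE negb_or eq_sym => /andP[/andP[]].
have yns : y \notin s.
  by move: us; rewrite rcons_uniq rcons_uniq => /and3P[].
have ss x : x \in rcons s y -> x \in rcons (rcons s y) z by move=> xs; rewrite mem_rcons inE xs orbT.
have zns x : x \in rcons s y -> x != z.
  move=> xs; apply: contraTneq us => xz; by rewrite rcons_uniq -xz xs.
pose F' x := if x == y then F y :|: F z else F x.
have FF' x : F x \subset F' x by rewrite /F'; case: eqP => [->|_] //; apply: subsetUl.
have tyz : has_edge_between e (F y) (F z).
  move: Fcy; rewrite (cycle_path y) last_rcons /= -cats1 -cats1 -catA cat_path /=.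
  case/andP=> _; rewrite /tie; case/and3P=> _ /orP[/eqP yz'|//] _; by rewrite yz' eqxx in yz.
exists F'; split.
- by move=> x xs; apply: (subsetP (FF' x)); apply/Fx/ss.
- move=> x xs; rewrite /F'; case: eqP => _; last exact/FV/ss.
  by rewrite subUset !FV.
- move=> x xs; rewrite /F'; case: eqP => _; last exact/Fc/ss.
  by apply: connU => //; [exact: Fc | exact: Fc | right].
- move=> x x' xs xs' xx'.
  have H (w w' : T) : w \in rcons s y -> w' \in rcons s y -> w != w' -> w' != y ->
    [disjoint F' w & F w'].
    move=> ws ws' ww wy; rewrite /F'; case: eqP => [wy'|_]; last by rewrite Fd ?ss.
    apply: disjointUs; apply: Fd => //; first exact: ss.
    - by rewrite eq_sym.
    - exact: ss.
    - by rewrite eq_sym zns.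
  have [e1|n1] := eqVneq x' y; last by rewrite {2}/F' (negPf n1) H.
  have n2 : x != y by rewrite -e1.
  by rewrite {1}/F' (negPf n2) disjoint_sym H // eq_sym.
- have ties a b : tie e F a b -> tie e F' a b.
    by case/orP=> [/eqP->|ab]; rewrite /tie ?eqxx // (touchSE _ _ ab) ?orbT.
  move: Fcy; rewrite (cycle_path y) last_rcons (cycle_path y) last_rcons /=.
  case: s us ys zs yns ss zns Fx FV Fc Fd => [|x s] us ys zs yns ss zns Fx FV Fc Fd /=.
    (* One root remains: the cycle is a tie of [y] with itself, true by the equality clause. *)
    by rewrite /tie eqxx.
  case/andP=> zx; rewrite rcons_path => /andP[px _]; apply/andP; split; last first.
    exact: sub_path ties _ _ px.
  move: zx => /orP[/eqP zx|zx]; last by rewrite /tie (touchSE _ _ zx) ?orbT // /F' eqxx subsetUr.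
  by have := zns x; rewrite inE eqxx zx eqxx => /(_ isT).
Qed.

Lemma mlinked_catl V e s t : symmetric e -> uniq (s ++ t) -> mlinked V e (s ++ t) -> mlinked V e s.
Proof.
move=> sym; elim/last_ind: t => [|t z IH]; first by rewrite cats0.
rewrite -rcons_cat => us /(mlinked_rcons sym us); apply: IH.
by move: us; rewrite rcons_uniq => /andP[].
Qed.

Lemma Linked_sub V e X s : symmetric e -> Linked V e X -> uniq s -> {subset s <= X} -> mlinked V e s.
Proof.
move=> sym L us sX; pose t := [seq x <- enum X | x \notin s].
have ut : uniq (s ++ t).
  rewrite cat_uniq us /= filter_uniq ?enum_uniq // andbT.
  by apply/hasPn=> x; rewrite mem_filter => /andP[].
apply: (@mlinked_catl _ _ _ t) => //; apply: L => // x.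
by rewrite mem_cat mem_filter mem_enum; case: (boolP (x \in s)) => //= /sX.
Qed.

End Models.

(** * Menger's theorem *)

Section Menger.
Variable T : finType.
Implicit Types (e : rel T) (x y z : T) (s : seq T) (V X Y Z A B S : {set T}).

Definition sep e V A B := (A :|: B == V) && ~~ has_edge_between e (A :\: B) (B :\: A).

Lemma sepP e V A B :
  reflect (A :|: B = V /\ forall x y, x \in A -> x \notin B -> y \in B -> y \notin A -> ~~ e x y)
          (sep e V A B).
Proof.
apply: (iffP andP) => [[/eqP-> H]|[-> H]]; split=> //.
  move=> x y xA xB yB yA; apply: contra H => xy; apply/touchP; exists x, y.
  by rewrite !inE xA xB yA yB.
apply/touchP=> -[x [y []]]; rewrite !inE => /andP[xB xA] /andP[yA yB].
by apply/negP; apply: H.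
Qed.

(** Connected sets replace paths, since they are glued by plain unions. Meeting [Z] only in [f x]
    stands for a path that stops on first reaching [Z], and makes [f] injective. *)
Definition linkage e V X Z (P : T -> {set T}) (f : T -> T) :=
  [/\ {in X, forall x, x \in P x}, {in X, forall x, P x \subset V},
      {in X, forall x, connected_in e (P x)},
      {in X &, forall x y, x != y -> [disjoint P x & P y]} &
      {in X, forall x, P x :&: Z = [set f x]}].

Lemma linkageS e e' V V' X Z P f : subrel e e' -> V \subset V' ->
  linkage e V X Z P f -> linkage e' V' X Z P f.
Proof.
move=> ee VV [H1 H2 H3 H4 H5]; split=> // x xX.
  exact: subset_trans (H2 x xX) VV.
exact: connS (H3 x xX).
Qed.

Lemma linkage_end e V X Z P f x : linkage e V X Z P f -> x \in X -> f x \in P x /\ f x \in Z.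
Proof. by move=> [_ _ _ _ H] /H E; apply/setIP; rewrite E inE. Qed.

Lemma linkage_hit e V X Z P f x z : linkage e V X Z P f -> x \in X -> z \in P x -> z \in Z -> z = f x.
Proof. by move=> [_ _ _ _ H] /H E zP zZ; apply/set1P; rewrite -E inE zP. Qed.

Lemma linkage_fix e V X Z P f x : linkage e V X Z P f -> x \in X -> x \in Z -> f x = x.
Proof. by move=> L xX xZ; rewrite -(linkage_hit L xX _ xZ) //; case: L => H *; apply: H. Qed.

Lemma linkage_inj e V X Z P f : linkage e V X Z P f -> {in X &, injective f}.
Proof.
move=> L x y xX yX fxy; apply/eqP/negPn/negP=> xy.
have [_ _ _ /(_ x y xX yX xy) D _] := L.
have [[fx _] [fy _]] := (linkage_end L xX, linkage_end L yX).
by move/disjointFr: D => /(_ _ fx); rewrite fxy fy.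
Qed.

Definition del e u v : rel T :=
  [rel x y | e x y && ~~ ((x == u) && (y == v) || (x == v) && (y == u))].

Lemma del_sym e u v : symmetric e -> symmetric (del e u v).
Proof.
move=> sym x y; rewrite /del /= sym.
by case: (x == u); case: (y == v); case: (x == v); case: (y == u).
Qed.

Lemma del_sub e u v : subrel (del e u v) e.
Proof. by move=> x y /andP[]. Qed.

Definition arcs e V : {set T * T} := [set p | [&& p.1 \in V, p.2 \in V & e p.1 p.2]].

Lemma arcs_in e V x y : ((x, y) \in arcs e V) = [&& x \in V, y \in V & e x y].
Proof. by rewrite inE. Qed.

Lemma ltn_arcs e e' V V' u v : subrel e' e -> V' \subset V -> u \in V -> v \in V -> e u v ->
  ~~ [&& u \in V', v \in V' & e' u v] -> #|arcs e' V'| < #|arcs e V|.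
Proof.
move=> ee /subsetP VV uV vV uv H; apply: proper_card; apply/properP; split.
  by apply/subsetP=> -[x y]; rewrite !arcs_in => /and3P[/VV-> /VV-> /ee->].
by exists (u, v); rewrite arcs_in ?uV ?vV ?uv.
Qed.

(** Induction on the number of arcs. If deleting an edge creates a small separation, this edge is
    the only one that crosses it. Either one of its ends can be added to the separator, or the
    separator together with either end has exactly |X| vertices; then both halves are linked by
    induction and the edge joins them. *)
Theorem menger e V X Z : symmetric e -> X \subset V -> Z \subset V ->
  (exists A B, [/\ sep e V A B, X \subset A, Z \subset B & #|A :&: B| < #|X|]) \/
  exists P f, linkage e V X Z P f.
Proof.
have [n] := ubnP #|arcs e V|; elim: n e V X Z => // n IH e V X Z lt_n sym XV ZV.
have [noe|[[u0 v0]]] := set_0Vmem (arcs e V).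
  have [XZ|XZ] := boolP (X \subset Z).
    right; exists set1, id; split.
    - by move=> x _; rewrite inE.
    - by move=> x xX; rewrite sub1set (subsetP XV).
    - by move=> x _; apply: conn1.
    - by move=> x y _ _ xy; rewrite disjoints1 inE.
    - by move=> x xX; apply/setIidPl; rewrite sub1set (subsetP XZ).
  left; exists X, (V :\: (X :\: Z)); split=> //.
  - apply/sepP; split.
      apply/setP=> x; rewrite !inE; have := subsetP XV x; case: (x \in X) => /= [/(_ isT)-> //|_].
      by rewrite andbF.
    move=> x y xX _; rewrite !inE => /andP[_ yV] _; apply/negP=> xy.
    by have := arcs_in e V x y; rewrite noe inE (subsetP XV) // yV xy.
  - apply/subsetP=> x xZ; rewrite !inE xZ /=; exact: (subsetP ZV).
  - apply: proper_card; apply/properP; split; first exact: subsetIl.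
    by case/subsetPn: XZ => x xX xZ; exists x; rewrite // !inE xX xZ.
rewrite arcs_in => /and3P[u0V v0V uv0].
have lt1 : #|arcs (del e u0 v0) V| < n.
  apply: leq_trans (_ : #|arcs e V| <= n); last by rewrite -ltnS.
  apply: (ltn_arcs (@del_sub e u0 v0) (subxx V) u0V v0V uv0).
  by rewrite /del /= !eqxx /= !andbF.
have [[A [B [sAB XA ZB ltS]]]|[P [f L]]] := IH _ V X Z lt1 (del_sym u0 v0 sym) XV ZV; last first.
  by right; exists P, f; apply: linkageS L => //; apply: del_sub.
have [sABe|] := boolP (sep e V A B); first by left; exists A, B.
case/sepP: sAB => ABV noe.
rewrite /sep ABV eqxx /= negbK => /touchP[u [v []]].
rewrite !inE => /andP[uB uA] /andP[vA vB] uv.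
(* Nothing but the deleted edge can cross [(A, B)]; from here on [u] and [v] name its ends on the
   side of [A] and of [B]. *)
have Huv x y : x \in A -> x \notin B -> y \in B -> y \notin A -> e x y -> x = u /\ y = v.
  move=> xA xB yB yA xy.
  have := noe _ _ xA xB yB yA; have := noe _ _ uA uB vB vA; rewrite /del /= xy uv !negbK /=.
  have cl a b : a \in A -> b \notin A -> a <> b by move=> aA bA ab; rewrite -ab aA in bA.
  case/orP=> /andP[/eqP eu /eqP ev]; case/orP=> /andP[/eqP ex /eqP ey].
  - by rewrite eu ev.
  - by case: (cl _ _ xA vA); rewrite ex ev.
  - by case: (cl _ _ xA vA); rewrite ex ev.
  - by rewrite eu ev.
have uV : u \in V by rewrite -ABV inE uA.
have vV : v \in V by rewrite -ABV inE vB orbT.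
pose S := A :&: B.
have [AV BV] : A \subset V /\ B \subset V by rewrite -ABV subsetUl subsetUr.
have [ltS1|geS] := ltnP #|S|.+1 #|X|.
  left; exists A, (u |: B); split=> //; last first.
  - apply: leq_ltn_trans ltS1; rewrite setIUr.
    by rewrite (setIidPr _) ?sub1set // cardsU1; case: (u \notin _).
  - by apply: subset_trans ZB _; apply: subsetUr.
  apply/sepP; split; first by rewrite setUCA ABV; apply/setUidPr; rewrite sub1set.
  move=> x y xA; rewrite !inE negb_or => /andP[xu xB] /orP[/eqP-> |yB] yA; first by rewrite uA in yA.
  by apply/negP=> /(Huv _ _ xA xB yB yA)[xu' _]; rewrite xu' eqxx in xu.
have kS : #|X| = #|S|.+1 by apply/eqP; rewrite eqn_leq geS ltS.
have uS : u \notin S by rewrite inE (negPf uB) andbF.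
have vS : v \notin S by rewrite inE (negPf vA).
have ltA : #|arcs e A| < n.
  apply: leq_trans (_ : #|arcs e V| <= n); last by rewrite -ltnS.
  by apply: (ltn_arcs (u := u) (v := v)) => //; rewrite (negPf vA) andbF.
have ltB : #|arcs e B| < n.
  apply: leq_trans (_ : #|arcs e V| <= n); last by rewrite -ltnS.
  by apply: (ltn_arcs (u := u) (v := v)) => //; rewrite (negPf uB).
have SuA : u |: S \subset A by rewrite subUset sub1set uA subsetIl.
have SvB : v |: S \subset B by rewrite subUset sub1set vB subsetIr.
(* Both [u |: S] and [v |: S] have as many vertices as [X], and a small separation of one half
   becomes a small separation of the whole when the other half is added to the appropriate side. *)
have [[A1 [B1 [/sepP[AB1 no1] XA1 SB1 lt]]]|[P [f LP]]] := IH _ A X (u |: S) ltA sym XA SuA.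
  left; exists A1, (B1 :|: B); split=> //.
  - apply/sepP; split; first by rewrite setUA AB1.
    have A1A : A1 \subset A by rewrite -AB1 subsetUl.
    have B1A : B1 \subset A by rewrite -AB1 subsetUr.
    move=> x y xA1; rewrite !inE negb_or => /andP[xB1 xB] yB yA1.
    have [yB1|yB1] := boolP (y \in B1); first exact: no1.
    rewrite (negPf yB1) /= in yB; have [yA|yA] := boolP (y \in A).
      by case/negP: yB1; apply: (subsetP SB1); rewrite !inE yA yB orbT.
    apply/negP=> /(Huv _ _ (subsetP A1A _ xA1) xB yB yA)[xu _].
    by case/negP: xB1; apply: (subsetP SB1); rewrite xu !inE eqxx.
  - by apply: subset_trans ZB _; apply: subsetUr.
  - rewrite setIUr (setUidPl _) //; apply/subsetP=> x /setIP[xA1 xB]; rewrite inE xA1.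
    by apply: (subsetP SB1); rewrite !inE xB andbT -AB1 inE xA1 orbT.
have cX : #|v |: S| = #|X| by rewrite cardsU1 vS kS.
have [[A1 [B1 [/sepP[AB1 no1] SA1 ZB1 lt]]]|[Q [g LQ]]] := IH _ B (v |: S) Z ltB sym SvB ZB.
  left; exists (A :|: A1), B1; split=> //.
  - apply/sepP; split; first by rewrite -setUA AB1.
    have B1B : B1 \subset B by rewrite -AB1 subsetUr.
    move=> x y; rewrite !inE negb_or => xA xB1 yB1 /andP[yA yA1].
    have [xA1|xA1] := boolP (x \in A1); first exact: no1.
    rewrite (negPf xA1) orbF in xA; have [xB|xB] := boolP (x \in B).
      by case/negP: xA1; apply: (subsetP SA1); rewrite !inE xA xB orbT.
    apply/negP=> /(Huv _ _ xA xB (subsetP B1B _ yB1) yA)[_ yv].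
    by case/negP: yA1; apply: (subsetP SA1); rewrite yv !inE eqxx.
  - by apply: subset_trans XA _; apply: subsetUl.
  - rewrite -cX; apply: leq_ltn_trans lt; apply: subset_leq_card.
    rewrite setIUl subUset subxx andbT; apply/subsetP=> x /setIP[xA xB1]; rewrite inE xB1 andbT.
    by apply: (subsetP SA1); rewrite !inE xA -AB1 inE xB1 !orbT.
(* The set ending at [u] continues from [v] across the edge [uv]; all others continue from the
   vertex of [S] where they ended. *)
right; pose h x := if f x == u then v else f x.
have fSu x : x \in X -> f x \in P x /\ f x \in u |: S by apply: linkage_end LP.
have hS x : x \in X -> h x \in v |: S.
  move=> /fSu[_]; rewrite /h; case: eqP => [_ _|/eqP fu]; first by rewrite !inE eqxx.
  by rewrite !inE (negPf fu) /= => ->; rewrite orbT.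
have hinj : {in X &, injective h}.
  move=> x y xX yX; rewrite /h; case: eqP => [fx|/eqP fx]; case: eqP => [fy|/eqP fy] E.
  - by apply: (linkage_inj LP) => //; rewrite fx fy.
  - by have [_] := fSu y yX; rewrite !inE (negPf fy) /= -E (negPf vA).
  - by have [_] := fSu x xX; rewrite !inE (negPf fx) /= E (negPf vA).
  - exact: (linkage_inj LP).
have [P1 P2 P3 P4 P5] := LP; have [Q1 Q2 Q3 Q4 Q5] := LQ.
have PQ x y w : x \in X -> y \in X -> w \in P x -> w \in Q (h y) -> w = f x /\ w = h x.
  move=> xX yX wP wQ; have wA := subsetP (P2 x xX) _ wP.
  have wB := subsetP (Q2 _ (hS y yX)) _ wQ.
  have wf : w = f x by apply: (linkage_hit LP); rewrite // !inE wA wB orbT.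
  by split=> //; rewrite /h -wf; case: eqP => // wu; rewrite wu (negPf uB) in wB.
have QQ x y w : x \in X -> y \in X -> w \in Q (h x) -> w \in Q (h y) -> x = y.
  move=> xX yX wx wy; apply: hinj => //; apply/eqP/negPn/negP=> hxy.
  by have /disjointFr/(_ wx) := Q4 _ _ (hS x xX) (hS y yX) hxy; rewrite wy.
have PQx x y w : x \in X -> y \in X -> w \in P x -> w \in Q (h y) -> x = y.
  move=> xX yX wP wQ; have [_ wh] := PQ _ _ _ xX yX wP wQ.
  by apply: (QQ x y w) => //; rewrite wh; apply: Q1; apply: hS.
exists (fun x => P x :|: Q (h x)), (fun x => g (h x)); split.
- by move=> x xX; rewrite inE P1.
- move=> x xX; rewrite subUset; apply/andP; split.
    by apply: subset_trans (P2 x xX) AV.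
  by apply: subset_trans (Q2 _ (hS x xX)) BV.
- move=> x xX; apply: connU => //; [exact: P3 | exact/Q3/hS|].
  have [fP fS] := fSu x xX; have hQ := Q1 _ (hS x xX).
  have [fu|fu] := eqVneq (f x) u.
    have hv : h x = v by rewrite /h fu eqxx.
    by right; apply/touchP; exists u, v; split=> //; [rewrite -fu | rewrite hv in hQ *].
  have hf : h x = f x by rewrite /h (negPf fu).
  by left; exists (f x); rewrite inE fP hf; rewrite hf in hQ.
- move=> x y xX yX xy; rewrite -setI_eq0; apply/eqP/setP=> w; rewrite [RHS]inE; apply/negP.
  rewrite !inE => /andP[/orP[wx|wx] /orP[wy|wy]].
  + by have /disjointFr/(_ wx) := P4 _ _ xX yX xy; rewrite wy.
  + by rewrite (PQx x y w) ?eqxx in xy.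
  + by rewrite (PQx y x w) ?eqxx in xy.
  + by rewrite (QQ x y w) ?eqxx in xy.
- move=> x xX; rewrite -(Q5 _ (hS x xX)) setIUl; apply/setUidPr.
  apply/subsetP=> w /setIP[wP wZ]; rewrite inE wZ andbT.
  have wA := subsetP (P2 x xX) _ wP; have wB := subsetP ZB _ wZ.
  have wf : w = f x by apply: (linkage_hit LP); rewrite // !inE wA wB orbT.
  have -> : w = h x by rewrite /h -wf; case: eqP => // wu; rewrite wu (negPf uB) in wB.
  by apply: Q1; apply: hS.
Qed.

(** Each linkage set lies in [A] and each bag in [B], so they can only meet in [A :&: B], where the
    set of [x] contains nothing but [f x]. Extending the bags by the linkage therefore keeps them
    disjoint. *)
Lemma linkage_mlinked e A B X P f s : symmetric e -> linkage e A X (A :&: B) P f ->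
  {subset s <= X} -> uniq s -> mlinked B e (map f s) -> mlinked (A :|: B) e s.
Proof.
move=> sym L sX us [F [F1 F2 F3 F4 F5]]; have [P1 P2 P3 P4 P5] := L.
have ms x : x \in s -> f x \in map f s by apply: map_f.
have PF x y w : x \in s -> y \in s -> w \in P x -> w \in F (f y) -> w = f x.
  move=> xs ys wP wF; apply: (linkage_hit L) => //; first exact: sX.
  by rewrite inE (subsetP (P2 x (sX x xs))) // (subsetP (F2 _ (ms y ys))).
have FF x y w : x \in s -> y \in s -> w \in F (f x) -> w \in F (f y) -> x = y.
  move=> xs ys wx wy; apply: (linkage_inj L); rewrite ?sX //.
  apply/eqP/negPn/negP=> fxy.
  by have /disjointFr/(_ wx) := F4 _ _ (ms x xs) (ms y ys) fxy; rewrite wy.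
have PFx x y w : x \in s -> y \in s -> w \in P x -> w \in F (f y) -> x = y.
  move=> xs ys wP wF; apply: (FF x y w) => //.
  by rewrite (PF _ _ _ xs ys wP wF); apply: F1; apply: ms.
exists (fun x => P x :|: F (f x)); split.
- by move=> x xs; rewrite inE P1 ?sX.
- by move=> x xs; apply: setUSS; [apply: P2; apply: sX | apply: F2; apply: ms].
- move=> x xs; apply: connU => //; [exact/P3/sX | exact/F3/ms |].
  left; exists (f x); rewrite inE F1 ?ms // andbT.
  by case: (linkage_end L (sX x xs)).
- move=> x y xs ys xy; rewrite -setI_eq0; apply/eqP/setP=> w; rewrite [RHS]inE; apply/negP.
  rewrite !inE => /andP[/orP[wx|wx] /orP[wy|wy]].
  + by have /disjointFr/(_ wx) := P4 _ _ (sX x xs) (sX y ys) xy; rewrite wy.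
  + by rewrite (PFx x y w) ?eqxx in xy.
  + by rewrite (PFx y x w) ?eqxx in xy.
  + by rewrite (FF x y w) ?eqxx in xy.
- move: F5; rewrite cycle_map => F5; apply: (sub_in_cycle (P := mem s)) F5; last exact/allP.
  move=> x y xs ys /= /orP[/eqP fxy|t].
    by rewrite /tie (linkage_inj L _ _ fxy) ?eqxx // sX.
  by rewrite /tie (touchSE _ _ t) ?orbT ?subsetUr.
Qed.

End Menger.

(** * Lifting rooted cycle minors *)

Section Lifting.
Variable T : finType.
Implicit Types (e : rel T) (x y z : T) (s : seq T) (V X Y Z A B D S : {set T}) (F : T -> {set T}).

Lemma mlinked_bags V e s (Bs : seq {set T}) : uniq s ->
  all2 (fun x B => (x \in B) && (B \subset V)) s Bs ->
  {in Bs, forall B, connected_in e B} ->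
  pairwise (fun A B => [disjoint A & B]) Bs -> cycle (has_edge_between e) Bs -> mlinked V e s.
Proof.
move=> us mB cB dB tB; have sz : size s = size Bs by move: mB; rewrite all2E => /andP[/eqP].
have [F BF] : exists F, Bs = map F s.
  exists (fun x => nth set0 Bs (index x s)).
  apply: (@eq_from_nth _ set0); first by rewrite size_map.
  case: s us mB sz => [|x0 s'] us mB sz i; first by rewrite -sz.
  by rewrite -sz => lt; rewrite (nth_map x0) // index_uniq.
have Fin x : x \in s -> F x \in Bs by rewrite BF => /(map_f F).
have {}mB : {in s, forall x, (x \in F x) /\ (F x \subset V)}.
  move: mB; rewrite BF; clear; elim: s => //= y s IH /andP[/andP[yF FV] /IH H] x.
  by rewrite inE => /predU1P[->|/H].
exists F; split.
- by move=> x /mB[].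
- by move=> x /mB[].
- by move=> x /Fin; apply: cB.
- move=> x y xs ys xy; move: dB; rewrite BF pairwise_map => /(pairwiseP x) dB.
  rewrite -(nth_index x xs) -(nth_index x ys).
  have [lt|lt|E] := ltngtP (index x s) (index y s).
  + by apply: dB; rewrite ?inE ?index_mem.
  + by rewrite disjoint_sym; apply: dB; rewrite ?inE ?index_mem.
  + by rewrite -(nth_index x xs) E nth_index ?eqxx in xy.
- by move: tB; rewrite BF cycle_map; apply: sub_cycle => x y /= H; rewrite /tie H orbT.
Qed.

(** Contraction of [v] into [u]. The vertex type is fixed, so [v] keeps its edges here; the
    contracted graph is this relation on a vertex set without [v]. *)
Definition ctr e u v : rel T :=
  [rel x y | (x != y) && [|| e x y, (x == u) && e v y | (y == u) && e x v]].

Lemma ctr_sym e u v : symmetric e -> symmetric (ctr e u v).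
Proof.
move=> sym x y; rewrite /ctr /= eq_sym (sym x y) (sym v y) (sym x v).
by case: (y != x) => //=; case: (e y x) => //=; rewrite orbC.
Qed.

Definition uncontract u v Y := if u \in Y then v |: Y else Y.

Lemma uncontract_sub u v Y : Y \subset uncontract u v Y.
Proof. by rewrite /uncontract; case: ifP => // _; apply: subsetUr. Qed.

Lemma uncontract_conn e u v Y : symmetric e -> e u v ->
  connected_in (ctr e u v) Y -> connected_in e (uncontract u v Y).
Proof.
move=> sym uv cY; set Y' := uncontract u v Y.
have YY' := subsetP (uncontract_sub u v Y).
have step x y : x \in Y' -> y \in Y' -> e x y -> connect (adj_in e Y') x y.
  by move=> xY yY xy; apply: connect1; rewrite /adj_in /= xy xY yY.
have vY' : u \in Y -> v \in Y' by move=> uY; rewrite /Y' /uncontract uY !inE eqxx.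
have H x y : connect (adj_in (ctr e u v) Y) x y -> connect (adj_in e Y') x y.
  apply: connect_sub => {}x {}y /= /andP[/andP[/andP[_ xy] xY] yY].
  case/or3P: xy => [xy|/andP[/eqP xu vy]|/andP[/eqP yu xv]].
  - exact: step (YY' _ xY) (YY' _ yY) xy.
  - rewrite xu in xY *; have vY := vY' xY.
    exact: connect_trans (step _ _ (YY' _ xY) vY uv) (step _ _ vY (YY' _ yY) vy).
  - rewrite yu in yY *; have vY := vY' yY; rewrite sym in uv.
    exact: connect_trans (step _ _ (YY' _ xY) vY xv) (step _ _ vY (YY' _ yY) uv).
have [uY|uY] := boolP (u \in Y); last first.
  have YE : Y' = Y by rewrite /Y' /uncontract (negPf uY).
  by move=> x y xY yY; apply/H/cY; rewrite -YE.
apply: (@conn_root _ _ _ u) => // y; rewrite {1}/Y' /uncontract uY => /setU1P[->|yY].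
  exact: step (YY' _ uY) (vY' uY) uv.
by apply: H; apply: cY.
Qed.

Lemma uncontract_touch e u v Y Z : symmetric e -> 
  has_edge_between (ctr e u v) Y Z -> has_edge_between e (uncontract u v Y) (uncontract u v Z).
Proof.
move=> sym /touchP[y [z [yY zZ /andP[_ yz]]]]; apply/touchP.
have YY := subsetP (uncontract_sub u v Y) _ yY.
have ZZ := subsetP (uncontract_sub u v Z) _ zZ.
case/or3P: yz => [yz|/andP[/eqP yu vz]|/andP[/eqP zu yv]]; first by exists y, z; split.
  by exists v, z; split=> //; rewrite yu in yY; rewrite /uncontract yY !inE eqxx.
by exists y, v; split=> //; rewrite zu in zZ; rewrite /uncontract zZ !inE eqxx.
Qed.

(** At most one bag contains [u], and only that bag takes [v] back. *)
Lemma ctr_mlinked V e u v s : symmetric e -> e u v -> v \in V ->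
  mlinked (V :\ v) (ctr e u v) s -> mlinked V e s.
Proof.
move=> sym uv vV [F [F1 F2 F3 F4 F5]].
have FV x : x \in s -> F x \subset V by move=> xs; apply: subset_trans (F2 x xs) (subD1set _ _).
have vF x : x \in s -> v \notin F x.
  by move=> xs; apply/negP=> /(subsetP (F2 x xs)); rewrite !inE eqxx.
exists (fun x => uncontract u v (F x)); split.
- by move=> x xs; apply: (subsetP (uncontract_sub u v _)); apply: F1.
- move=> x xs; rewrite /uncontract; case: ifP => _; last exact: FV.
  by rewrite subUset sub1set vV FV.
- by move=> x xs; apply: uncontract_conn => //; apply: F3.
- move=> x y xs ys xy; have D := F4 x y xs ys xy; rewrite /uncontract.
  case: ifP => ux; case: ifP => uy //.
  + by have /disjointFr/(_ ux) := D; rewrite uy.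
  + by apply: disjointUs; rewrite // disjoints1 vF.
  + by rewrite disjoint_sym; apply: disjointUs; rewrite ?disjoints1 ?vF // disjoint_sym.
- apply: sub_cycle F5 => x y /orP[xy|xy]; rewrite /tie ?xy //.
  by rewrite uncontract_touch ?orbT.
Qed.

Definition addK e S : rel T := [rel x y | e x y || [&& x \in S, y \in S & x != y]].

Lemma addK_sym e S : symmetric e -> symmetric (addK e S).
Proof. by move=> sym x y; rewrite /addK /= sym eq_sym andbCA. Qed.

Lemma conn_bigcup_sorted e F (l : seq T) : symmetric e -> {in l, forall x, x \in F x} ->
  {in l, forall x, connected_in e (F x)} -> sorted (tie e F) l ->
  connected_in e (\bigcup_(z <- l) F z).
Proof.
move=> sym; elim: l => [|z l IH] Fx Fc Fs; first by rewrite big_nil; apply: conn0.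
rewrite big_cons; case: l IH Fx Fc Fs => [|y l] IH Fx Fc Fs.
  by rewrite big_nil setU0; apply: Fc; rewrite inE.
apply: connU => //; first by apply: Fc; rewrite inE eqxx.
  apply: IH; last by case/andP: Fs.
    by move=> x xl; apply: Fx; rewrite inE xl orbT.
  by move=> x xl; apply: Fc; rewrite inE xl orbT.
case/andP: Fs => /orP[/eqP->|zy] _.
  left; exists y; rewrite big_cons !inE Fx //; by rewrite !inE eqxx ?orbT.
by right; rewrite big_cons (touchSE _ _ zy) ?subsetUl.
Qed.

Lemma cycle_flatten_rot (I : Type) (r : rel T) (g : I -> seq T) n (s : seq I) :
  cycle r (flatten (map g (rot n s))) = cycle r (flatten (map g s)).
Proof. by rewrite /rot map_cat flatten_cat cycle_catC -flatten_cat -map_cat cat_take_drop. Qed.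

Lemma cycle_sorted (r : rel T) (s : seq T) : cycle r s -> sorted r s.
Proof. by case: s => //= x s; rewrite rcons_path => /andP[]. Qed.

(* The vertices of [S] used by the bags, listed bag by bag along the cycle, form a cyclic order
   of roots for [B]; the bags obtained there replace the edges of the clique. *)
Lemma splice A B e s : symmetric e -> uniq s -> mlinked A (addK e (A :&: B)) s ->
  Linked B e (A :&: B) -> mlinked (A :|: B) e s.
Proof.
set S := A :&: B => sym us [F [F1 F2 F3 F4 F5]] LB.
pose g x := enum (S :&: F x); pose t := flatten (map g s).
have gE x z : (z \in g x) = (z \in S) && (z \in F x) by rewrite mem_enum inE.
have tP z : reflect (exists2 x, x \in s & z \in g x) (z \in t) by apply: flatten_mapP.
have FF x y w : x \in s -> y \in s -> w \in F x -> w \in F y -> x = y.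
  move=> xs ys wx wy; apply/eqP/negPn/negP=> xy.
  by have /disjointFr/(_ wx) := F4 _ _ xs ys xy; rewrite wy.
have ut : uniq t.
  rewrite /t; elim: s us FF {F1 F2 F3 F4 F5 t tP} => //= x s IH /andP[xs us] FF.
  rewrite cat_uniq enum_uniq IH //= ?andbT; last first.
    by move=> y z w ys zs; apply: FF; rewrite inE ?ys ?zs orbT.
  apply/hasPn=> z /flatten_mapP[y ys zy]; apply/negP=> zx.
  move: zx zy; rewrite !gE => /andP[_ zx] /andP[_ zy].
  by move: xs; rewrite (FF x y z) ?ys // inE ?eqxx ?ys ?orbT.
have tS : {subset t <= S} by move=> z /tP[x _]; rewrite gE => /andP[].
have [F' [F1' F2' F3' F4' F5']] := Linked_sub sym LB ut tS.
have FF' x y w : x \in t -> y \in t -> w \in F' x -> w \in F' y -> x = y.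
  move=> xs ys wx wy; apply/eqP/negPn/negP=> xy.
  by have /disjointFr/(_ wx) := F4' _ _ xs ys xy; rewrite wy.
pose W x := \bigcup_(z <- g x) F' z.
have WP x w : reflect (exists2 z, z \in g x & w \in F' z) (w \in W x).
  rewrite /W bigcup_seq; apply: (iffP bigcupP) => -[z]; by exists z.
have gt x z : x \in s -> z \in g x -> z \in t by move=> xs zx; apply/tP; exists x.
have gsorted x : x \in s -> sorted (tie e F') (g x).
  move=> /splitPr E; move/cycle_sorted: F5'; rewrite /t; case: E => p q.
  rewrite map_cat flatten_cat /= => /cat_sorted2[_ /cat_sorted2[]//].
have Wc x : x \in s -> connected_in e (W x).
  move=> xs; apply: conn_bigcup_sorted => //; last exact: gsorted.
    by move=> z /(gt x z xs); apply: F1'.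
  by move=> z /(gt x z xs); apply: F3'.
have gW x z : x \in s -> z \in g x -> z \in W x.
  by move=> xs zx; apply/WP; exists z; rewrite // F1' // (gt x).
exists (fun x => F x :|: W x); split.
- by move=> x xs; rewrite inE F1.
- move=> x xs; apply: setUSS; first exact: F2.
  by apply/subsetP=> w /WP[z zx]; apply/subsetP/F2'/(gt x).
- move=> x xs; set Y := F x :|: W x.
  have [g0|[z0 z0g]] : g x = [::] \/ exists z, z \in g x.
    by case: (g x) => [|z l]; [left | right; exists z; rewrite inE eqxx].
    have -> : Y = F x by rewrite /Y /W g0 big_nil setU0.
    move=> y z yF zF; apply: connect_sub (F3 x xs y z yF zF) => y' z' /andP[/andP[yz yx] zx].
    case/orP: yz => [yz|/and3P[yS _ _]]; first by apply: connect1; rewrite /adj_in /= yz yx zx.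
    by have := gE x y'; rewrite g0 yS yx.
  have Wz z : z \in W x -> connect (adj_in e Y) z0 z.
    by move=> zW; apply: connect_adj_inS (Wc x xs z0 z (gW x z0 xs z0g) zW) => //; apply: subsetUr.
  apply: (@conn_root _ _ _ z0) => // y /setUP[yF|]; last exact: Wz.
  have z0F : z0 \in F x by move: z0g; rewrite gE => /andP[].
  have /connectP[p] := F3 x xs z0 y z0F yF.
  (* Along a path inside [F x] starting at [z0], every vertex of [S] is already joined to [z0]
     within [W x]; an edge to a vertex outside [S] is no clique edge and survives. *)
  elim/last_ind: p y {yF} => [|p z IH] y; first by move=> _ ->; apply: connect0.
  rewrite rcons_path last_rcons => /andP[pp lz] ->.
  have [/andP[lz' lF] zF] := andP lz.
  have [zS|zS] := boolP (z \in S); first by apply/Wz/gW; rewrite // gE zS.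
  apply: connect_trans (IH _ pp erefl) _; apply: connect1.
  case/orP: lz' => [lz'|]; last by rewrite (negPf zS) andbF.
  by rewrite /adj_in /= lz' !inE lF zF.
- have FW x y w : x \in s -> y \in s -> w \in F x -> w \in W y -> x = y.
    move=> xs ys wx /WP[z zy wz]; have zt := gt _ _ ys zy.
    have wS : w \in S by rewrite inE (subsetP (F2 x xs)) // (subsetP (F2' z zt)).
    have wg : w \in g x by rewrite gE wS.
    have wt := gt _ _ xs wg; have E := FF' _ _ w wt zt (F1' w wt) wz.
    by move: zy; rewrite -E gE => /andP[_]; apply: FF.
  have WW x y w : x \in s -> y \in s -> w \in W x -> w \in W y -> x = y.
    move=> xs ys /WP[z zx wz] /WP[z' zy wz'].
    have E := FF' _ _ w (gt _ _ xs zx) (gt _ _ ys zy) wz wz'.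
    move: zx zy; rewrite -E !gE => /andP[_ zx] /andP[_]; exact: FF zx.
  move=> x y xs ys xy; rewrite -setI_eq0; apply/eqP/setP=> w; rewrite [RHS]inE; apply/negP.
  rewrite inE => /andP[/setUP[wx|wx] /setUP[wy|wy]].
  + by rewrite (FF x y w) ?eqxx in xy.
  + by rewrite (FW x y w) ?eqxx in xy.
  + by rewrite (FW y x w) ?eqxx in xy.
  + by rewrite (WW x y w) ?eqxx in xy.
- apply: cycle_from_next => // x xs; set y := next s x; rewrite /tie.
  have ys : y \in s by rewrite mem_next.
  have := next_cycle F5 xs; rewrite -/y /tie; case: eqVneq => //= xy.
  case/touchP=> a [b [aF bF]] /orP[ab|/and3P[aS bS _]].
    by apply/touchP; exists a, b; rewrite !inE aF bF.
  have ag : a \in g x by rewrite gE aS.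
  have bg : b \in g y by rewrite gE bS.
  (* The contact between [F x] and [F y] is a clique edge, so the blocks [g x] and [g y] are both
     non-empty. They are consecutive in [t], hence the last vertex of one is tied to the first of
     the other. *)
  have [n q E] := rot_to xs.
  have yE : y = head x q by rewrite /y -(next_rot n us) E /= ; case: (q) => [|? ?] /=; rewrite eqxx.
  case: q E yE => [|y' q] E /= yE; first by rewrite yE eqxx in xy.
  move: F5'; rewrite -(cycle_flatten_rot _ _ n) E /= -yE => /cycle_sorted.
  rewrite catA => /cat_sorted2[sgg _].
  have [p [a' ga]] : exists p a', g x = rcons p a'.
    by case/lastP: (g x) ag => // p a' _; exists p, a'.
  have [b' [p' gb]] : exists b' p', g y = b' :: p'.
    by case: (g y) bg => // b' p' _; exists b', p'.
  have a'g : a' \in g x by rewrite ga mem_rcons inE eqxx.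
  have b'g : b' \in g y by rewrite gb inE eqxx.
  move: sgg; rewrite ga gb cat_rcons => /cat_sorted2[_ /=/andP[]].
  case/orP=> [/eqP ab _|ab _].
    case/eqP: xy; move: a'g b'g; rewrite !gE ab => /andP[_ bx] /andP[_]; exact: FF bx.
  apply: touchSE ab; apply: subset_trans (subsetUr _ _); apply/subsetP=> w wF; apply/WP.
    by exists a'.
  by exists b'.
Qed.

(* With two dominating vertices, every pair of consecutive roots but one is served by them. *)
Lemma dominators_mlinked V e a b x s D : symmetric e -> uniq s -> size s = 5 ->
  {subset s <= V} -> D \subset V -> a \in V -> b \in V -> a != b -> a \notin s -> b \notin s ->
  {in s, forall y, e a y && e b y} -> {in D, forall y, [&& y \notin s, y != a & y != b]} ->
  x \in s -> connected_in e (x |: D) -> has_edge_between e (x |: D) [set next s x] ->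
  mlinked V e s.
Proof.
move=> sym us s5 sV DV aV bV ab as_ bs_ He HD xs cD tD.
have [n q E] := rot_to xs; apply: (@mlinked_rot _ n).
have u2 : uniq (rot n s) by rewrite rot_uniq.
have sE y : (y \in s) = (y \in rot n s) by rewrite mem_rot.
rewrite -(next_rot n us) in tD; move: s5 tD; rewrite -(size_rot n s).
rewrite E in u2 sE *.
case: q {E} u2 sE => [|x2 [|x3 [|x4 [|x5 []]]]] //= u2 sE _; rewrite eqxx => tD.
have {}sE : s =i [:: x; x2; x3; x4; x5] := sE.
have m1 : [/\ x \in s, x2 \in s, x3 \in s, x4 \in s & x5 \in s] by rewrite !sE !inE !eqxx !orbT.
case: m1 => m1 m2 m3 m4 m5.
have touch1 y z Y Z : y \in Y -> z \in Z -> e y z -> has_edge_between e Y Z.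
  by move=> yY zZ yz; apply/touchP; exists y, z.
have He1 y : y \in s -> [/\ e a y, e y a, e b y & e y b].
  by move=> /He/andP[ay yb]; rewrite ![e y _]sym.
have xx1 y (z : T) : y \in [set y; z] by rewrite !inE eqxx.
have xx2 y (z : T) : z \in [set y; z] by rewrite !inE eqxx orbT.
have xx0 y : y \in [set y] by rewrite inE.
(* In the bag of [x3], [a] reaches [x2] and [x4]; in the bag of [x5], [b] reaches [x4] and [x]. Only
   the contact of [x] with [x2] is left to [D]. *)
pose Bs := [:: x |: D; [set x2]; [set x3; a]; [set x4]; [set x5; b]].
have nD y : y \in s -> y \notin D by move=> ys; apply/negP=> /HD; rewrite ys.
have na y : y \in s -> y != a by move=> ys; apply: contraNneq as_ => <-.
have nb y : y \in s -> y != b by move=> ys; apply: contraNneq bs_ => <-.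
have aD : a \notin D by apply/negP=> /HD; rewrite eqxx andbF.
have bD : b \notin D by apply/negP=> /HD; rewrite eqxx !andbF.
have dB : pairwise (fun A B => [disjoint A & B]) Bs.
{ move: (u2); rewrite /= !inE !negb_or !andbT => /and4P[/and4P[? ? ? ?] /and3P[? ? ?] /andP[? ?] ?].
  rewrite /Bs /= -!setI_eq0; do ?[apply/andP; split] => //; apply/eqP/setP=> w; rewrite !inE;
    apply/negP.
  all: case/andP=> h1 h2; move: h2; try case/orP; move/eqP=> h2; subst w; move: h1.
  all: try case/orP.
  all: apply/negP.
  all: try by [assumption | exact: nD | exact: na | exact: nb | rewrite eq_sym].
  all: by rewrite eq_sym; first [apply: na | apply: nb]. }
apply: (@mlinked_bags _ _ _ Bs) => //.
- by rewrite /= !subUset !sub1set !inE !eqxx DV aV bV /= !sV.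
- move=> B; rewrite !inE => /or4P[/eqP->//|/eqP->|/eqP->|/orP[]/eqP->]; try exact: conn1.
    by apply: connU1; [|exact: conn1| apply: (touch1 x3 a) => //; case: (He1 x3)].
  by apply: connU1; [|exact: conn1| apply: (touch1 x5 b) => //; case: (He1 x5)].
- rewrite /= tD /= andbT; apply/and4P; split.
  + by apply: (touch1 x2 a) => //; case: (He1 x2).
  + by apply: (touch1 a x4) => //; case: (He1 x4).
  + by apply: (touch1 x4 b) => //; case: (He1 x4).
  + by apply: (touch1 b x) => //; [rewrite !inE eqxx | case: (He1 x)].
Qed.
End Lifting.

(** * Counting edges *)

Section Density.
Variable T : finType.
Implicit Types (e : rel T) (u v x y z : T) (V X Y Z A B C D S W : {set T}).

(** Edges as ordered pairs, so that edge counts are compared through inclusions and injections of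
    sets of pairs; [double_rh] accounts for the factor two. *)
Definition inc e V Y : {set T * T} :=
  [set p | [&& p.1 \in V, p.2 \in V, e p.1 p.2 & (p.1 \in Y) || (p.2 \in Y)]].

Lemma incE e V Y x y :
  ((x, y) \in inc e V Y) = [&& x \in V, y \in V, e x y & (x \in Y) || (y \in Y)].
Proof. by rewrite inE. Qed.

Definition rh e V Y := rho (adj_in e V) Y.

Definition nb e A v : {set T} := [set z in A | e v z].

Lemma double_rh e V Y : symmetric e -> irreflexive e -> (rh e V Y).*2 = #|inc e V Y|.
Proof.
move=> sym irr; rewrite /rh /rho; set E := [set _ in _ | _].
pose phi (p : T * T) : {set T} := [set p.1; p.2].
have phiE p : p \in inc e V Y -> phi p \in E.
  case: p => x y; rewrite incE => /and4P[xV yV xy xyY]; rewrite !inE; apply/andP; split.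
    by apply/existsP; exists x; apply/existsP; exists y; rewrite /adj_in /= xy xV yV /phi eqxx.
  apply/set0Pn; case/orP: xyY => ?; [exists x|exists y]; by rewrite !inE eqxx ?orbT.
rewrite -[RHS]sum1_card (partition_big phi (mem E)) //= -muln2 -sum_nat_const.
apply: eq_bigr => F; rewrite !inE => /andP[/existsP[x /existsP[y /andP[xy /eqP FE]]] /set0Pn[z]].
rewrite FE !inE => /andP[zxy zY].
have [/andP[exy xV] yV] := andP xy.
have nxy : x != y by apply: contraTneq exy => ->; rewrite irr.
have xyY : (x \in Y) || (y \in Y).
  by case/orP: zxy zY => /eqP-> ->; rewrite ?orbT.
rewrite sum1dep_card.
rewrite (_ : [set _ | _] = [set (x, y); (y, x)]) ?cards2 ?xpair_eqE ?(negPf nxy) //.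
apply/setP=> -[a b]; rewrite in_set2 inE incE /phi /= !xpair_eqE.
apply/andP/orP => [[/and4P[_ _ eab _] /eqP ab]|[]/andP[/eqP-> /eqP->]]; last first.
- by rewrite xV yV sym exy orbC xyY setUC eqxx.
- by rewrite xV yV exy xyY eqxx.
have nab : a != b by apply: contraTneq eab => ->; rewrite irr.
have := set21 a b; have := set22 a b; rewrite ab !inE.
case/orP=> /eqP eb /orP[] /eqP ea; rewrite ea eb ?eqxx;
  [by rewrite ea eb eqxx in nab|by right|by left|by rewrite ea eb eqxx in nab].
Qed.

Lemma rh_le e e' V V' Y Y' : symmetric e -> irreflexive e -> symmetric e' -> irreflexive e' ->
  inc e V Y \subset inc e' V' Y' -> rh e V Y <= rh e' V' Y'.
Proof. by move=> *; rewrite -leq_double !double_rh // subset_leq_card. Qed.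

Lemma rh_eq e e' V V' Y Y' : symmetric e -> irreflexive e -> symmetric e' -> irreflexive e' ->
  inc e V Y = inc e' V' Y' -> rh e V Y = rh e' V' Y'.
Proof. by move=> s i s' i' E; apply: double_inj; rewrite !double_rh ?E. Qed.

Lemma addK_irr e S : irreflexive e -> irreflexive (addK e S).
Proof. by move=> irr x; rewrite /addK /= irr eqxx !andbF. Qed.

Lemma del_irr e u v : irreflexive e -> irreflexive (del e u v).
Proof. by move=> irr x; rewrite /del /= irr. Qed.

Lemma ctr_irr e u v : irreflexive (ctr e u v).
Proof. by move=> x; rewrite /ctr /= eqxx. Qed.

Section Fixed.
Variable e : rel T.
Hypotheses (sym : symmetric e) (irr : irreflexive e).

Lemma rhU V Y Z : rh e V (Y :|: Z) <= rh e V Y + rh e V Z.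
Proof.
rewrite -leq_double doubleD !double_rh //; apply: leq_trans (leq_card_setU _ _).
apply: subset_leq_card; apply/subsetP=> -[x y]; rewrite in_setU !incE !inE.
by case: (x \in V); case: (y \in V); case: (e x y) => //=; do 4!case: (_ \in _).
Qed.

(** An edge that misses [V :\: A] lies inside [A]. *)
Lemma rh_restrict V A X : X \subset A -> A \subset V ->
  rh e V (V :\: X) = rh e V (V :\: A) + rh e A (A :\: X).
Proof.
move=> /subsetP XA /subsetP AV; apply: double_inj; rewrite doubleD !double_rh //.
rewrite -cardsUI (_ : _ :&: _ = set0) ?cards0 ?addn0.
  apply: eq_card => -[x y]; rewrite in_setU !incE !inE.
  have := XA x; have := XA y; have := AV x; have := AV y.
  case: (e x y); rewrite ?andbF //=.
  case: (x \in V); case: (y \in V); case: (x \in A); case: (y \in A); case: (x \in X);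
    case: (y \in X) => //=;
  by move=> H1 H2 H3 H4; first [have := H1 isT|have := H2 isT|have := H3 isT|have:= H4 isT].
apply/setP=> -[x y]; rewrite in_setI in_set0 !incE !inE.
by case: (x \in A); case: (y \in A); rewrite ?andbF.
Qed.

Lemma rh_local V B Y : Y \subset B -> B \subset V ->
  (forall x y, x \in Y -> y \in V -> e x y -> y \in B) -> rh e V Y = rh e B Y.
Proof.
move=> /subsetP YB /subsetP BV H; apply: rh_eq => //; apply/setP=> -[x y]; rewrite !incE.
apply/and4P/and4P=> -[xV yV xy xyY]; split=> //; try exact: BV.
- by case/orP: xyY => [/YB//|yY]; apply: (H y); rewrite // sym.
- by case/orP: xyY => [xY|/YB//]; apply: (H x).
Qed.

Lemma rh_vertex A v : v \notin A -> rh e (v |: A) [set v] = #|nb e A v|.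
Proof.
move=> vA; apply: double_inj; rewrite double_rh // -addnn.
have pinj z : injective (pair z : T -> T * T) by move=> a b [].
have sinj z : injective (fun w => (w, z) : T * T) by move=> a b [].
rewrite -{1}(card_imset _ (pinj v)) -(card_imset (nb e A v) (sinj v)).
rewrite -cardsUI (_ : _ :&: _ = set0) ?cards0 ?addn0.
  apply: eq_card => -[x y]; rewrite in_setU incE !inE.
  apply/and4P/orP => [[/orP xA /orP yA xy xyv]|].
    case/orP: xyv => /eqP E; [left|right]; rewrite E in xA yA xy *.
      apply: imset_f; rewrite inE xy andbT; case: yA => // /eqP yv; by rewrite yv irr in xy.
    apply/imsetP; exists x => //; rewrite inE sym xy andbT; case: xA => // /eqP yv;
      by rewrite yv irr in xy.
  case=> /imsetP[z]; rewrite inE => /andP[zA vz] [-> ->]; rewrite ?eqxx zA ?orbT; split=> //.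
  by rewrite sym.
apply/setP=> -[x y]; rewrite in_setI in_set0; apply/negP=> /andP[/imsetP[z zA [-> ->]] /imsetP[w]].
by rewrite inE => /andP[wA _] [vw _]; rewrite vw wA in vA.
Qed.

Lemma rh_add_vertex A X v : v \notin A -> X \subset A ->
  rh e (v |: A) ((v |: A) :\: X) = #|nb e A v| + rh e A (A :\: X).
Proof.
move=> vA XA; rewrite (@rh_restrict _ A) ?subsetUr //; congr (_ + _).
by rewrite -rh_vertex //; congr rh; rewrite setDUl setDv setU0; apply/setDidPl; rewrite disjoints1.
Qed.

Lemma rh_addK V S Y : [disjoint Y & S] -> rh (addK e S) V Y = rh e V Y.
Proof.
move=> YS; apply: rh_eq => //; [exact: addK_sym | exact: addK_irr |].
apply/setP=> -[x y]; rewrite !incE /addK /=.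
have := disjointFr YS (x := x); have := disjointFr YS (x := y).
case: (x \in Y); case: (y \in Y) => //= H1 H2; rewrite ?andbF ?andbT //.
- by rewrite H1 // ?andbF ?orbF.
- by rewrite H2 // ?andbF ?orbF.
- by rewrite H1 // ?andbF ?orbF.
Qed.

Lemma rh_del V Y u v : u \in V -> v \in V -> e u v -> (u \in Y) || (v \in Y) ->
  rh e V Y = (rh (del e u v) V Y).+1.
Proof.
move=> uV vV uv uvY; apply: double_inj; rewrite doubleS !double_rh //; [|exact: del_sym|exact: del_irr].
have nuv : u != v by apply: contraTneq uv => ->; rewrite irr.
have ->: inc (del e u v) V Y = inc e V Y :\: [set (u, v); (v, u)].
  apply/setP=> -[x y]; rewrite in_setD in_set2 !incE /del /= !xpair_eqE.
  by case: (x \in V); case: (y \in V); case: (e x y); rewrite ?andbF //= ?andbT.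
have sub : [set (u, v); (v, u)] \subset inc e V Y.
  by rewrite subUset !sub1set !incE uV vV uv sym uv uvY orbC uvY.
rewrite cardsD (setIidPr sub) cards2 xpair_eqE (negPf nuv) /=.
by have := subset_leq_card sub; rewrite cards2 xpair_eqE (negPf nuv) /= => ?; rewrite -addn2 subnK.
Qed.

(** An edge that appears only through the contraction is sent back to its original at [v]. This is
    injective because the remaining edges avoid [v]. Heaviness away from [u] and [v] thus lifts from
    the contraction. *)
Lemma rh_ctr_local V Y u v : u \in V -> v \in V -> e u v -> u \notin Y -> v \notin Y ->
  rh (ctr e u v) (V :\ v) Y <= rh e V Y.
Proof.
move=> uV vV uv uY vY; rewrite -leq_double !double_rh //; [|exact: ctr_sym|exact: ctr_irr].
pose h (p : T * T) := if e p.1 p.2 then p else if p.1 == u then (v, p.2) else (p.1, v).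
rewrite -(@card_in_imset _ _ h).
  apply: subset_leq_card; apply/subsetP=> _ /imsetP[[x y] xy ->].
  move: xy; rewrite incE !in_setD1 /h /= => /and4P[/andP[xv xV] /andP[yv yV] /andP[xy cxy] xyY].
  case: ifP => [exy|nexy]; first by rewrite incE exy xV yV.
  rewrite nexy /= in cxy; case: eqP => xu.
    rewrite xu (negPf uY) /= in xyY; rewrite incE vV yV xyY orbT andbT.
    case/orP: cxy => /andP[//]; rewrite xu; move=> /eqP yu; by rewrite xu yu eqxx in xy.
  move: cxy; case: eqP => //= _ /andP[/eqP yu xv']; rewrite yu (negPf uY) orbF in xyY.
  by rewrite incE vV xV xv' xyY.
move=> [x y] [x' y']; rewrite !incE !inE /h /ctr /=.
move=> /and4P[/andP[xv xV] /andP[yv yV] /andP[xy cxy] xyY].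
move=> /and4P[/andP[xv' xV'] /andP[yv' yV'] /andP[xy' cxy'] xyY'].
have nv1 : (x == v) = false by apply/negbTE.
have nv2 : (y == v) = false by apply/negbTE.
have nv3 : (x' == v) = false by apply/negbTE.
have nv4 : (y' == v) = false by apply/negbTE.
move: cxy cxy'; case: (e x y); case: (e x' y') => //=.
- move=> _ _; case: eqP => _ [E1 E2]; [by rewrite E1 eqxx in nv1|by rewrite E2 eqxx in nv2].
- move=> _ _; case: eqP => _ [E1 E2]; [by rewrite -E1 eqxx in nv3|by rewrite -E2 eqxx in nv4].
- case: (eqVneq x u) => [->|xu]; case: (eqVneq x' u) => [->|xu'] /=.
  + by move=> _ _ [->].
  + by move=> _ _ [E1 E2]; rewrite -E1 eqxx in nv3.
  + by move=> _ _ [E1 E2]; rewrite E1 eqxx in nv1.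
  + by move=> /andP[/eqP-> _] /andP[/eqP-> _] [->].
Qed.

(** Lost are the edge [uv], one edge for each common neighbour and, if [u] is in [X], the edges from
    [v] to [X], which become edges inside [X] and are no longer counted. This is why edges inside
    [X] count as present among common neighbours. *)
Lemma rh_ctr V X u v : u \in V -> v \in V -> e u v -> X \subset V -> v \notin X ->
  rh e V (V :\: X) <= rh (ctr e u v) (V :\ v) ((V :\ v) :\: X) + 1 +
    #|[set z in V | [&& z != u, e v z & e u z || (u \in X) && (z \in X)]]|.
Proof.
move=> uV vV uv XV vX; set C := [set z in V | _]; set V' := V :\ v.
have XV' : X \subset V' by rewrite subsetD1 XV.
have vV' : v \notin V' by rewrite !inE eqxx.
have nuv : u != v by apply: contraTneq uv => ->; rewrite irr.
have VE : V = v |: V' by rewrite /V' setD1K.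
rewrite {1 2}VE rh_add_vertex //.
(* The neighbours of [v] whose edge survives as a new counted edge at [u]. *)
pose W := [set z in V' | [&& z != u, e v z, ~~ e u z & ~~ ((u \in X) && (z \in X))]].
have nbE : nb e V' v \subset u |: (C :|: W).
  apply/subsetP=> z; rewrite !inE => /andP[/andP[zv zV] vz].
  by rewrite zv zV vz /=; case: eqP => //= _; case: (e u z) => //=; case: (_ && _).
have c1 : #|nb e V' v| <= 1 + #|C| + #|W|.
  apply: leq_trans (subset_leq_card nbE) _; rewrite -addnA -(cards1 u).
  apply: leq_trans (leq_card_setU _ _) _; rewrite leq_add2l; exact: leq_card_setU.
suff: rh e V' (V' :\: X) + #|W| <= rh (ctr e u v) V' (V' :\: X) by lia.
rewrite -leq_double doubleD !double_rh //; [|exact: ctr_sym|exact: ctr_irr].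
have pinj z : injective (pair z : T -> T * T) by move=> a b [].
have sinj z : injective (fun w => (w, z) : T * T) by move=> a b [].
rewrite -addnn -{1}(card_imset _ (pinj u)) -(card_imset W (sinj u)).
rewrite -cardsUI (_ : _ @: _ :&: _ @: _ = set0) ?cards0 ?addn0; last first.
  apply/setP=> -[x y]; rewrite in_setI in_set0; apply/negP=> /andP[/imsetP[z zA [-> ->]] /imsetP[w]].
  by rewrite inE => /andP[_ /and4P[wu _ _ _]] [uw _]; rewrite uw eqxx in wu.
rewrite -cardsUI (_ : _ :&: _ = set0) ?cards0 ?addn0; last first.
  apply/setP=> -[x y]; rewrite in_setI incE in_set0; apply/negP=> /andP[/and4P[_ _ xy _]].
  rewrite in_setU => /orP[]/imsetP[z]; rewrite inE => /andP[_ /and4P[_ _ nuz _]] [E1 E2].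
    by rewrite E1 E2 (negPf nuz) in xy.
  by rewrite E1 E2 sym (negPf nuz) in xy.
apply: subset_leq_card; apply/subsetP=> -[x y]; rewrite !in_setU !incE !inE /= => /or3P[].
- move=> /and4P[-> -> xy ->]; rewrite /ctr /= xy andbT; apply/andP; split=> //.
  by apply: contraTneq xy => ->; rewrite irr.
- case/imsetP=> z; rewrite !inE => /andP[/andP[zv zV] /and4P[zu vz _ XX]] [-> ->].
  rewrite nuv uV zv zV /ctr /= eq_sym zu eqxx vz orbT /=.
  by move: XX; case: (u \in X); case: (z \in X).
- case/imsetP=> z; rewrite !inE => /andP[/andP[zv zV] /and4P[zu vz _ XX]] [-> ->].
  rewrite nuv uV zv zV /ctr /= zu eqxx [e z v]sym vz !orbT /=.
  by move: XX; case: (u \in X); case: (z \in X).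
Qed.

Lemma card_pairs (P : pred T) (r : rel T) :
  #|[set p : T * T | P p.1 && r p.1 p.2]| = \sum_(x | P x) #|[set y | r x y]|.
Proof.
rewrite -sum1_card (eq_bigl (fun p : T * T => P p.1 && r p.1 p.2)) => [|p]; last by rewrite inE.
rewrite -(pair_big_dep P (fun x y => r x y) (fun _ _ => 1)) /=.
by apply: eq_bigr => x _; rewrite -sum1_card; apply: eq_bigl => y; rewrite inE.
Qed.

(** An edge inside [V :\: X] is seen from both ends. An edge to [X] is seen from one end only, and
    the second summand counts it again. *)
Lemma degree_sum V X : X \subset V ->
  \sum_(v in V :\: X) (#|nb e V v| + #|nb e X v|) = (rh e V (V :\: X)).*2.
Proof.
move=> /subsetP XV; rewrite double_rh // big_split /= -!card_pairs.
pose sw (p : T * T) := (p.2, p.1).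
have swI : injective sw by move=> [a b] [c d] [-> ->].
rewrite -(card_imset [set p | (p.1 \in V :\: X) && ((p.2 \in X) && e p.1 p.2)] swI).
rewrite -cardsUI (_ : _ :&: _ = set0) ?cards0 ?addn0.
  apply: eq_card => -[x y]; rewrite in_setU incE.
  have -> : ((x, y) \in [set sw p | p in [set p | (p.1 \in V :\: X) && ((p.2 \in X) && e p.1 p.2)]]) =
            (y \in V :\: X) && ((x \in X) && e y x).
    apply/imsetP/idP => [[[a b]]|H]; first by rewrite inE /sw /= => H [-> ->].
    by exists (y, x); rewrite // inE.
  rewrite !inE /= (sym y x); have := XV x.
  case: (e x y); case: (x \in X); case: (y \in X); case: (x \in V); case: (y \in V) => //=;
  by move=> /(_ isT).
apply/setP=> -[x y]; rewrite in_setI in_set0 inE /=; apply/negP=> /andP[/andP[xX _]].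
move/imsetP=> [[a b]]; rewrite !inE /= => /and3P[_ bX _] [E _].
by move: xX; rewrite E inE bX.
Qed.
End Fixed.
End Density.

(** * Rooted C_5-minors in a dense neighbourhood *)

(* Certificates for a finite case analysis. Roots are numbered 0..4 in cyclic order, the other
   vertices 5, 6, ...; a further vertex adjacent to everything is left implicit.
   [Branch a b] distinguishes whether a and b are adjacent. [Model i a b c d] describes a minor
   in which the implicit vertex joins the bag of root i and a, b, c, d (0 for none) join the bags
   of the next four roots; [ModelChain j w i a b c d] moreover appends w to the (j+1)-st of
   these four bags. *)
Inductive cert :=
| Model of nat & nat & nat & nat & nat
| ModelChain of nat & nat & nat & nat & nat & nat & nat
| Branch of nat & nat & cert & cert.

Section Checker.
Variables (m : nat) (pairs : seq (nat * nat)) (limited : nat -> bool).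

Definition pair_in (p : nat * nat) l := has (fun q => eqn q.1 p.1 && eqn q.2 p.2) l.

(** The pairs whose adjacency is under control: those with an end outside the roots, and the pairs
    of roots listed in [pairs]. *)
Definition tracked (p : nat * nat) := [&& p.1 < p.2, p.2 < 5 + m & (4 < p.2) || pair_in p pairs].

Definition ordered a b := if a < b then (a, b) else (b, a).

Definition incident w := fun p : nat * nat => eqn p.1 w || eqn p.2 w.

(* A vertex with [m - 1] known non-neighbours is adjacent to all its other tracked vertices. *)
Definition saturated F w := limited w && (m <= (count (incident w) F).+1).

Definition known P F a b :=
  pair_in (ordered a b) P || [&& tracked (ordered a b),
    saturated F a || saturated F b & ~~ pair_in (ordered a b) F].

(** The cycle of roots written out nearly twice, so that indices up to 4 + 4 need no reduction. *)
Definition root_at i j := nth 0 [:: 0; 1; 2; 3; 4; 0; 1; 2; 3] (i + j).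

Definition link P F l l' := has (fun a => has (known P F a) l') l.

(** The implicit vertex is in the bag of root [i] and is adjacent to every root, which settles the
    two contacts of that bag. Three contacts are left to check. *)
Definition plan P F i b1 b2 b3 b4 :=
  let l1 := root_at i 1 :: b1 in let l2 := root_at i 2 :: b2 in
  let l3 := root_at i 3 :: b3 in let l4 := root_at i 4 :: b4 in
  [&& i < 5, uniq (root_at i 0 :: l1 ++ l2 ++ l3 ++ l4),
    all (fun z => z < 5 + m) (b1 ++ b2 ++ b3 ++ b4),
      path (known P F) (root_at i 1) b1, path (known P F) (root_at i 2) b2,
        path (known P F) (root_at i 3) b3,
      path (known P F) (root_at i 4) b4 &
      [&& link P F l1 l2, link P F l2 l3 & link P F l3 l4]].

(** The value 0 can stand for no vertex because 0 is a root and never occurs as an additional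
    vertex. *)
Definition extra a : seq nat := if a is 0 then [::] else [:: a].

Definition extra_chain j k w a := if eqn j k then extra a ++ [:: w] else extra a.

Fixpoint check P F t := match t with
  | Model i a b c d => plan P F i (extra a) (extra b) (extra c) (extra d)
  | ModelChain j w i a b c d => plan P F i (extra_chain j 0 w a) (extra_chain j 1 w b) (extra_chain
    j 2 w c) (extra_chain j 3 w d)
  | Branch a b t1 t0 => [&& tracked (a, b), ~~ pair_in (a, b) F,
                        check ((a, b) :: P) F t1 & check P ((a, b) :: F) t0]
  end.

Lemma pair_inE p l : pair_in p l = (p \in l).
Proof.
case: p => a b; rewrite /pair_in; elim: l => //= -[c d] l ->; rewrite inE xpair_eqE /= !eqnE.
by rewrite [a == c]eq_sym [b == d]eq_sym.
Qed.

Lemma orderedC a b : ordered a b = ordered b a.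
Proof. by rewrite /ordered; case: ltngtP => // ->. Qed.

Lemma tracked_lt a b : tracked (ordered a b) -> [/\ a < 5 + m, b < 5 + m & a != b].
Proof.
by rewrite /tracked /ordered; case: (ltnP a b) => ab /and3P[] /= lt1 lt2 _; split; lia.
Qed.

Section Soundness.
Variables (T : finType) (e : rel T) (V : {set T}) (v : T) (g : nat -> T).
Hypotheses (sym : symmetric e) (g_inj : {in gtn (5 + m) &, injective g}).
Hypotheses (gV : forall i, i < 5 + m -> g i \in V) (vV : v \in V).
Hypotheses (vg : forall i, i < 5 + m -> v != g i) (vadj : forall i, i < 5 -> e v (g i)).
Hypothesis limited_few : forall w l, w < 5 + m -> limited w -> uniq l ->
  (forall z, z \in l -> [/\ z < 5 + m, tracked (ordered w z) & ~~ e (g w) (g z)]) -> size l < m.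

Definition inv (P F : seq (nat * nat)) := [/\ {in P, forall p, e (g p.1) (g p.2)},
  {in F, forall p, tracked p && ~~ e (g p.1) (g p.2)} & uniq F].

Lemma ordered_adj (p : nat * nat) a b : ordered a b = p -> e (g p.1) (g p.2) = e (g a) (g b).
Proof. by move=> <-; rewrite /ordered; case: (ltnP a b) => // _; rewrite sym. Qed.

(** If [g a] and [g b] were not adjacent, [b] together with the recorded non-neighbours of [a] would
    be at least [m] distinct tracked non-neighbours, against [limited_few]. *)
Lemma saturated_sound P F a b : inv P F -> saturated F a -> tracked (ordered a b) ->
  ordered a b \notin F ->
  e (g a) (g b).
Proof.
move=> [_ HF uF] /andP[ca le_m] tab nF; apply/negPn/negP=> nab.
pose oth (p : nat * nat) := if p.1 == a then p.2 else p.1.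
pose Fa := filter (incident a) F.
have [a5 b5 nab'] := tracked_lt tab.
have FaP p : p \in Fa -> p = ordered a (oth p) /\ oth p != a.
  rewrite mem_filter /incident !eqnE => /andP[pa /HF/andP[/and3P[lt _ _] _]].
  move: pa lt; case: p => c d /=; rewrite /oth /ordered /=.
  case: eqP => [->|/eqP ca'] /=; first by move=> _ lt; rewrite lt neq_ltn lt orbT.
  by move=> /eqP-> lt; rewrite ltnNge ltnW.
suff: size (b :: map oth Fa) < m.
  rewrite /= size_map size_filter; by move/leq_trans/(_ le_m); rewrite ltnn.
apply: (limited_few a5) => //=.
  apply/andP; split.
    apply/negP=> /mapP[p pFa bp]; have [pE _] := FaP p pFa.
    by move: pFa; rewrite mem_filter pE -bp (negPf nF) andbF.
  rewrite map_inj_in_uniq ?filter_uniq // => p q /FaP[pE _] /FaP[qE _] E.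
  by rewrite pE E -qE.
move=> z; rewrite inE => /predU1P[->//|/mapP[p pFa zp]].
have [pE _] := FaP p pFa; move: pFa; rewrite mem_filter => /andP[_ /HF/andP[tp np]].
rewrite {1}pE -zp in tp; have [_ z5 _] := tracked_lt tp; split=> //.
by rewrite -(@ordered_adj p) // zp -pE.
Qed.

Lemma known_sound P F a b : inv P F -> known P F a b -> e (g a) (g b).
Proof.
move=> I; rewrite /known !pair_inE => /orP[pP|/and3P[t /orP[]s n]].
- by have [HP _ _] := I; rewrite -(ordered_adj erefl); apply: HP.
- exact: saturated_sound I s t n.
- by rewrite sym; apply: (saturated_sound I s); rewrite ?(orderedC b a).
Qed.

Lemma conn_path x p : path e x p -> connected_in e [set z in x :: p].
Proof.
elim: p x => [|y p IH] x /=; first by move=> _; rewrite set_seq1 ; apply: conn1.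
case/andP=> xy yp; rewrite set_cons; apply: connU1 => //; first exact: IH.
by apply/touchP; exists x, y; rewrite !inE !eqxx.
Qed.

Lemma pairwise_disjoint (ls : seq (seq T)) : uniq (flatten ls) ->
  pairwise (fun A B : {set T} => [disjoint A & B]) [seq [set z in l] | l <- ls].
Proof.
elim: ls => //= l ls IH; rewrite cat_uniq => /and3P[_ H /IH->]; rewrite andbT.
apply/allP=> _ /mapP[l' l'ls ->]; rewrite -setI_eq0; apply/eqP/setP=> z.
rewrite !inE; apply/negP=> /andP[zl zl']; case/hasP: H; exists z => //.
by apply/flattenP; exists l'.
Qed.

Lemma plan_sound P F i b1 b2 b3 b4 : inv P F -> plan P F i b1 b2 b3 b4 ->
  mlinked V e (map g (iota 0 5)).
Proof.
move=> I /and5P[i5 u a5 p1 /and4P[p2 p3 p4 /and3P[l12 l23 l34]]].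
have rE : rot i (iota 0 5) = [:: root_at i 0; root_at i 1; root_at i 2; root_at i 3; root_at i 4].
  by move: i5; clear; do 5?[case: i => [//|i]].
apply: (@mlinked_rot _ i); rewrite -map_rot rE.
have r5 j : j < 5 -> root_at i j < 5.
  by move: i5; clear; do 5?[case: i => [|i]] => //; do 5?[case: j => [//|j]].
have kpath x p : path (known P F) x p -> path e (g x) (map g p).
  elim: p x => //= y p IH x /andP[xy yp]; by rewrite (known_sound I xy) IH.
have klink l l' : link P F l l' -> has_edge_between e [set z in map g l] [set z in map g l'].
  case/hasP=> a al /hasP[b bl ab]; apply/touchP; exists (g a), (g b).
  by rewrite !inE !map_f //; split=> //; apply: known_sound ab.
pose ls := [:: [:: g (root_at i 0); v]; map g (root_at i 1 :: b1); map g (root_at i 2 :: b2);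
               map g (root_at i 3 :: b3); map g (root_at i 4 :: b4)].
have lt5 z : z \in root_at i 0 :: (root_at i 1 :: b1) ++ (root_at i 2 :: b2) ++ (root_at i 3 :: b3)
  ++ (root_at i 4 :: b4) -> z < 5 + m.
  have rlt j : j < 5 -> root_at i j < 5 + m by move=> /r5 lt; apply: leq_trans lt _; apply: leq_addr.
  have blt z' : z' \in b1 ++ b2 ++ b3 ++ b4 -> z' < 5 + m by move/allP: a5; apply.
  rewrite !(inE, mem_cat) => H.
  have {H} : (exists2 j, j < 5 & z = root_at i j) \/ z \in b1 ++ b2 ++ b3 ++ b4.
    rewrite !mem_cat; case/orP: H => [/eqP->|]; first by left; exists 0.
    case/orP=> [/eqP->|]; first by left; exists 1.
    case/orP=> [->|]; first by right.
    case/orP=> [/eqP->|]; first by left; exists 2.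
    case/orP=> [->|]; first by right; rewrite orbT.
    case/orP=> [/eqP->|]; first by left; exists 3.
    case/orP=> [->|]; first by right; rewrite !orbT.
    by case/orP=> [/eqP->|->]; [left; exists 4 | right; rewrite !orbT].
  by case=> [[j /rlt lt ->]|/blt].
have ul : uniq (flatten ls).
  have -> : flatten ls = g (root_at i 0) :: v :: map g ((root_at i 1 :: b1) ++ (root_at i 2 :: b2)
    ++ (root_at i 3 :: b3) ++ (root_at i 4 :: b4)).
    rewrite /ls /flatten /= cats0 !(map_cat, map_cons) /=. by [].
  move: u lt5; move: ((root_at i 1 :: b1) ++ _) => L u lt5.
  have := u; rewrite -(map_inj_in_uniq (f := g)); last first.
    by move=> x y xL yL; apply: g_inj; rewrite inE lt5.
  rewrite map_cons cons_uniq => /andP[rL uL]; rewrite !cons_uniq inE negb_or rL uL andbT.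
  rewrite eq_sym vg ?lt5 ?inE ?eqxx //=; rewrite andbT; apply/mapP=> -[z zL vz].
  by have := vg (lt5 z _); rewrite vz eqxx inE zL orbT => /(_ isT).
have rg j : j < 5 -> root_at i j < 5 + m.
  by move=> /r5 lt; apply: leq_trans lt _; apply: leq_addr.
have lV j b : j < 5 -> {subset b <= b1 ++ b2 ++ b3 ++ b4} ->
  [set z in g (root_at i j) :: map g b] \subset V.
  move=> j5 bb; apply/subsetP=> z; rewrite inE => /(@mapP _ _ g (root_at i j :: b))[y];
    rewrite inE => /predU1P[->|yb] ->; apply: gV.
    exact: rg.
  by apply: (allP a5); apply: bb.
apply: (mlinked_bags (Bs := [seq [set z in l] | l <- ls])); last 2 first.
- exact: pairwise_disjoint.
- rewrite /= (klink _ _ l12) (klink _ _ l23) (klink _ _ l34) /= andbT; apply/andP; split.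
    by apply/touchP; exists v, (g (root_at i 1)); rewrite !inE !eqxx ?orbT vadj ?r5.
  by apply/touchP; exists (g (root_at i 4)), v; rewrite !inE !eqxx ?orbT sym vadj ?r5.
- rewrite map_inj_in_uniq; last first.
    move=> x y xL yL; apply: g_inj; rewrite inE.
      by move: xL; rewrite !inE; do 4?[case/orP=> [/eqP->|]; first exact: rg]; move/eqP->; apply: rg.
    by move: yL; rewrite !inE; do 4?[case/orP=> [/eqP->|]; first exact: rg]; move/eqP->; apply: rg.
  by move: i5; clear; do 5?[case: i => [//|i]].
- have bb1 : {subset b1 <= b1 ++ b2 ++ b3 ++ b4} by move=> z zb; rewrite !mem_cat zb.
  have bb2 : {subset b2 <= b1 ++ b2 ++ b3 ++ b4} by move=> z zb; rewrite !mem_cat zb !orbT.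
  have bb3 : {subset b3 <= b1 ++ b2 ++ b3 ++ b4} by move=> z zb; rewrite !mem_cat zb !orbT.
  have bb4 : {subset b4 <= b1 ++ b2 ++ b3 ++ b4} by move=> z zb; rewrite !mem_cat zb !orbT.
  rewrite /= (lV 1 b1) // (lV 2 b2) // (lV 3 b3) // (lV 4 b4) // !inE !eqxx /= andbT.
  apply/subsetP=> z; rewrite !inE => /orP[]/eqP-> //; apply: gV; exact: rg.
- have cg j b : j < 5 -> path (known P F) (root_at i j) b ->
  connected_in e [set z in map g (root_at i j :: b)].
    by move=> j5 /kpath; apply: conn_path.
  move=> B; rewrite !inE => /or4P[/eqP->|/eqP->|/eqP->|/orP[]/eqP->]; try exact: cg.
  by apply: conn_path; rewrite /= sym vadj ?r5.
Qed.

Lemma check_sound t P F : inv P F -> check P F t -> mlinked V e (map g (iota 0 5)).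
Proof.
elim: t P F => [i a b c d|j w i a b c d|a b t1 IH1 t0 IH0] P F I /=.
- exact: plan_sound.
- exact: plan_sound.
case/and4P=> tab nab c1 c0; have [HP HF uF] := I.
have [ab|ab] := boolP (e (g a) (g b)).
  apply: (IH1 ((a, b) :: P) F) => //; split=> // p; rewrite inE => /predU1P[->//|]; exact: HP.
apply: (IH0 P ((a, b) :: F)) => //; split=> //.
  by move=> p; rewrite inE => /predU1P[->|]; [rewrite tab ab | apply: HF].
by rewrite /= uF andbT -pair_inE.
Qed.

End Soundness.
End Checker.

(** The character code of 0 is 48. At most ten vertices are numbered, so one digit names a
    vertex. *)
Definition digit c := Nat.sub (nat_of_ascii c) 48.

(* Certificates are written in postfix order; the parser is not trusted. *)
Fixpoint parse_onto (st : seq cert) (str : string) : cert := match str with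
  | String "L" (String i (String a (String b (String c (String d r))))) =>
      parse_onto (Model (digit i) (digit a) (digit b) (digit c) (digit d) :: st) r
  | String "C" (String j (String w (String i (String a (String b (String c (String d r))))))) =>
      parse_onto (ModelChain (digit j) (digit w) (digit i) (digit a) (digit b) (digit c) (digit d) :: st) r
  | String "B" (String a (String b r)) =>
      if st is t0 :: t1 :: st' then parse_onto (Branch (digit a) (digit b) t1 t0 :: st') r
      else parse_onto st r
  | String _ r => parse_onto st r
  (* The default has root index 5, which [plan] rejects, so an empty stack never passes the
     check. *)
  | EmptyString => head (Model 5 0 0 0 0) st
  end%char.

Definition parse := parse_onto [::].

Definition cyc_pairs := [:: (0, 1); (1, 2); (2, 3); (3, 4); (0, 4)].

(** The adjacencies of consecutive roots are fixed in advance, so that rotations of one pattern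
    share a certificate. *)
Definition check_pattern m b t :=
  check m cyc_pairs predT (mask b cyc_pairs) (mask (map negb b) cyc_pairs) t.

Local Open Scope string_scope.

Definition cert2 := parse
"L00506L00560B35L20650B25L40560L00605B05B46L30605L00650B25B36L00650L10506B26L10506B16B15".

Definition cert3 := parse
"L00000L10000L00500L00600L00700B16B25L00600L00700B26B15B04B12L00005L00006L00007B36B45L00006L00007
B46B35L10050L10060L10070B36B45L10060L10070B46B35L10050L10065B35L10060L10070B36B05B04B12B34L10500
L10600L00070B26B35L00060L00070B36B25L00050L00060L00070B26B35L00060L00070B36B25L00500L00560B35
L00600L00700B36B15B12B04L00056L10600L00506L00605B15B04B12L10500B46L00060L00070B46B25B34B23".

(** The keys are the eight binary patterns of length five up to rotation. *)
Definition certs4 := [::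
  ([:: false; false; false; false; false], parse
"L00506L00507L00508B37B46L00507L00508B47B36L00560L00576B26L00570L00580B27B46B35L40560L40576B16
L10750L05670L20750B56B45B36L30670L30870B46L30760L30608B47B17B05B25L30607L30807L30570B08B46L40605
L40608B35B27L20507L40760L30570B26B35L20670L20708B36B45B06B15");
  ([:: false; false; false; false; true], parse
"L10500L10560L10560L10570L10580B47B56B36L10570L10580B37B46B45L10600L10760B26L10700L10670B27L10800
L10680B28B47B46B35L10600L10700L10800L10650B48B37L10800L10650B38B47B46L10700L10800L10750B48B47B36
B25");
  ([:: false; false; false; true; true], parse
"L10500L10600L10700L10800B37B26L10700L10800B27B36B35L10600L10700L10800B37B36B25");
  ([:: false; false; true; false; true], parse
"L10050L10070L10570L10080L10870L30070B78B48L10670L30070B67B38B57B37L10060L10580L10560L30050B56B58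
B36B47B45L10070L10060L10080L10750L10760L30070B67B57B48B36L10780L10750L30070B57B78B46B47L10080
L10060L10670L10870L30070B78B67B46B48B37B35");
  ([:: false; false; true; true; true], parse
"L10000");
  ([:: false; true; false; true; true], parse
"L00050L00060L00560L00070L00080L00580L20005B58B28B37L00080L00570L20005B57B38B27B56B26L00070L00080
L00570L00580L20005B58B57B28B27B36B35L00060L00070L00080L00650L00670L20006B67B56B38B27L00080L00650
L00680L20006B68B56B28B37B36L00070L00080L00750L00760L20007B67B57B38B37B26B25");
  ([:: false; true; true; true; true], parse
"L00000");
  ([:: true; true; true; true; true], parse
"L00000")].

Definition certs5 := [::
  ([:: false; false; false; false; false], parse
"L10507C3710506C2610578L10509L10508C3710509C3710508L20509C3610509L10950B69B19B78B79B48B49B68B06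
L00650C3710509L10509C0609050L20590L00905B59B69L40850C0608050L10650L10506B36B68B08B19B49B79L10650
L10508C3710508L10506C3910506B46B78B48B36B09B16L00750C0907050C1700805B79B27L00950L00850C0806050
L00507C0709050B37B68B18B29L40850L20506B08B19B17B26B67B07L10508L10506L10509C3810507C3810509
C3610507L20509C3610509L10950B69B19B67B89B78B49B06L10509L20506C3810506L20507C3810507C3910507
L10750B79B78B17B68B16B09B46B08L10506L10509L20508C3910507C3610508C3610507L20507L10750B17B67B68B79
B18B09B06B48B47L00508L00506L00509L00507B39B36B48L00507L00509L00506B49B37L00509L00506B39B47B38
L40750C1740850C1740950L10570C2710560B47B79B78B17L40850L48750L48950L48650B59B17B58L48750C0648750
C0948750L10580B89B68B78B18C1740950L46750B19L10560L10560C1710560C1710506C1810706B47B67B56B36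
C1710509B46B79B08B07L40605C1640805C1640705C1640905L10560B69B67B68B16L40650C1940650L46950L46850
B19B69B56C0946850C1640950B58L47850L47950B58C0746095L46705B29L10560B67B07B69B16B26L10590L10590
C1810509C1610509B48B59B39C1520908C1520907B18C2810590L40850L47650B18B89B59B09C1610507C1810507B56
L10578C1610508L10580B56B37B07B49B06B57B15B45L10650C0618050C0617050L10950L10850L10750B38B39B67B68
B26L10850C0918050L10950L10750B29B89B38L10950L10750B39B28B36L00905C2610950L10956L40690C1640790
L08605B67B16L08905L00895L00795L40609B17B28B89L07905C2540690L20906B59B79B18B69B46B56C2810950
C2710950C1510908C1510907C3610908C3610907C1500609C1600905B26B67B68B47B48B57B58B06B19L00950L07950
L07950L08950L06950B18B27B79L08950L06950B28B17B19C1700950L09750L09850L09650B58B27B79C1530809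
C1620509B08B57C1600905C0906075L00685B27B36L20596C2820590C2720590B18B06B69L00805C1700905L30980B79
B38L00705L00765B37B28B16B19B59B39L00765L00785L00705B38B36L00650L00685L00605L00675B36B38B56L08650
L00865L00850L08750B58B36B56B16B17B29B05L30708L30780L30780C3500807C2700850C1810907C1600807B39B58
B38C1500807L20705B58C1630708C1930708B16B37B57B78B08B17L10870L10870L10807L18570C1618507L40580B56
B57B48B37B78C1810570C0518070C0518097C1810507B49B37B78C0918070C0918670C1810970C1810607B78B67B37
C0918570L20705B59B39C2830760L30709L30870B29B16B89B58B38B18L19570L16570C2700650C2700950L16570
C3830706L30670B68B56B19B16B36B59L10970L40709L10970C1740809L30760B18B37B17B79L40706L00670C0519070
L20705B59B16B36C1610570C1610507C1910507C2630750B59B46B67C2930750B56B17B39B57B28C2700850L25780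
C2708650C2700650C2708950C2700950L00780B19B89B16B68B08B28C0725080C0725980C1520708C0725068B05B89
B48C1520768C1520709C1520706C1730508L20850B28B16B19B68B08B78C1520706C1520796C1520786C1520709
C1730506L00760B26B19B68B69B06L20750C1730509C2510670C2510870B36B29B37B16C1520769C1520790B56
C1925706L25760C2540670L06870B27B67B79B19B05B18L00807C1500807C1620750L00870L00870B78B67B58B38
C1500807C1506807B15C1620750L27950L27650B49B67B58B18L00670L00970L40870L40570B08B19B16B28C2540680
C2540680C2540680B56B68C2840675L40609C3940608C3940605L40560B59B89B39B78B28C2540690C2900650L00680
L20605B38B49B29B58C3710806C1710806L30670B78B48C2610970C2700860C1500867L40560B58B18B29B38C1640795
C1730690B17C2600957C1830507L30670B48B19B59B28L36970L36870B09C2800750C2900750B58B46B67B16C1520809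
C2630850L30890B26B58L20690L10890C3500906L20905B56B28B36B48C1520908C2630950L30980B26B59C1520608
L20680L20805B36B56B49C1730806C1730906B78L30857L30957B48B26B18B19B06B37B57B07L20680C0625080L20980
C0627080C0927080L10780L20807B27B79B67B39B56B36L10908L10798C1610508C1610908C0517098L20950B57B69
B56B37B29C1610508C1617508C1910508C1910608L10809L00980B09B69B59B37B26L10608L10780C1910508L20805
B59B27B36C1910508L17580B59B26B56B39B18C0625090L20890C0825090L17590L00960L20905B36B27B58B38B56
L10609C1610509L30960C2630980C2630970B68B16C1610809L10790C1810509L20905B58B27B38L30960B68B69B56
B36L10809C1810509C1810709L30980B78C0617090L00790L00890B17B67B37B58B38B26B19C1520807C1520907
C1520607B59B58C1520806C1520906L20860L17560L00690L20605B39B27B38B59B58L30659L30658B29B16B17B09B08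
B47B45B25L10605L20650L00560L20605C3710605C3810605B47B06B25B56L00760C0845060C0509060B58B17L10608
C3710608L10609C3910608C3910605C3710605B59B89B09B78B48L10609C3810605C3710605B58B49L20607L00860
L00960B28B17B09B08B27B15B45L00560L00860C0508060C0708560C0509060C0507060B19B78B58B28L00960L40960
L20607B09B29B18B15L10608L20680L40860L00860L20608L00960L00760B19B06B28B16B68L10607C3510608
C3510607B58B47L20609C3920607C3920605C3510608B59B79B19B07B18B48L20607L10607L10609C3810609L20609
C3810607C3510609L10960B59B78B19B89B49B47B17B08B25B05L20670L20670L20607C1820670C1820607C1920607
C1520607B69B08B78C2640750L07960B25B68B06B67B47L00760L00706L00786L00796B28B37B67C1700960C1700906
L07806B37B67L08560L00806L00896B38B56L07560C1700560C1700506B67B56C1700806B57B18B79B27B07L20605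
L00560C1500760C1500860B57B25L30605L20609L20608B09B16L10860L10760B38B25B56B05L30608L30609B28B15
L00906L00596L00896B25B19L00960C1700906C1800906L20690B89B79B69L00806L00576B28B19B39L00806L00876
B38L00560L05860L05760B68B56B18B29B06B17B26L10976L19860L10986L10906B48B68B47L17860L10706L10760
L10796L10786B49B67B47B68L10896L10806L10876B48B49B27B29C3700806C2710860C1618705C2518760L10890
C3610809L00670B69B49B56B45B07B18L10870L10890L00807C2510870L10875C3610809L00680B69B45B57B18B49B07
L10890C3610895L00690B56B09L10805C3610809L00680B69B05B49B47B67C3800706L00708C3900706C2510760
L00709L00670B49B05B69B48B68C2810760C2910760L10790C2810769C2517860C1720609L40590B19B56B89B49B69
B08C2910760L10790L00670C1700608B47B49B69L10780C2517960C3610705L10795B47B59C1720608C1720605B18B56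
B48B09B68B17C2600580C2600570C2600590B67B68L00908C3800906C3700906C2510960L00907L00690B47B05B67B68
B48L40769L40869B07B19B15B27B28B06B36L10805C3910805C3710805L00580B57B59B45L10807C3910807C3510807
L10809C3910806L20806C3510806L00580B56B16B69B09B57B79B47L20809L10809C3510809C3510806L00580B56B59
B49B19B07B05L20807L00708L00780L10680L10980B26B78B37L10980L10680B39B27B07L20806L20805L30805L30809
B25B05B16L10780C0617080L10680L10980B26B67B37L10680L10980B36B27B06B17L20870L28570L20857L20897B05
B57B47L20896L20856B49C3620897C2720860B49C2720890C2720890B47C2720850L00708B78L00708B57B79B67B16
B07L00908C1900608C1900708C1900508L20890B59B79B69B29L00978L00968B27L00608L00568B16B29B39L20860
L00580C1500980L20850C1500680B05B59B25C1920860C1720806C1920805B07B69B58B68C1920805L20850C1720805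
B58B89B06B19B17B08B28L10870L10897B37L10875L10895B37L30980L10879L10890B37B18B05B07C0928050
C0728050L16850L00590L00570B39B26B78B89L10905C1710805L10695L10705B36B78B29L10705L10675B27B39B15
C0928070C1910807C1916807C0916070C1510807C0816070L00670B68B58B69B36B29B17C1510807L16870L10907
L20708B39B26B58L10907L10670B39B25B89C1820906C1820506C1820706B58B89C1820509C1530807C1510809B27B19
L10709C1710609L20908L30907B18B67B37L10690C1510609L30950B56B69L00590L00907B15B36B27B58B16B07B05
B28B48L10790L00709L05709L00579L20950L20950B59C2610750B05B25B57L00609C1600709L00879L40890L40690
B08B28B67B26B15B17B09L10690C0715090C0615090L00590L10905B15B56B57B26L00609C1600509L00590C1600809
L20960B68B15B56B26L10670C2810690C2810670L10678L30580B48B78B89B07L10698L10695B08B47L00590L00890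
B15B26B16B09B27L10978L10975L10970B05B08L10670L10675L10678B05B07L00870L10708L10705C3510709
C1510607L00570B56B59B05B08B18B26B29B49B38B46B35");
  ([:: false; false; false; false; true], parse
"L10500C1610500L10560C1710500L10570L10580L10590C1615800C1715800C1615900L30060B69B78B68B49B48B37
B57C1810500L10580L10590C1615700C1815700C1615900L30060B69B78B67B49B38B58C1910500L10590C1615700
C1915700C1615800L30060B68B79B67B39B59B48B47B36B56C1710500L10570C1810500L10580L10590C1715600
C1815600C1715900L30070B79B68B67B49B38B58C1910500L10590C1715600C1915600C1715800L30070B78B69B67B39
B59B48B37B57C1810500C1910500L10580L10590C1815600C1915600C1815700L30080B78B69B68B39B38B59B58B47
B46B45L30050C2530060L30060C2530070C1510800C1510900B38B57C2530080C2530090B58B17B26C2530070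
C1510800C1510900B38B57C2530080C2530090B58B17B06B56C2530070C2530080C2530090B58B57B16B15L30065
L30650L30075L30085L30095L30750C1830605C1930605L10600B69B68B57B09B08B17L30085L30095L30850C1730605
C1930605L10600B69B67B58B09B18L30095L30950C1730605C1830605L10600B68B67B59B19B08B07B56B16L30075
L30750L30085L30095L30850C1630705C1930705L10700B79B67B58B09B18L30095L30950C1630705C1830705L10700
B78B67B59B19B08B57B17L30085L30095L30850L30950C1630805C1730805L10800B78B68B59B58B19B18B07B06
C1510600C1510700C1510800B37B56C1510700C1510800B57B36L15600C1510670C1510680B47B46L15700L15800
L15900B48B47B36B45B15B05B35L10600C1510600L10650C1710600L10670L10680L10690C1516800C1516900B58B49
B48B37B67C1810600L10680L10690C1516700C1516900B57B49B38B68C1910600L10690C1516700C1516800B57B39B69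
B48B47B35B56C1710600L10670C1810600L10680L10690C1716500C1816500C2630050B58B57B49B38B68C1910600
L10690C1716500C1916500C2630050B59B57B39B69B48B37B67C1810600C1910600L10680L10690C1816500C1916500
C2630050B59B58B39B38B69B68B47B45B46L30060C2630050C2630070C1610800C1610900B38B67C2630080C2630090
B68B17B56C2630070C2630080C2630090B68B67B15B16L30056L30560L30076L30086L30096L30760C1830506
C1900650B58B67B09B08B17L30086L30096L30860C1730506C1900650B57B68B09B18L30096L30960C1730506
C1800650B57B69B19B08B07B56B15L30076L30760L30086L30096L30860C1530706C1930706L10700B79B57B68B09B18
L30096L30960C1530706C1830706L10700B78B57B69B19B08B67B17L30086L30096L30860L30960C1530806C1730806
L10800B78B58B69B68B19B18B07B05C1610500C1610700C1610800B37B56C1610700C1610800B67B35L16500C1610570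
C1610580B47B45L16700L16800L16900B48B47B35B46B16B06B36L10700L10800C1810700C1810900L10900C1810500
C1810600L30080B68B35L30080B58B49B89C1810500C1810600L30080B68B58B39B78B38L10900C1910700C1910800
C1910500C1910600L30090B69B59B38C1910500L30090B59C1910600L30090B69B35B89B79B39C1510700C1610700
L10750L10760C1510800C1510900B58B36B35B67B57B49B48B47L10800L10900C1910500C1910600C1910800L30090
B89B69B59B39L30070C2730090L30090C1710800C1710850B47C1710500C1710600B35B78B09B79C2730050C2730060
C1710800B67B57B19B17L30090C2930070C1710800C1710850B47C1710500C1710600B35B78B79C2930050C2930060
C2930080B69B59B17B19C1510800L10850L10860C1710600C1710800C1710900B78B67B46B35B58C1710800C1610800
L10860C1710500C1710900B57B36B68B78B45B09B07B49B48L10900L10950L10960C1710500C1810500C2930050B58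
B57B46B45B49B38B37B26B25");
  ([:: false; false; false; true; true], parse
"L10500L10600C0615000L10700C0617000L10800L10900C0815000C0817000C0619000L20006B69B78B58B39B28
L10900C0915000C0917000C0618000L20006B68B79B59B29B38B67B37L10800L10900C0715000C0618000C0718000
C0619000L20006B69B78B68B57B39B38B27B56B26L10700C0715000L10800L10900C0915000C0716000C0916000
C0718000L20007B78B69B67B59B29B38L10900C0815000C0716000C0816000C0719000L20007B79B68B67B58B39B28
B57B27L10800L10900C0815000C0915000C0816000C0916000C0817000L20008B78B69B68B59B58B29B28B37B36B35
L10600L10700L10800L10900C0516000C0716000C0518000C0718000C0519000L20005B59B78B58B67B56B39B38B27
L10800L10900C0516000C0816000C0517000C0817000C0519000L20005B59B78B57B68B56B39B28L10900C0516000
C0916000C0517000C0917000C0518000L20005B58B79B57B69B56B29B38B37B36L10700L10800L10900C0517000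
C0617000C0518000C0618000C0519000L20005B59B68B58B67B57B39B38B37B26B25");
  ([:: false; false; true; false; true], parse
"L10080C1810700C1710580C1710980L10060C1810900L10090C1710680C1810600C1510600C1510670B45L30060B56
B68B67B49B89B46B79B35C1710980C1810900L10090C1610980L30090B69C1710680L30070B67C1810500L30080B58
B36B68B49B89B79C1810600L10060L10050C1810500C1710680C1910680L30080B89L30060B69B67B58B45B46B68B39
B57B37C1810900L10090C1810500L30080B58L10060C1810600L30080B68B46L10070C1610700C1510700C1610750
C1610780L30060B68B56B57B46C1510900C1510700L30070B57B59C1610900C1510980L30080B58L30090B59B69B45
B67B47B36B35B49B89C1810500L10050C1610500C1610580L30080B68B46C1810600L10070C1610780C1910500L30050
B59C1910760L30060B69L30070B79B49B67B47B36L30080B68B56B45B58C1810600L10070L10060C1910780L30080B89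
C1510680L30080B58C1910680L30080B89L30060B69B56B79B46B47B68B35B39B78B38L10060C1610800L10070
C1610700C1810760L10090L10050C1810560L30080B58B45B39C1510700L30070B57B49B78B67B47C1810960C1810560
L30080B58B89B37B38C1610900L10050C1910560C1610500C1910760L10070C1610700L30060B67B47B79C1910860
C1710560L30060B67L30050B57B89B37B56B59B45C1910860C1910760L10070C1610700C1510760L30070B57L30060
B56B67B47B79B89B35B39C1610500C1510760L10070C1610700L30060B67B47B57L10090C1510860C1510960C1710960
L30090B79L30060B67B59B58B49B37B35L30060B56B69B68B36L10070L10050C1710600C1610870L10090C1710800
C1510800L30080B58B78B49B68B36C1510800C1710800C1910800C1910870L30070B79B49L30080B89B78B58C1710900
C1510600C1510900L10090C1810970L30070B78L30090B89B49B59B56B79B38B67B35L10090C1710500C1910500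
C1710600C1710800C1910800C1610570L30050B56B89B78B36C1910600C1610890L30060B68B36C1910800C1810690
L30060B68B38L30090B89B69B67B59B57C1710800C1710600C1910800C1910600C1510890L30080B58L30090B59B69
B89B67B78B35B39B45B37L10050L10090C1510700C1710650C1510800C1710850L30070B78B58B67B37C1910600
C1510600C1510800L30050B58C1910700C1810650L30060B68L30050B58B79B38B56B69C1910700C1910800C1510800
C1610850L30050B56L30080B68B58B89B79B36B57B39B35B47B46B48");
  ([:: false; false; true; true; true], parse
"L10000");
  ([:: false; true; false; true; true], parse
"L00050L00060C1600500L00070C1600700L00080C1800500C1800700L00090C1600900L20006B69B39C1900500
C1900560L20006B69B39L20005B59B29B78B58B28L00090C1900500C1900700C1600800C1800560L20005B58B28
L20006B68B79B59B29B38B67B37L00080C1600800L00090C1900500C1900800C1700500C1700560L20006B67B37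
L20005B57B89B59B29C1700500C1700800C1600900C1900560L20005B59B29L20006B69B78B57B39B68B38L00090
C1600900C1700500C1700900C1800500C1800560L20006B68B38L20005B58B79B57C1800500C1800900C1700560
L20006B67L20005B57B89B58B37B69B39B28B27B56B26L00070C1700500L00080L00090C1900500C1700800C1900800
C1700600C1600570L20005B56B26L20007B67B89B78B59B29B38L00090C1800500C1700900C1800900C1700600
C1600570L20005B56B26L20007B67B89B79B58B39C1700600C1800500C1800600C1900500C1900570L20007B79B39
L20005B59B68B58C1900500C1900600C1800570L20007B78L20005B58B69B59B38B67B29B28B57B27L00080L00090
C1800500C1900500C1800600C1900600C1800700C1700580L20005B57B27L20008B78B69B68C1800700C1900700
C1600580L20008B68L20005B56B79B78B26B59B58B29B28B37B36B35L00060L00070C1700600L00080C1700800L00090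
C1900600C1900800C1500600C1500670L20007B57B35L20006B56B89B69B29C1500600C1500800C1500900C1900650
L20006B69B29L20005B59B58B56B39B78B38L00090C1700900C1500600C1500900C1800600C1800650L20005B58B38
L20006B68B59B56C1800600C1800900C1500670L20007B57L20006B56B89B68B35B79B39B28B67B27L00080C1800600
L00090C1500600C1500900C1800900C1500700C1700650L20006B67B27L20005B57B89B59B56B39C1800700C1500600
C1500700C1900600C1900650L20005B59B39L20006B69B57B56C1900600C1900700C1500680L20008B58L20006B56B79
B69B35B78B29B68B28L00090C1500600C1900600C1500700C1900700C1500800C1800650L20006B68B28L20005B58B79
B57C1500800C1900800C1700650L20006B67L20005B57B89B58B27B69B56B29B38B37B36L00070L00080L00090
C1800700C1800900C1500700C1500900C1600700C1600750L20005B56B36L20007B67B59B57C1600700C1600900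
C1500760L20007B57L20006B56B69B67B35B89B78B39B28L00090C1900700C1900800C1500700C1500800C1600700
C1600750L20005B56B36L20007B67B58B57C1600700C1600800C1500760L20007B57L20006B56B68B67B35B89B79B29
C1500700C1600700C1500800C1600800C1500900C1900750L20007B79B29L20005B59B68B58C1500900C1600900
C1800750L20007B78L20005B58B69B59B28B67B57B39B38B37L00080L00090C1500800C1500900C1600800C1600900
C1700800C1700850L20005B57B37L20008B78B69B68C1700800C1700900C1600850L20008B68L20005B56B79B78B36
B59B58C1600800C1700800C1600900C1700900C1500860L20008B58L20006B56B79B69B78B68B35B39B38B27B26B25");
  ([:: false; true; true; true; true], parse
"L00000");
  ([:: true; true; true; true; true], parse
"L00000")].

Local Close Scope string_scope.

Lemma check2 : check 2 [::] (leq 5) [::] [::] cert2.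
Proof. by vm_compute. Qed.

(** With eight neighbours, two roots may lie in [K], and a missing edge between them is not bounded.
    If they are consecutive, a rotation puts them at positions 0 and 1, and this pair is left
    untracked. *)
Lemma check3 : check 3 (behead cyc_pairs) predT [::] [::] cert3.
Proof. by vm_compute. Qed.

Lemma check4 : all (fun p => check_pattern 4 p.1 p.2) certs4.
Proof. by vm_compute. Qed.

Lemma check5 : all (fun p => check_pattern 5 p.1 p.2) certs5.
Proof. by vm_compute. Qed.

(** * From certificates to neighbourhoods of six to ten vertices *)

Section Local.
Variable T : finType.
Implicit Types (e : rel T) (u v x y z : T) (s o : seq T) (V X K N A B C D S W M : {set T}).

Lemma check_mlinked m pairs (limited : nat ->
  bool) (P0 F0 : seq (nat * nat)) t e V v s o : symmetric e -> size s = 5 -> size o = m ->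
  uniq (v :: s ++ o) -> {subset v :: s ++ o <= V} -> {in s, forall x, e v x} ->
  let g := nth v (s ++ o) in
  (forall w, w < 5 + m -> limited w -> exists2 M : {set T}, #|M| < m &
     forall i, i < 5 + m -> tracked m pairs (ordered w i) -> ~~ e (g w) (g i) -> g i \in M) ->
  {in P0, forall p, e (g p.1) (g p.2)} ->
  {in F0, forall p, tracked m pairs p && ~~ e (g p.1) (g p.2)} -> uniq F0 ->
  check m pairs limited P0 F0 t -> mlinked V e s.
Proof.
move=> sym s5 om u sV vs g Hcon HP HF uF chk.
have szo : size (s ++ o) = 5 + m by rewrite size_cat s5 om.
have sE : s = map g (iota 0 5).
  rewrite -{1}s5; apply: (@eq_from_nth _ v); first by rewrite size_map size_iota.
  move=> i i5; rewrite (nth_map 0) ?size_iota // nth_iota // /g nth_cat add0n i5 //.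
have [vso uso] := andP u.
have g_inj : {in gtn (5 + m) &, injective g}.
  move=> i j; rewrite !inE => i5 j5 /eqP; rewrite /g nth_uniq ?szo //; by move/eqP.
rewrite sE; apply: (check_sound (v := v) (limited := limited)) chk => //.
- by move=> i i5; apply: sV; rewrite inE mem_nth ?szo ?orbT.
- by apply: sV; rewrite inE eqxx.
- by move=> i i5; apply: contraNneq vso => ->; rewrite mem_nth ?szo.
- by move=> i i5; apply: vs; rewrite /g nth_cat s5 i5 mem_nth ?s5.
move=> w l w5 cw ul lz; have [M cM HM] := Hcon w w5 cw.
apply: leq_ltn_trans cM; rewrite -(size_map g) cardE; apply: uniq_leq_size.
  rewrite map_inj_in_uniq // => x y /lz[x5 _ _] /lz[y5 _ _]; exact: g_inj.
by move=> _ /mapP[z zl ->]; rewrite mem_enum; have [z5 tz nz] := lz z zl; apply: HM.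
Qed.

(** The certificate takes [p] as the implicit vertex and [q], [r] as vertices 5 and 6, each with at
    most one missing edge. It serves neighbourhoods of seven vertices and the triples in
    [three_dense]. *)
Lemma three_dominators e V p q r s : symmetric e -> uniq [:: p, q, r & s] -> size s = 5 ->
  {subset [:: p, q, r & s] <= V} -> {in s, forall x, e p x} ->
  count (fun x => ~~ e q x) (r :: s) <= 1 -> count (fun x => ~~ e r x) (q :: s) <= 1 ->
  mlinked V e s.
Proof.
move=> sym u s5 sV ps cq cr.
have u' : uniq (p :: s ++ [:: q; r]).
  have E : perm_eq (p :: s ++ [:: q; r]) [:: p, q, r & s].
    by rewrite perm_cons perm_catC.
  by rewrite (perm_uniq E).
have nthE w : w < 5 -> nth p (s ++ [:: q; r]) w \in s.
  by move=> w5; rewrite nth_cat s5 w5 mem_nth ?s5.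
have n5 : nth p (s ++ [:: q; r]) 5 = q by rewrite nth_cat s5.
have n6 : nth p (s ++ [:: q; r]) 6 = r by rewrite nth_cat s5.
have cardM y l : count (fun x => ~~ e y x) l <= 1 -> uniq l -> #|[set x in l | ~~ e y x]| < 2.
  move=> c ul; rewrite ltnS; apply: leq_trans c; rewrite -size_filter.
  have /card_uniqP <- : uniq [seq x <- l | ~~ e y x] by rewrite filter_uniq.
  by apply: subset_leq_card; apply/subsetP=> x; rewrite !inE mem_filter andbC.
apply: (check_mlinked sym s5 _ u' _ ps _ _ _ _ check2) => //.
- by move=> x; rewrite inE mem_cat => H; apply: sV; move: H; rewrite !inE; case: (x \in s);
  rewrite ?orbT ?orbF.
- move=> w w7 w5; have {w7 w5} [->|->] : w = 5 \/ w = 6 by lia.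
  + exists [set x in r :: s | ~~ e q x].
      by apply: cardM => //; move: u; rewrite /= !inE; case/and4P=> _ _ -> ->.
    move=> z z7; rewrite n5 inE => tz ->; rewrite andbT inE.
    have [z5|z5] := ltnP z 5; first by rewrite nthE ?orbT.
    have [zE|zE] : z = 5 \/ z = 6 by lia.
      by rewrite zE in tz.
    by rewrite zE n6 eqxx.
  + exists [set x in q :: s | ~~ e r x].
      apply: cardM => //; move: u; rewrite /= !inE !negb_or => /and4P[_ /andP[_ ->] _ ->] //.
    move=> z z7; rewrite n6 inE => tz ->; rewrite andbT inE.
    have [z5|z5] := ltnP z 5; first by rewrite nthE ?orbT.
    have [zE|zE] : z = 5 \/ z = 6 by lia.
      by rewrite zE n5 eqxx.
    by rewrite zE in tz.
Qed.

Lemma all_lookup (A : eqType) (U : Type) (P : A * U -> bool) (l : seq (A * U)) b :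
  all P l -> b \in [seq p.1 | p <- l] -> exists t, P (b, t).
Proof.
elim: l => //= -[a t] l IH /andP[Pa /IH H]; rewrite inE => /predU1P[->|//]; by exists t.
Qed.

(* The last entry is read backwards so that rotating [s] rotates the sequence. *)
Definition bits (r : rel T) s :=
  if s is [:: x0; x1; x2; x3; x4] then [:: r x0 x1; r x1 x2; r x2 x3; r x3 x4; r x4 x0] else [::].

Lemma bits_rot r s n : size s = 5 -> n < 5 -> bits r (rot n s) = rot n (bits r s).
Proof.
case: s => [|x0 [|x1 [|x2 [|x3 [|x4 []]]]]] // _.
by do 5?[case: n => [|n]].
Qed.

Definition covers (b : seq bool) (P : pred (seq bool)) := has (fun n => P (rot n b)) (iota 0 5).

Lemma rot_patterns b : size b = 5 -> covers b (fun c => c \in [seq p.1 | p <- certs4]).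
Proof. by case: b => [|[] [|[] [|[] [|[] [|[] []]]]]]. Qed.

Lemma rot_two_true b : size b = 5 -> count id b <= 2 ->
  covers b (fun c => if c is [:: _; b1; b2; b3; b4] then
    [&& ~~ (b1 && b2), ~~ (b2 && b3), ~~ (b3 && b4) & ~~ (b4 && head true c)] else false).
Proof. by case: b => [|[] [|[] [|[] [|[] [|[] []]]]]]. Qed.

Section Neighbourhood.
Variables (e : rel T) (v : T) (N K : {set T}).
Hypotheses (sym : symmetric e) (vN : v \notin N) (vadj : {in N, forall x, e v x}).
Hypotheses (N6 : 6 <= #|N|) (NK : #|N| + #|K| <= 10).
(** Minimum degree five inside [N], in complementary form: of the |N| - 1 other vertices at most |N|
    - 6 are missed, where pairs inside [K] count as present. *)
Hypothesis few : {in N, forall w,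
  #|[set z in N | [&& z != w, ~~ e w z & ~~ ((w \in K) && (z \in K))]]| <= #|N| - 6}.

(** With m = |N| - 5, [few] says that every vertex misses fewer than m others. Since [few] ignores
    pairs inside [K], no tracked pair may lie inside [K]. *)
Lemma neighbourhood_check pairs P0 F0 t s : size s = 5 -> uniq s -> {subset s <= N} ->
  {subset K <= s} ->
  let o := enum (N :\: [set x in s]) in let g := nth v (s ++ o) in
  (forall i j, g i != g j -> tracked (#|N| - 5) pairs (i, j) -> ~~ ((g i \in K) && (g j \in K))) ->
  {in P0, forall p : nat * nat, e (g p.1) (g p.2)} ->
  {in F0, forall p, tracked (#|N| - 5) pairs p && ~~ e (g p.1) (g p.2)} -> uniq F0 ->
  check (#|N| - 5) pairs predT P0 F0 t -> mlinked (v |: N) e s.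
Proof.
move=> s5 us sN Ks o g HK HP HF uF chk.
have om : size o = #|N| - 5.
  rewrite -cardE cardsD (setIidPr _); last by apply/subsetP=> x; rewrite inE; apply: sN.
  by rewrite cardsE (card_uniqP us) s5.
have uso : uniq (s ++ o).
  rewrite cat_uniq us enum_uniq andbT /=; apply/hasPn=> x; by rewrite mem_enum !inE => /andP[].
have soN x : x \in s ++ o -> x \in N.
  by rewrite mem_cat mem_enum !inE => /orP[/sN//|/andP[]].
apply: (check_mlinked sym s5 om _ _ _ _ HP HF uF chk).
- rewrite /= uso andbT; apply: contra vN; exact: soN.
- by move=> x; rewrite !inE => /predU1P[->|/soN->]; rewrite ?eqxx ?orbT.
- by move=> x /sN/vadj.
move=> w w5 _; exists [set z in N | [&& z != g w, ~~ e (g w) z & ~~ ((g w \in K) && (z \in K))]].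
  apply: leq_ltn_trans (few _) _; last by lia.
  by apply: soN; apply: mem_nth; rewrite size_cat s5 om.
move=> i i5 tr ne; have [_ _ wi] := tracked_lt tr.
rewrite inE ne soN /=; last by apply: mem_nth; rewrite size_cat s5 om.
have gwi : g i != g w by rewrite /g nth_uniq ?size_cat ?s5 ?om // eq_sym.
rewrite gwi /=; move: tr; rewrite /ordered; case: (ltnP w i) => _.
  by apply: HK; rewrite eq_sym.
by rewrite andbC; apply: HK.
Qed.

(** Nine or more neighbours leave room for at most one vertex in [K], so every missing edge is
    bounded by [few] and all consecutive pairs of roots can be tracked. *)
Lemma neighbourhood_pattern s : 9 <= #|N| -> size s = 5 -> uniq s -> {subset s <= N} ->
  {subset K <= s} -> bits e s \in [seq p.1 | p <- certs4] -> mlinked (v |: N) e s.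
Proof.
move=> N9 s5 us sN Ks bs.
have noK x y : x != y -> ~~ ((x \in K) && (y \in K)).
  move=> xy; apply/negP=> /andP[xK yK].
  have : #|[set x; y]| <= #|K| by apply: subset_leq_card; rewrite subUset !sub1set xK.
  rewrite cards2 xy; lia.
have [t chk] : exists t, check_pattern (#|N| - 5) (bits e s) t.
  have [N9'|N10] := eqVneq #|N| 9.
    by rewrite N9'; exact: (all_lookup check4 bs).
  have -> : #|N| - 5 = 5 by lia.
  exact: (all_lookup check5 bs).
move: chk; set b := bits e s => chk.
have bE : bits e s = b by [].
have gE (i : nat) : i < 5 -> nth v (s ++ enum (N :\: [set x in s])) i = nth v s i.
  by move=> i5; rewrite nth_cat s5 i5.
have b5 : size b = 5 by rewrite -bE; case: (s) s5 => [|x0 [|x1 [|x2 [|x3 [|x4 []]]]]].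
have be : b = [seq e (nth v (s ++ enum (N :\: [set x in s])) p.1) (nth v (s ++ enum (N :\: [set x
  in s])) p.2)
                | p <- cyc_pairs].
  rewrite -bE /= !gE //; case: (s) s5 => [|x0 [|x1 [|x2 [|x3 [|x4 []]]]]] //= _.
  by rewrite [e x4 x0]sym.
apply: (neighbourhood_check s5 us sN Ks _ _ _ _ chk).
- by move=> i j gij _; apply: noK.
- by rewrite be -filter_mask => p; rewrite mem_filter => /andP[].
- rewrite be -map_comp -filter_mask => p; rewrite mem_filter => /andP[/= -> pc]; rewrite andbT.
  have /= := pc; rewrite !inE /tracked pair_inE pc orbT andbT.
  by do 4?[case/orP=> [/eqP->|]; first by rewrite /=; lia]; move/eqP->; rewrite /=; lia.
- by rewrite mask_uniq.
Qed.

(** Larger neighbourhoods may miss more edges but contain fewer vertices of [K]. With six vertices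
    all pairs not inside [K] are adjacent; with seven, [v] and the two non-roots suffice; eight and
    more use the certificates. *)
Lemma neighbourhood_linked s : size s = 5 -> uniq s -> {subset s <= N} ->
  {subset K <= s} -> mlinked (v |: N) e s.
Proof.
move=> s5 us sN Ks.
have K5 : #|K| <= 4 by lia.
have rotE n : [/\ size (rot n s) = 5, uniq (rot n s), {subset rot n s <= N} & {subset K <= rot n s}].
  split; rewrite ?size_rot ?rot_uniq // => x; rewrite mem_rot; [exact: sN | exact: Ks].
have b5 : size (bits e s) = 5 by case: (s) s5 => [|x0 [|x1 [|x2 [|x3 [|x4 []]]]]].
have [N9|N8] := leqP 9 #|N|.
  have /hasP[n] := rot_patterns b5; rewrite mem_iota => /= n5; rewrite -bits_rot // => bn.
  apply: (@mlinked_rot _ n); have [r1 r2 r3 r4] := rotE n.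
  exact: neighbourhood_pattern.
have {N8} [N6'|[N7|N8]] : #|N| = 6 \/ #|N| = 7 \/ #|N| = 8 by lia.
- have full x y : x \in N -> y \in N -> y != x -> ~~ ((x \in K) && (y \in K)) -> e x y.
    move=> xN yN yx nK; have := few xN; rewrite N6' leqn0 cards_eq0 => /eqP/setP/(_ y).
    by rewrite !inE yN yx nK /= andbT => /negbFE.
  (* As [K] has at most four vertices, some root [x] is outside [K], hence adjacent to the next
     root. This serves the pair that the dominating vertices [v] and [y] leave open. *)
  have [x xs xK] : exists2 x, x \in s & x \notin K.
    apply/hasP; apply: contraLR K5 => /hasPn H; rewrite -ltnNge -s5.
    rewrite -(card_uniqP us); apply: subset_leq_card; apply/subsetP=> x /H; by rewrite negbK.
  have cO : #|N :\: [set x in s]| = 1.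
    rewrite cardsD (setIidPr _); last by apply/subsetP=> y; rewrite inE; apply: sN.
    by rewrite cardsE (card_uniqP us) s5 N6'.
  have /eqP/cards1P[y yE] := cO.
  have /setDP[yN] : y \in N :\: [set x in s] by rewrite yE inE.
  rewrite inE => ys.
  have yK : y \notin K by apply: contra ys; apply: Ks.
  apply: (@dominators_mlinked _ _ _ v y x s set0) => //.
  + by move=> z /sN zN; rewrite !inE zN orbT.
  + exact: sub0set.
  + by rewrite !inE eqxx.
  + by rewrite !inE yN orbT.
  + by apply: contraNneq vN => ->.
  + by apply: contra vN => /sN.
  + move=> z zs; rewrite vadj ?sN //=; apply: full => //; [exact: sN | | by rewrite (negPf yK)].
    by apply: contraNneq ys => <-.
  + by move=> z; rewrite inE.
  + by rewrite setU0; apply: conn1.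
  + rewrite setU0; apply/touchP; exists x, (next s x); rewrite !inE !eqxx; split=> //.
    have nx : next s x \in s by rewrite mem_next.
    apply: full; rewrite ?(negPf xK) ?sN //.
    have [n q E] := rot_to xs; rewrite -(next_rot n us) E.
    have := rot_uniq n s; rewrite us E; have := size_rot n s; rewrite s5 E.
    case: q {E} => [|x2 q] //= _; rewrite !inE negb_or eqxx eq_sym => /andP[/andP[]//].
- have cO : #|N :\: [set x in s]| = 2.
    rewrite cardsD (setIidPr _); last by apply/subsetP=> y; rewrite inE; apply: sN.
    by rewrite cardsE (card_uniqP us) s5 N7.
  have /eqP/cards2P[q [r [qr qrE]]] := cO.
  have /setDP[qN] : q \in N :\: [set x in s] by rewrite qrE !inE eqxx.
  have /setDP[rN] : r \in N :\: [set x in s] by rewrite qrE !inE eqxx orbT.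
  rewrite !inE => rs qs.
  have cnt y z : y \in N -> z \in N -> y \notin s -> z \notin s -> y != z ->
    count (fun x => ~~ e y x) (z :: s) <= 1.
    move=> yN zN ys zs yz; rewrite -size_filter.
    have uzs : uniq (z :: s) by rewrite /= zs.
    rewrite -(card_uniqP (filter_uniq _ uzs)).
    apply: leq_trans (_ : _ <= #|N| - 6) _; last by rewrite N7.
    apply: leq_trans (few yN); apply: subset_leq_card; apply/subsetP=> x.
    rewrite mem_filter => /andP[yx xzs]; rewrite inE yx.
    have xN : x \in N by move: xzs; rewrite inE => /predU1P[->|/sN].
    have xy : x != y by apply: contraTneq xzs => ->; rewrite inE negb_or yz.
    have yK : y \notin K by apply: contra ys; apply: Ks.
    by rewrite xN xy (negPf yK).
  apply: (@three_dominators _ _ v q r) => //.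
  + rewrite /= !inE !negb_or qr qs rs us !andbT; apply/and3P; split.
    * by apply: contraNneq vN => ->.
    * by apply: contraNneq vN => ->.
    * by apply: contra vN => /sN.
  + by move=> x; rewrite !inE => /or4P[->|/eqP->|/eqP->|/sN->] //; rewrite ?qN ?rN ?orbT.
  + by move=> x /sN/vadj.
  + exact: cnt.
  + by apply: cnt; rewrite // eq_sym.
- have bK5 : size (bits (fun x _ => x \in K) s) = 5 by case: (s) s5 => [|x0 [|x1 [|x2 [|x3 [|x4 []]]]]].
  have cK : count id (bits (fun x _ => x \in K) s) <= 2.
    apply: leq_trans (_ : #|K| <= 2); last by lia.
    have -> : count id (bits (fun x _ => x \in K) s) = size (filter (mem K) s).
      by rewrite size_filter; case: (s) s5 => [|x0 [|x1 [|x2 [|x3 [|x4 []]]]]].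
    rewrite -(card_uniqP (filter_uniq _ us)); apply: subset_leq_card; apply/subsetP=> x.
    by rewrite mem_filter => /andP[].
  have /hasP[n] := rot_two_true bK5 cK; rewrite mem_iota => /= n5; rewrite -bits_rot // => bn.
  apply: (@mlinked_rot _ n); have [r1 r2 r3 r4] := rotE n.
  apply: (@neighbourhood_check (behead cyc_pairs) [::] [::] cert3) => //; last by rewrite N8;
    apply: check3.
  move: (rot n s) r1 r2 r3 r4 bn => s' s5' us' sN' Ks' bn i j _.
  rewrite N8 /tracked pair_inE => /and3P[/= ij j8 H].
  have [j5|j5] := ltnP 4 j.
    rewrite negb_and; apply/orP; right; apply/negP=> /Ks'.
    rewrite nth_cat s5' ltnNge j5 /=.
    have cO : #|N :\: [set x in s']| = 3.
      rewrite cardsD (setIidPr _); last by apply/subsetP=> y; rewrite inE; apply: sN'.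
      by rewrite cardsE (card_uniqP us') s5' N8.
    have : nth v (enum (N :\: [set x in s'])) (j - 5) \in enum (N :\: [set x in s']).
      by rewrite mem_nth // -cardE cO; lia.
    by rewrite mem_enum !inE => /andP[/negPf->].
  rewrite ltnNge j5 /= in H; rewrite !nth_cat s5' !ltnS j5 (leq_trans (ltnW ij) j5).
  case: s' {us' sN' Ks'} s5' bn => [|x0 [|x1 [|x2 [|x3 [|x4 []]]]]] //= _ /and4P[k1 k2 k3 k4].
  move: H; rewrite !inE !xpair_eqE.
  by do 3?[case/orP=> [/andP[/eqP-> /eqP->] //|]]; case/andP=> /eqP-> /eqP->; rewrite andbC.
Qed.

End Neighbourhood.
End Local.

(** * Massed pairs *)

Section Massed.
Variable T : finType.
Implicit Types (e : rel T) (u v x y z : T) (s : seq T) (V X Y Z U A B C D S W : {set T}).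

(* With c = 1 this is (M1) for (X, V) and the negation of (M2) for other separations. The
   variant c = 0, where the bound in (M2) is strict, is what an induction on separations of
   order at most four needs. *)
Definition heavy c e V A B := (B :\: A != set0) && (5 * #|B :\: A| + c <= rh e V (B :\: A)).

Definition Mass e V X c := [/\ X \subset V, heavy c e V X V &
  forall A B, sep e V A B -> X \subset A -> #|A :&: B| < #|X| -> ~~ heavy c e V A B].

(** The one exceptional structure, carried through the induction as the alternative to
    linkedness. *)
Definition dominated e V X := (#|X| == 5) && [exists a in V :\: X, exists b in V :\: X,
  (a != b) && [forall x in X, e a x && e b x]].

Lemma dominatedP e V X : reflect (#|X| = 5 /\ exists a b, [/\ a \in V :\: X, b \in V :\: X, a != b &
    {in X, forall x, e a x && e b x}]) (dominated e V X).
Proof.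
apply: (iffP andP) => [[/eqP c /existsP[a /andP[aV /existsP[b /and3P[bV ab /forallP H]]]]]|].
  by split=> //; exists a, b; split=> // x xX; have /implyP := H x; apply.
case=> -> [a [b [aV bV ab H]]]; split=> //; apply/existsP; exists a; rewrite aV /=.
apply/existsP; exists b; rewrite bV ab /=; apply/forallP=> x; apply/implyP; exact: H.
Qed.

Lemma rh0 e V : rh e V set0 = 0.
Proof.
apply/eqP; rewrite /rh /rho cards_eq0; apply/eqP/setP=> E; rewrite !inE setI0 eqxx andbF //.
Qed.

Section Sep.
Variable e : rel T.
Hypotheses (sym : symmetric e) (irr : irreflexive e).

Lemma rh_sub_vertices V V' Y : V' \subset V -> rh e V' Y <= rh e V Y.
Proof.
move=> /subsetP VV; apply: rh_le => //; apply/subsetP=> -[x y]; rewrite !incE.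
by case/and4P=> /VV-> /VV-> -> ->.
Qed.

Lemma sep_sub V A B : sep e V A B -> A \subset V /\ B \subset V.
Proof. by case/sepP=> <- _; rewrite subsetUl subsetUr. Qed.

Lemma sep_diff V A B : sep e V A B -> V :\: A = B :\: A.
Proof. by case/sepP=> <- _; rewrite setDUl setDv set0U. Qed.

Lemma sep_ltA V A B : sep e V A B -> B :\: A != set0 -> #|A| < #|V|.
Proof.
move=> sAB; rewrite -(sep_diff sAB) => /set0Pn[x /setDP[xV xA]].
by apply: proper_card; apply/properP; split; [case: (sep_sub sAB) | exists x].
Qed.

Lemma rh_sep V A B : sep e V A B -> rh e V (B :\: A) = rh e B (B :\: A).
Proof.
move=> sAB; have [AV BV] := sep_sub sAB; have /sepP[VE noe] := sAB.
apply: rh_local => //; first exact: subsetDl.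
move=> x y /setDP[xB xA] yV xy; apply/negPn/negP=> yB.
have yA : y \in A by move: yV; rewrite -VE inE (negPf yB) orbF.
by have := noe y x yA yB xB xA; rewrite sym xy.
Qed.

Lemma sep_extend V A B A2 B2 : sep e V A B -> sep e B A2 B2 -> A :&: B \subset A2 ->
  [/\ sep e V (A :|: A2) B2, (A :|: A2) :&: B2 = A2 :&: B2 & B2 :\: (A :|: A2) = B2 :\: A2].
Proof.
move=> /sepP[VE noe] /sepP[BE noe2] /subsetP SA.
have B2B x : x \in B2 -> x \in B by move=> xB; rewrite -BE inE xB orbT.
have A2B x : x \in A2 -> x \in B by move=> xB; rewrite -BE inE xB.
have AB2 x : x \in A -> x \in B2 -> x \in A2 by move=> xA xB; apply: SA; rewrite inE xA B2B.
split.
- apply/sepP; split; first by rewrite -setUA BE.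
  move=> x y /setUP[xA|xA2] xB yB; rewrite inE negb_or => /andP[yA yA2]; last exact: noe2.
  have [xB'|xB'] := boolP (x \in B); last exact: noe xA xB' (B2B _ yB) yA.
  by apply: noe2 => //; apply: SA; rewrite inE xA.
- by apply/setP=> x; rewrite !inE; have := AB2 x; case: (x \in A); case: (x \in B2) => //=;
  rewrite ?andbF // => ->.
- by apply/setP=> x; rewrite !inE; have := AB2 x; case: (x \in A); case: (x \in B2) => //=;
  rewrite ?andbF // => ->.
Qed.

(** By [sep_extend] a separation of [B] with [A :&: B] on its first side extends to [V] with the
    same order and the same far part. Hence a heavy separation whose order cannot be lowered makes
    its far side a smaller pair for the induction. *)
Lemma submass V A B c : sep e V A B -> heavy c e V A B ->
  (forall A2 B2, sep e V A2 B2 -> A \subset A2 -> #|A2 :&: B2| < #|A :&: B| -> ~~ heavy c e V A2 B2) ->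
  Mass e B (A :&: B) c.
Proof.
move=> sAB hAB Hmin; have [AV BV] := sep_sub sAB.
split; first exact: subsetIr.
  by rewrite /heavy setDIr setDv setU0 -(rh_sep sAB).
move=> A2 B2 s2 SA lt; have [s3 iE dE] := sep_extend sAB s2 SA.
have := Hmin _ _ s3 (subsetUl _ _); rewrite iE => /(_ lt); apply: contra.
rewrite /heavy dE => /andP[-> le]; apply: leq_trans le _.
exact: rh_sub_vertices.
Qed.

(** Components are split off one at a time, and the counts are subadditive. The non-emptiness of [U]
    provides at least one component with slack [c]. *)
Lemma rh_components_slack V U c : (forall D, D \subset U -> D != set0 -> connected_in e D ->
    (forall x y, x \in D -> y \in U -> e x y -> y \in D) ->
    rh e V D + c <= 5 * #|D|) ->
  U != set0 -> rh e V U + c <= 5 * #|U|.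
Proof.
move=> H.
suff: forall W, W \subset U -> (forall x y, x \in W -> y \in U -> e x y -> y \in W) ->
    W != set0 -> rh e V W + c <= 5 * #|W|.
  by move=> HW U0; apply: HW.
move=> W; have [n] := ubnP #|W|; elim: n W => // n IH W ltW WU clW /set0Pn[v vW].
have vU := subsetP WU _ vW.
pose D := component_in e U v.
have DW : D \subset W.
  have cD : connected_in e D by apply: component_conn.
  have vD : v \in D by apply: component_self.
  apply/subsetP=> y yD; apply/negPn/negP=> yW.
  have vDW : v \in D :&: W by rewrite inE vD.
  have yDW : y \in D :\: W by rewrite inE yW.
  have [a [b [/setIP[aD aW] /setDP[bD bW] ab]]] := conn_cross cD vDW yDW.
  by case/negP: bW; apply: clW aW _ ab; apply: (subsetP (component_sub e U v)).
have vD : v \in D by apply: component_self.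
have rD : rh e V D + c <= 5 * #|D|.
  apply: H => //; [exact: component_sub | by apply/set0Pn; exists v | exact: component_conn|].
  by move=> x y; apply: component_closed.
have [WD|WD] := eqVneq (W :\: D) set0.
  have -> : W = D by apply/eqP; rewrite eqEsubset DW andbT -setD_eq0 WD.
  exact: rD.
have rW : rh e V (W :\: D) + c <= 5 * #|W :\: D|.
  apply: IH => //.
  - have : #|W :\: D| < #|W|; last by move=> lt; apply: leq_trans lt _; rewrite -ltnS.
    apply: proper_card; apply/properP; split; first exact: subsetDl.
    by exists v => //; rewrite !inE vU connect0.
  - by apply: subset_trans WU; apply: subsetDl.
  - move=> x y /setDP[xW xD] yU xy; rewrite inE (clW x y) // andbT.
    apply: contra xD => yD; apply: component_closed yD _ _; last by rewrite sym.
    exact: (subsetP WU).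
rewrite -(cardsID D W) (setIidPr DW) -{1}(setID W D) (setIidPr DW) mulnDr.
have := rhU sym irr V D (W :\: D); move: rD rW; clear; lia.
Qed.

Lemma rh_components V U : (forall D, D \subset U -> D != set0 -> connected_in e D ->
    (forall x y, x \in D -> y \in U -> e x y -> y \in D) -> rh e V D <= 5 * #|D|) ->
  rh e V U <= 5 * #|U|.
Proof.
move=> H; have [->|U0] := eqVneq U set0; first by rewrite rh0.
rewrite -[rh _ _ _]addn0; apply: rh_components_slack => // D *; rewrite addn0; exact: H.
Qed.

Definition nbs V D : {set T} := [set z in V :\: D | [exists y in D, e y z]].

Lemma sep_nbs V D : D \subset V ->
  [/\ sep e V (V :\: D) (D :|: nbs V D), (V :\: D) :&: (D :|: nbs V D) = nbs V D &
      (D :|: nbs V D) :\: (V :\: D) = D].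
Proof.
move=> /subsetP DV; split.
- apply/sepP; split.
    apply/setP=> x; rewrite !inE; have := DV x; case: (x \in D) => //=; rewrite ?andbT.
      by move=> ->.
    by case: (x \in V).
  move=> x y /setDP[xV xD]; rewrite !inE xV (negPf xD) /= => nx yB yD.
  have {}yD : y \in D by move: yB yD; case: (y \in D) => //=; case: (y \in V).
  apply/negP=> xy; case/negP: nx; apply/existsP; exists y; by rewrite yD sym.
- apply/setP=> x; rewrite !inE; by case: (x \in D) => //=; case: (x \in V).
- apply/setP=> x; rewrite !inE; have := DV x; case: (x \in D) => [/(_ isT)->|_] //=.
  by case: (x \in V).
Qed.

(** A stable set of the five-cycle has at most two elements, and two of them are at distance two. *)
Lemma nonconsecutive (t0 t1 t2 t3 t4 : bool) :
  ~~ (t0 && t1) -> ~~ (t1 && t2) -> ~~ (t2 && t3) -> ~~ (t3 && t4) -> ~~ (t4 && t0) ->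
  exists2 i, i < 5 & forall j, j < 5 -> nth false [:: t0; t1; t2; t3;
    t4] j -> j = i \/ j = (i + 2) %% 5.
Proof.
move=> h0 h1 h2 h3 h4.
have /hasP[i] : has (fun i => all (fun j => nth false [:: t0; t1; t2; t3; t4] j ==>
    ((j == i) || (j == (i + 2) %% 5))) (iota 0 5)) (iota 0 5).
  by move: h0 h1 h2 h3 h4; case: t0; case: t1; case: t2; case: t3; case: t4.
rewrite mem_iota add0n => /andP[_ i5] /allP H; exists i => // j j5 tj.
have := H j; rewrite mem_iota add0n j5 tj => /(_ isT) /orP[]/eqP->; by [left|right].
Qed.

(** If [D] touched two consecutive roots, it could join the bag of the first and supply the contact
    that [a] and [b] leave open. *)
Lemma attachment V a b s D : uniq s -> size s = 5 -> {subset s <= V} -> a \in V -> b \in V ->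
  a != b -> a \notin s -> b \notin s -> {in s, forall y, e a y && e b y} -> ~ mlinked V e s ->
  D \subset V -> connected_in e D -> {in D, forall y, [&& y \notin s, y != a & y != b]} ->
  exists2 i, i < 5 & forall x0 j, j < 5 -> has_edge_between e D [set nth x0 s j] ->
    j = i \/ j = (i + 2) %% 5.
Proof.
move=> us s5 sV aV bV ab as_ bs_ He nL DV cD HD.
pose t x := has_edge_between e D [set x].
have : cycle (fun x y => ~~ (t x && t y)) s.
  apply: cycle_from_next => // x xs; apply/negP=> /andP[tx ty]; apply: nL.
  apply: (dominators_mlinked sym us s5 sV DV aV bV ab as_ bs_ He HD xs).
    by apply: connU1 => //; rewrite touchC.
  by apply: touchSE ty => //; apply: subsetUr.
case: s s5 {us sV as_ bs_ He nL HD} => [|x0 [|x1 [|x2 [|x3 [|x4 []]]]]] //= _.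
case/and5P=> h0 h1 h2 h3; rewrite andbT => h4.
have [i i5 H] := nonconsecutive h0 h1 h2 h3 h4; exists i => // y j j5 tj; apply: H => //.
by move: tj j5; do 5?[case: j => [|j]].
Qed.

Lemma attachment_card V X a b s D : uniq s -> s =i X -> size s = 5 -> X \subset V ->
  a \in V :\: X -> b \in V :\: X ->
  a != b -> {in X, forall y, e a y && e b y} -> ~ mlinked V e s ->
  D \subset V :\: (a |: (b |: X)) -> connected_in e D ->
  exists2 I : {set T}, #|I| <= 2 & forall x, x \in X -> has_edge_between e D [set x] -> x \in I.
Proof.
move=> us sX s5 XV /setDP[aV aX] /setDP[bV bX] ab He nL DV cD.
have [||||||i i5 H] := @attachment V a b s D us s5 _ aV bV ab _ _ _ nL _ cD.
- by move=> x; rewrite sX => /(subsetP XV).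
- by rewrite sX.
- by rewrite sX.
- by move=> y; rewrite sX => /He.
- by apply: subset_trans DV (subsetDl _ _).
- by move=> y /(subsetP DV); rewrite !inE sX !negb_or => /andP[/and3P[-> -> ->]].
exists [set nth a s i; nth a s ((i + 2) %% 5)]; first by rewrite cards2; case: (_ != _).
move=> x; rewrite -sX => xs; have lt : index x s < 5 by rewrite -s5 index_mem.
rewrite -(nth_index a xs) => /(H _ _ lt)[->|->]; by rewrite !inE eqxx ?orbT.
Qed.

Lemma nonadjacent_roots V a b s : uniq s -> size s = 5 -> {subset s <= V} -> a \in V -> b \in V ->
  a != b -> a \notin s -> b \notin s -> {in s, forall y, e a y && e b y} -> ~ mlinked V e s ->
  cycle (fun x y => ~~ e x y) s.
Proof.
move=> us s5 sV aV bV ab as_ bs_ He nL.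
apply: cycle_from_next => // x xs; apply/negP=> ex; apply: nL.
apply: (dominators_mlinked (D := set0) sym us s5 sV _ aV bV ab as_ bs_ He _ xs).
- exact: sub0set.
- by move=> y; rewrite inE.
- by rewrite setU0; apply: conn1.
- by rewrite setU0; apply/touchP; exists x, (next s x); rewrite !inE !eqxx.
Qed.

(** Edges among the roots lie in the complement of a five-cycle, which is again a five-cycle and has
    maximum degree two and no triangle. *)
Lemma sparse_roots s : size s = 5 -> cycle (fun x y => ~~ e x y) s ->
  {in s, forall x, count (e x) s <= 2} /\
  (forall x y z, x \in s -> y \in s -> z \in s -> e x y -> e y z -> e x z -> False).
Proof.
case: s => [|x0 [|x1 [|x2 [|x3 [|x4 []]]]]] //= _ /and5P[h0 h1 h2 h3]; rewrite andbT => h4.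
have [[f0 f1 f2] [f3 f4]] : [/\ e x0 x1 = false, e x1 x2 = false & e x2 x3 = false] /\
  (e x3 x4 = false /\ e x4 x0 = false) by do !split; apply/negbTE.
have [[g0 g1 g2] [g3 g4]] : [/\ e x1 x0 = false, e x2 x1 = false & e x3 x2 = false] /\
  (e x4 x3 = false /\ e x0 x4 = false) by do !split; rewrite sym.
have E := (irr, f0, f1, f2, f3, f4, (g0, g1, g2, g3, g4)).
split=> [x|x y z]; rewrite !inE; first by case/or4P=> [/eqP->|/eqP->|/eqP->|/orP[]/eqP->];
  rewrite !E; do 2!case: (e _ _).
by case/or4P=> [/eqP->|/eqP->|/eqP->|/orP[]/eqP->]; case/or4P=> [/eqP->|/eqP->|/eqP->|/orP[]/eqP->];
  rewrite ?E //; case/or4P=> [/eqP->|/eqP->|/eqP->|/orP[]/eqP->]; rewrite ?E.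
Qed.

(** * Edge counts in the presence of two dominating vertices *)

Section Dominated.
Variables (V X : {set T}) (a b : T) (s : seq T).
Hypotheses (X5 : #|X| = 5) (us : uniq s) (sX : s =i X) (massed : Mass e V X 1).
Hypotheses (aVX : a \in V :\: X) (bVX : b \in V :\: X) (ab : a != b).
Hypotheses (He : {in X, forall y, e a y && e b y}) (not_linked : ~ mlinked V e s).

Let U := V :\: (a |: (b |: X)).

Lemma dominated_component D : D \subset U -> D != set0 -> connected_in e D ->
  (forall x y, x \in D -> y \in U -> e x y -> y \in D) -> rh e V D <= 5 * #|D|.
Proof.
move=> DU D0 cD clD; have [XV _ M2] := massed.
have s5 : size s = 5 by rewrite -X5 -(eq_card sX) (card_uniqP us).
have [I I2 HI] := attachment_card us sX s5 XV aVX bVX ab He not_linked DU cD.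
have DV : D \subset V by apply: subset_trans DU (subsetDl _ _).
have [sD iD dD] := sep_nbs DV.
have := M2 _ _ sD _ _; rewrite iD /heavy dD D0 /= -ltnNge addn1 ltnS; apply.
  rewrite subsetD XV /= disjoint_sym; apply/pred0P=> x /=; apply/negP=> /andP[xD xX].
  by have := subsetP DU _ xD; rewrite !inE xX !orbT.
apply: leq_ltn_trans (_ : #|[set a; b] :|: I| < _); last first.
  rewrite X5 ltnS; apply: leq_trans (leq_card_setU _ _) _; by rewrite cards2 ab (leq_add2l 2 _ 2).
apply: subset_leq_card; apply/subsetP=> z; rewrite !inE => /andP[/andP[zD zV] /existsP[y /andP[yD yz]]].
have [zA|zA] := boolP (z \in a |: (b |: X)); last first.
  by case/negP: zD; apply: clD yD _ yz; rewrite inE zA.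
move: zA; rewrite !inE => /or3P[->|->|zX]; rewrite ?orbT //.
rewrite HI ?orbT //; apply/touchP; exists y, z; by rewrite inE.
Qed.

Lemma dominated_density : rh e V (V :\: X) = rh e V U + (e a b + 10) /\ #|V :\: X| = #|U| + 2.
Proof.
have [XV _ _] := massed; have [aV aX] := setDP aVX; have [bV bX] := setDP bVX.
pose A := a |: (b |: X).
have AV : A \subset V by rewrite !subUset !sub1set aV bV.
have XA : X \subset A by apply: subset_trans (subsetUr _ _); apply: subsetUr.
have abX : a \notin b |: X by rewrite !inE negb_or ab.
split; last first.
  have A7 : #|A| = 7 by rewrite !cardsU1 abX bX X5.
  have E1 : #|V :\: X| = #|V| - 5 by rewrite cardsD (setIidPr XV) X5.
  have E2 : #|U| = #|V| - 7 by rewrite cardsD (setIidPr AV) A7.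
  have := subset_leq_card AV; rewrite A7 E1 E2; clear; lia.
rewrite (rh_restrict sym irr XA AV) /A rh_add_vertex ?subsetUr // rh_add_vertex // setDv rh0 addn0.
have nbX w : {in X, forall y, e w y} -> nb e X w = X.
  by move=> H; apply/setP=> x; rewrite inE; case: (boolP (x \in X)) => // /H.
have [nba nbb] : nb e X a = X /\ nb e X b = X by split; apply: nbX => y /He/andP[].
rewrite nbb X5; congr (_ + _).
have -> : nb e (b |: X) a = if e a b then b |: X else X.
  rewrite -{2 3}nba; apply/setP=> x; case: ifP => eab; rewrite !inE; case: eqP => // ->;
    by rewrite eab ?andbF.
by case: ifP => _; rewrite ?cardsU1 ?bX X5.
Qed.

(** The two dominating vertices account for at most 5 + 5 + 1 = 5 * 2 + 1 edges beyond those at the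
    components. So the excess over density five is at most one, and it is reached only if [a] and
    [b] are adjacent. *)
Lemma dominators_count : rh e V (V :\: X) <= 5 * #|V :\: X| + 1.
Proof.
have [-> ->] := dominated_density; have := rh_components dominated_component.
by case: (e a b); clear; lia.
Qed.

Hypothesis dense : 5 * #|V :\: X| + 1 <= rh e V (V :\: X).

Lemma dominators_adjacent : e a b.
Proof.
move: dense; have [-> ->] := dominated_density; have := rh_components dominated_component.
by case: (e a b) => //; clear; lia.
Qed.

Lemma dominated_component_eq D : D \subset U -> D != set0 -> connected_in e D ->
  (forall x y, x \in D -> y \in U -> e x y -> y \in D) -> rh e V D = 5 * #|D|.
Proof.
move=> DU D0 cD clD; apply/eqP; rewrite eqn_leq dominated_component //=.
(* Components of [U :\: D] are components of [U], so the rest obeys the bound as well and cannot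
   make up for slack in [D]. *)
have rUD : rh e V (U :\: D) <= 5 * #|U :\: D|.
  apply: rh_components => D' D'UD D'0 cD' clD'.
  have D'U : D' \subset U by apply: subset_trans D'UD (subsetDl _ _).
  apply: dominated_component => // x y xD' yU xy.
  have [yD|yD] := boolP (y \in D); last by apply: clD' xD' _ xy; rewrite inE yD.
  have /setDP[xU xD] := subsetP D'UD x xD'.
  by case/negP: xD; apply: clD yD xU _; rewrite sym.
move: dense; have [-> ->] := dominated_density; rewrite dominators_adjacent.
have := rhU sym irr V D (U :\: D); rewrite -(cardsID D U) (setIidPr DU).
have -> : D :|: U :\: D = U by rewrite -{2}(setID U D) (setIidPr DU).
move: rUD; clear; lia.
Qed.

End Dominated.

End Sep.
End Massed.

(** * Minimal counterexamples *)

Section Main.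
Variable T : finType.
Implicit Types (e : rel T) (u v x y z : T) (s : seq T) (V X Y Z U A B C D S W : {set T}).

(** Five roots require [c] = 1: a single vertex joined to five pairwise non-adjacent roots has
    density exactly five, but is neither linked nor dominated. *)
Definition admissible X c := [&& #|X| <= 5, c <= 1 & (#|X| == 5) ==> (c == 1)].

Section Minimal.
Variables (e : rel T) (V X : {set T}) (c : nat).
Hypotheses (sym : symmetric e) (irr : irreflexive e) (adm : admissible X c).
Hypothesis massed : Mass e V X c.
Hypothesis IH : forall e' V' X' c', symmetric e' -> irreflexive e' -> #|V'| < #|V| ->
  admissible X' c' -> Mass e' V' X' c' -> Linked V' e' X' \/ dominated e' V' X'.
Variable s : seq T.
Hypotheses (us : uniq s) (sX : s =i X) (not_linked : ~ mlinked V e s).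
Hypothesis not_dominated : ~ dominated e V X.

Let XV : X \subset V. Proof. by case: massed. Qed.
Let X5 : #|X| <= 5. Proof. by case/and3P: adm. Qed.
Let c1 : c <= 1. Proof. by case/and3P: adm. Qed.
Let szs : size s = #|X|. Proof. by rewrite -(eq_card sX) (card_uniqP us). Qed.

Lemma admissible_small X' c' : c' <= 1 -> #|X'| < 5 -> admissible X' c'.
Proof. by move=> c'1 X'5; rewrite /admissible c'1 (ltnW X'5) /= ltn_eqF. Qed.

Lemma not_heavy A B : sep e V A B -> X \subset A -> #|A :&: B| < #|X| -> ~~ heavy c e V A B.
Proof. by case: massed => _ _; apply. Qed.

Lemma density : 5 * #|V :\: X| + c <= rh e V (V :\: X).
Proof. by case: massed => _ /andP[]. Qed.

(* Replacing B by a clique on A :&: B gives a smaller massed pair, provided A is as small as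
   possible; a minor found there is spliced back. *)
Lemma no_linked_sep A B : sep e V A B -> X \subset A -> #|A :&: B| < #|X| -> B :\: A != set0 ->
  ~ Linked B e (A :&: B).
Proof.
have [n] := ubnP #|A|; elim: n A B => // n IHn A B ltn sAB XA ordAB BA LB.
set S := A :&: B in ordAB LB.
have [AV BV] := sep_sub sAB; have [ABV noe] := sepP _ _ _ _ sAB.
have ltA := sep_ltA sAB BA.
pose e' := addK e S.
have sym' : symmetric e' by apply: addK_sym.
have irr' : irreflexive e' by apply: addK_irr.
have ee' : subrel e e' by move=> x y xy; rewrite /e' /addK /= xy.
have SA : S \subset A by apply: subsetIl.
have SB : S \subset B by apply: subsetIr.
(* The far side is not heavy, so it takes away fewer than 5 |B - A| + c edges. The parameter cancels
   and an excess of at least one remains in [A], whatever [c] is. *)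
have rAX : 5 * #|A :\: X| + 1 <= rh e A (A :\: X).
  have := density; rewrite (rh_restrict sym irr XA AV) (sep_diff sAB).
  have : ~~ heavy c e V A B by apply: not_heavy.
  rewrite /heavy BA /= -ltnNge.
  have : #|V :\: X| = #|B :\: A| + #|A :\: X|.
    rewrite -(sep_diff sAB) !cardsD (setIidPr XV) (setIidPr AV) (setIidPr XA).
    by have := subset_leq_card AV; have := subset_leq_card XA; clear; lia.
  by move=> ->; move: c1; clear; lia.
have rAX' : rh e A (A :\: X) <= rh e' A (A :\: X).
  apply: rh_le => //; apply/subsetP=> -[x y]; rewrite !incE => /and4P[-> -> xy ->].
  by rewrite ee'.
have M' : Mass e' A X c.
  split=> //.
    rewrite /heavy; apply/andP; split; last by move: c1 rAX rAX'; clear; lia.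
    by apply: contraTneq rAX => ->; rewrite rh0 addn1.
  suff: ~ exists p : {set T} * {set T}, [&& sep e' A p.1 p.2, X \subset p.1,
    #|p.1 :&: p.2| < #|X| & heavy c e' A p.1 p.2].
    move=> H A' B' sAB' XA' lt; apply/negP=> h; apply: H; exists (A', B'); by rewrite /= sAB' XA' lt.
  case=> p0 Pp0.
  case: (@arg_minnP _ p0 (fun p => [&& sep e' A p.1 p.2, X \subset p.1,
    #|p.1 :&: p.2| < #|X| & heavy c e' A p.1 p.2]) (fun p => #|p.1 :&: p.2|) Pp0) => -[A' B'] /=
      /and4P[sAB' XA' lt h] Hmin {p0 Pp0}.
  have [AE noe'] := sepP _ _ _ _ sAB'.
  have [A'A B'A] := sep_sub sAB'.
  have BA'0 : B' :\: A' != set0 by case/andP: h.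
  (* A separation cannot split the clique [S]. If [S] is on the side of [A'], adding [B] to that
     side gives a separation of the original graph that is just as heavy. *)
  have [SA'|SA'] := boolP (S \subset A').
    have s2 : sep e V (A' :|: B) B'.
      apply/sepP; split; first by rewrite setUAC AE.
      move=> x y /setUP[xA'|xB] xB' yB'; rewrite inE negb_or => /andP[yA' yB].
        by have := noe' x y xA' xB' yB' yA'; apply: contra; apply: ee'.
      have yA := subsetP B'A y yB'.
      have [xA|xA] := boolP (x \in A).
        have xA' : x \in A' by apply: (subsetP SA'); rewrite inE xA.
        by have := noe' x y xA' xB' yB' yA'; apply: contra; apply: ee'.
      by rewrite sym; apply: noe.
    have iE : (A' :|: B) :&: B' = A' :&: B'.
      apply/setP=> x; rewrite !inE; case xB': (x \in B'); rewrite ?andbF ?andbT //.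
      have := subsetP SA' x; rewrite inE (subsetP B'A x) //=.
      by case: (x \in B) => //=; rewrite ?orbF // => ->.
    have dE : B' :\: (A' :|: B) = B' :\: A'.
      apply/setP=> x; rewrite !inE; case xB': (x \in B'); rewrite ?andbF ?andbT // negb_or.
      have := subsetP SA' x; rewrite inE (subsetP B'A x) //=.
      by case: (x \in B) => //=; rewrite ?andbT // => ->.
    have := not_heavy s2; rewrite iE => /(_ _ lt)/negP; apply.
      by apply: subset_trans XA' (subsetUl _ _).
    move: h; rewrite /heavy dE => /andP[-> le]; apply: leq_trans le _.
    rewrite rh_addK //; first exact: rh_sub_vertices.
    by rewrite disjoint_subset; apply/subsetP=> x /setDP[_ xA']; rewrite inE;
      apply: contra xA' => /(subsetP SA').
  (* Otherwise [S] lies in [B'], which is linked by induction on vertices. Splicing [B] back makes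
     [B' :|: B] linked, and [A'] is smaller than [A]. *)
  have SB' : S \subset B'.
    case/subsetPn: SA' => t tS tA'; apply/subsetP=> x xS; apply/negPn/negP=> xB'.
    have tA := subsetP SA t tS; have xA := subsetP SA x xS.
    have tB' : t \in B' by move: tA; rewrite -AE inE (negPf tA').
    have xA' : x \in A' by move: xA; rewrite -AE inE (negPf xB') orbF.
    have := noe' x t xA' xB' tB' tA'; rewrite /e' /addK /= xS tS.
    by rewrite (contraNneq _ tA') ?orbT // => <-.
  have c5 : #|A' :&: B'| < 5 by apply: leq_trans lt X5.
  have M2 : Mass e' B' (A' :&: B') c.
    apply: (submass sym' irr' sAB' h) => A2 B2 s2 AA2 lt2; apply/negP=> h2.
    have := Hmin (A2, B2); rewrite /= s2 h2 (subset_trans XA' AA2) (ltn_trans lt2 lt) => /(_ isT).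
    by rewrite leqNgt lt2.
  have ltB' : #|B'| < #|V| by apply: leq_ltn_trans ltA; apply: subset_leq_card.
  have LB' : Linked B' e' (A' :&: B').
    case: (IH sym' irr' ltB' (admissible_small c1 c5) M2) => // /dominatedP[E _].
    by rewrite E in c5.
  have SE : B' :&: B = S.
    apply/setP=> x; apply/setIP/idP => [[xB' xB]|xS]; first by rewrite inE (subsetP B'A).
    by rewrite (subsetP SB') ?(subsetP SB).
  have L2 : Linked (B' :|: B) e (A' :&: B').
    move=> t ut tE; apply: splice => //; rewrite SE //; exact: LB'.
  have s3 : sep e V A' (B' :|: B).
    apply/sepP; split; first by rewrite setUA AE.
    move=> x y xA'; rewrite !inE negb_or => /andP[xB' xB] yB yA'.
    have xA := subsetP A'A x xA'.
    have [yB'|yB'] := boolP (y \in B').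
      by have := noe' x y xA' xB' yB' yA'; apply: contra; apply: ee'.
    rewrite (negPf yB') /= in yB; apply: noe => //.
    by apply: contra yB' => yA; apply: (subsetP SB'); rewrite inE yA.
  have iE : A' :&: (B' :|: B) = A' :&: B'.
    rewrite setIUr; apply/setUidPl/subsetP=> x /setIP[xA' xB]; rewrite inE xA'.
    by apply: (subsetP SB'); rewrite inE xB (subsetP A'A).
  apply: (IHn A' (B' :|: B)); rewrite ?iE //.
  - apply: leq_trans (sep_ltA sAB' BA'0) _; by rewrite -ltnS.
  - case/set0Pn: BA'0 => x /setDP[xB' xA']; apply/set0Pn; exists x; by rewrite !inE xA' xB'.
have nA : ~ mlinked A e' s.
  move=> L; apply: not_linked; rewrite -ABV; exact: splice L LB.
case: (IH sym' irr' ltA adm M') => [L|/dominatedP[X5' [a [b [aV bV ab He]]]]].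
  by apply: nA; apply: L.
have cE : c = 1 by case/and3P: adm => _ _; rewrite X5' eqxx => /eqP.
rewrite cE in M'.
(* A dominated pair has excess at most one, which [A] already has without the clique. So the clique
   adds no edge at a vertex outside [X], and the dominating vertices already dominate in [e]. *)
have cnt := dominators_count sym' irr' X5' us sX M' aV bV ab He nA.
have rE : rh e A (A :\: X) = rh e' A (A :\: X) by move: rAX rAX' cnt; clear; lia.
have incS : inc e A (A :\: X) \subset inc e' A (A :\: X).
  by apply/subsetP=> -[x y]; rewrite !incE => /and4P[-> -> xy ->]; rewrite ee'.
have incEq : inc e A (A :\: X) = inc e' A (A :\: X).
  by apply/eqP; rewrite eqEcard incS -!double_rh // rE leqnn.
have old x y : x \in A :\: X -> y \in X -> e' x y -> e x y.
  move=> xA yX xy; have : (x, y) \in inc e' A (A :\: X).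
    by have [xA0 _] := setDP xA; rewrite incE xA xy xA0 (subsetP XA).
  by rewrite -incEq incE => /and4P[].
apply: not_dominated; apply/dominatedP; split=> //.
have sub x : x \in A :\: X -> x \in V :\: X by move=> /setDP[xA xX]; rewrite inE xX (subsetP AV).
exists a, b; split; rewrite ?sub // => x xX; have /andP[ax bx] := He x xX.
by rewrite !old.
Qed.

(** Fewer than five roots allow [c] = 0. The far side of a violation of least order is then linked
    by induction, against [no_linked_sep]. For [c] = 1 this improves the bound of (M2) by one. *)
Lemma no_heavy0 A B : sep e V A B -> X \subset A -> #|A :&: B| < #|X| -> ~~ heavy 0 e V A B.
Proof.
move=> sAB0 XA0 lt0; apply/negP=> h0.
pose P := fun p : {set T} * {set T} => [&& sep e V p.1 p.2, X \subset p.1,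
  #|p.1 :&: p.2| < #|X| & heavy 0 e V p.1 p.2].
have P0 : P (A, B) by rewrite /P /= sAB0 XA0 lt0.
case: (@arg_minnP _ (A, B) P (fun p => #|p.1 :&: p.2|) P0) => -[A' B'] /and4P[/= sAB XA lt h] Hmin.
have BA0 : B' :\: A' != set0 by case/andP: h.
have c5 : #|A' :&: B'| < 5 by apply: leq_trans lt X5.
have M : Mass e B' (A' :&: B') 0.
  apply: (submass sym irr sAB h) => A2 B2 s2 AA2 lt2; apply/negP=> h2.
  have := Hmin (A2, B2); rewrite /P /= s2 h2 (subset_trans XA AA2) (ltn_trans lt2 lt) => /(_ isT).
  by rewrite leqNgt lt2.
have ltB : #|B'| < #|V|.
  apply: proper_card; rewrite properEneq; have [_ BV] := sep_sub sAB; rewrite BV andbT.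
  apply: contraTneq lt => BV'; rewrite -leqNgt; apply: subset_leq_card.
  by rewrite subsetI XA BV'.
apply: (no_linked_sep sAB XA lt BA0).
case: (IH sym irr ltB (admissible_small (leq0n 1) c5) M) => // /dominatedP[E _].
by rewrite E in c5.
Qed.

(** The order of the separation may exceed |X|. If [X] is linked to [A :&: B] inside [A], the minor
    in [B] is pulled back along the linkage; if not, a smallest cut between them gives a linked
    separation of order below |X|. A linkage fixes roots already in [A :&: B], so only lists
    containing those occur. *)
Lemma no_rigid_sep A B : sep e V A B -> X \subset A -> B :\: A != set0 ->
  ~ (forall t, uniq t -> {subset t <= A :&: B} -> size t <= #|X| ->
       {in X, forall x, x \in A :&: B -> x \in t} -> mlinked B e t).
Proof.
set Z := A :&: B => sAB XA BA0 rigid.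
have [ABV noe] := sepP _ _ _ _ sAB.
have ZA : Z \subset A by apply: subsetIl.
have ZB : Z \subset B by apply: subsetIr.
have [[A0 [B0 [s0 XA0 ZB0 lt0]]]|[P [f L]]] := menger sym XA ZA; last first.
  have sX' : {subset s <= X} by move=> x; rewrite sX.
  apply: not_linked; rewrite -ABV; apply: (linkage_mlinked sym L) => //; apply: rigid.
  - by rewrite map_inj_in_uniq // => x y /sX' xX /sX' yX; apply: (linkage_inj L).
  - by move=> _ /mapP[x /sX' xX ->]; case: (linkage_end L xX).
  - by rewrite size_map szs.
  - by move=> x xX xZ; rewrite -(linkage_fix L xX xZ) map_f // sX.
pose Q := fun p : {set T} * {set T} => [&& sep e A p.1 p.2, X \subset p.1,
  Z \subset p.2 & #|p.1 :&: p.2| < #|X|].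
have Q0 : Q (A0, B0) by rewrite /Q /= s0 XA0 ZB0.
case: (@arg_minnP _ (A0, B0) Q (fun p => #|p.1 :&: p.2|) Q0) => -[A1 B1] /and4P[/= s1 XA1 ZB1 lt] Hmin.
have [A1A B1A] := sep_sub s1; have [AE noe1] := sepP _ _ _ _ s1.
(* Since [A1 :&: B1] is a smallest cut, all of it can be linked to [Z] inside [B1]. *)
have [[A2 [B2 [s2 SA2 ZB2 lt2]]]|[P [f L]]] := menger sym (subsetIr A1 B1) ZB1.
  have [s3 iE dE] := sep_extend s1 s2 SA2.
  have := Hmin (A1 :|: A2, B2);
    rewrite /Q /= s3 iE ZB2 (ltn_trans lt2 lt) (subset_trans XA1 (subsetUl _ _)).
  by move=> /(_ isT); rewrite leqNgt lt2.
have ZE : B1 :&: B = Z.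
  apply/setP=> x; apply/setIP/idP => [[xB1 xB]|xZ]; first by rewrite inE (subsetP B1A).
  by rewrite (subsetP ZB1) ?(subsetP ZB).
have sE : sep e V A1 (B1 :|: B).
  apply/sepP; split; first by rewrite setUA AE.
  move=> x y xA1; rewrite !inE negb_or => /andP[xB1 xB] yB yA1.
  have [yB1|yB1] := boolP (y \in B1); first exact: noe1.
  rewrite (negPf yB1) /= in yB; apply: noe => //; first exact: (subsetP A1A).
  by apply: contra yB1 => yA; apply: (subsetP ZB1); rewrite inE yA.
have iE : A1 :&: (B1 :|: B) = A1 :&: B1.
  rewrite setIUr; apply/setUidPl/subsetP=> x /setIP[xA1 xB]; rewrite inE xA1.
  by apply: (subsetP ZB1); rewrite inE xB (subsetP A1A).
apply: (no_linked_sep sE XA1); rewrite ?iE //.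
  case/set0Pn: BA0 => x /setDP[xB xA]; apply/set0Pn; exists x; rewrite !inE xB orbT andbT.
  by apply: contra xA; apply: (subsetP A1A).
move=> t ut tE; rewrite -ZE in L.
have tS : {subset t <= A1 :&: B1} by move=> x; rewrite tE.
apply: (linkage_mlinked sym L) => //; rewrite ZE in L; apply: rigid.
- by rewrite map_inj_in_uniq // => x y /tS xX /tS yX; apply: (linkage_inj L).
- by move=> _ /mapP[x /tS xX ->]; case: (linkage_end L xX).
- by rewrite size_map -(card_uniqP ut) (eq_card tE) ltnW.
- move=> x xX xZ; have xS : x \in A1 :&: B1 by rewrite inE (subsetP XA1) // (subsetP ZB1).
  by rewrite -(linkage_fix L xS xZ) map_f // tE.
Qed.

Lemma in_nb w Y z : (z \in nb e Y w) = (z \in Y) && e w z.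
Proof. by rewrite inE. Qed.

Lemma card_nb_setU1 w z Y : z \notin Y -> #|nb e (z |: Y) w| = e w z + #|nb e Y w|.
Proof.
move=> zY; case wz: (e w z) => /=.
  have -> : nb e (z |: Y) w = z |: nb e Y w.
    by apply/setP=> x; rewrite !inE; case: eqP => // ->; rewrite wz.
  by rewrite cardsU1 inE (negPf zY).
apply: eq_card => x; rewrite !inE; case: eqP => // ->; by rewrite wz !andbF.
Qed.

Lemma card_nb_le w Y : #|nb e Y w| <= #|Y|.
Proof. by apply: subset_leq_card; apply/subsetP=> x; rewrite inE => /andP[]. Qed.

Lemma card_nb_full w Y : #|nb e Y w| = #|Y| -> {in Y, forall x, e w x}.
Proof.
move=> E x xY; have : nb e Y w = Y.
  apply/eqP; rewrite eqEcard E leqnn andbT; apply/subsetP=> y; by rewrite inE => /andP[].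
by move/setP/(_ x); rewrite inE xY.
Qed.

Lemma card_nb_count w : #|nb e X w| = count (e w) s.
Proof.
rewrite -size_filter -(card_uniqP (filter_uniq _ us)); apply: eq_card => x.
by rewrite !inE mem_filter sX andbC.
Qed.

Lemma three_dense p q r : #|X| = 5 -> uniq [:: p; q;
  r] -> p \in V :\: X -> q \in V :\: X -> r \in V :\: X ->
  #|nb e X p| = 5 -> #|nb e X q| = 4 -> #|nb e X r| = 4 -> e q r -> False.
Proof.
move=> X5' u3 /setDP[pV pX] /setDP[qV qX] /setDP[rV rX] dp dq dr qr.
have s5 : size s = 5 by rewrite szs.
have cE w : #|nb e X w| = 4 -> count (fun x => ~~ e w x) s = 1.
  by rewrite card_nb_count => c4; have := count_predC (e w) s; rewrite s5 c4 => -[].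
apply: not_linked; apply: (@three_dominators _ _ _ p q r) => //.
- move: u3; rewrite /= !inE !negb_or => /and3P[/andP[-> ->] -> _].
  by rewrite !sX pX qX rX us.
- by move=> x; rewrite !inE => /or4P[/eqP->|/eqP->|/eqP->|]; rewrite // sX => /(subsetP XV).
- by move=> x; rewrite sX; apply: card_nb_full; rewrite dp.
- by rewrite /= qr cE.
- by rewrite /= sym qr cE.
Qed.

(* Otherwise the three vertices span at least 16 of the 18 possible edges among themselves
   and to [X]. *)
Lemma dense_component p q r : #|X| = 5 -> uniq [:: p; q;
  r] -> p \in V :\: X -> q \in V :\: X -> r \in V :\: X ->
  ~ (forall D, D \subset V :\: (p |: (q |: (r |: X))) -> D != set0 -> connected_in e D ->
       (forall x y, x \in D -> y \in V :\: (p |: (q |: (r |: X))) -> e x y -> y \in D) ->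
       rh e V D <= 5 * #|D|).
Proof.
move=> X5' u3 pVX qVX rVX H.
have [[pV pX] [qV qX] [rV rX]] := And3 (setDP pVX) (setDP qVX) (setDP rVX).
have := u3; rewrite /= !inE negb_or andbT => /andP[/andP[pq pr] qr].
have cE : c = 1 by case/and3P: adm => _ _; rewrite X5' eqxx => /eqP.
pose A := p |: (q |: (r |: X)).
have rX1 : r \notin X by [].
have qX1 : q \notin r |: X by rewrite !inE negb_or qr.
have pX1 : p \notin q |: (r |: X) by rewrite !inE !negb_or pq pr.
have AV : A \subset V by rewrite !subUset !sub1set pV qV rV.
have XA : X \subset A by do 3!apply: subset_trans (subsetUr _ _).
have rU := rh_components sym irr H; rewrite -/A in rU.
have A8 : #|A| = 8 by rewrite !cardsU1 pX1 qX1 rX1 X5'.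
have cV : #|V :\: X| = #|V :\: A| + 3.
  rewrite !cardsD (setIidPr XV) (setIidPr AV) X5' A8.
  by have := subset_leq_card AV; rewrite A8; clear; lia.
have rA : rh e A (A :\: X) = e p q + (e p r + #|nb e X p|) + (e q r + #|nb e X q| + #|nb e X r|).
  rewrite /A rh_add_vertex //; last by do 2!apply: subset_trans (subsetUr _ _).
  rewrite rh_add_vertex ?subsetUr // rh_add_vertex // setDv rh0 addn0.
  by rewrite !card_nb_setU1 // !inE negb_or.
have := density; rewrite (rh_restrict sym irr XA AV) cV rA cE.
have dp := card_nb_le p X; have dq := card_nb_le q X; have dr := card_nb_le r X.
rewrite X5' in dp dq dr.
have two a b : a != b -> a \in V :\: X -> b \in V :\: X -> #|nb e X a| = 5 -> #|nb e X b| = 5 -> False.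
  move=> ab aV bV da db; apply: not_dominated; apply/dominatedP; split=> //.
  by exists a, b; split=> // x xX; rewrite (@card_nb_full a X) ?(@card_nb_full b X) ?da ?db.
have t1 := two p q pq pVX qVX; have t2 := two p r pr pVX rVX; have t3 := two q r qr qVX rVX.
have u' : uniq [:: q; p; r] by rewrite /= !inE negb_or eq_sym pq qr pr.
have u'' : uniq [:: r; p; q] by rewrite /= !inE negb_or ![r == _]eq_sym pr qr pq.
have T1 := three_dense X5' u3 pVX qVX rVX.
have T2 := three_dense X5' u' qVX pVX rVX.
have T3 := three_dense X5' u'' rVX pVX qVX.
(* At most one of the three is complete to [X], so they have at most 5 + 4 + 4 + 3 = 16 edges, while
   the density asks for 5 * 3 + 1. Equality leaves exactly the situation of [three_dense]. *)
move: rU dp dq dr t1 t2 t3 T1 T2 T3.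
move: (rh e V _) #|V :\: A| #|nb e X p| #|nb e X q| #|nb e X r| => R n a b d.
case: (e p q); case: (e p r); case: (e q r) => /=; clear; move=> rU ha hb hd t1 t2 t3 T1 T2 T3 H.
all: have [ab|ab] : ~ (a = 5 /\ b = 5) \/ (a = 5 /\ b = 5) by lia.
all: try by case: ab; apply: t1.
all: have [ad|ad] : ~ (a = 5 /\ d = 5) \/ (a = 5 /\ d = 5) by lia.
all: try by case: ad; apply: t2.
all: have [bd|bd] : ~ (b = 5 /\ d = 5) \/ (b = 5 /\ d = 5) by lia.
all: try by case: bd; apply: t3.
all: clear t1 t2 t3.
all: have [[e1 [e2 e3]]|[[e1 [e2 e3]]|[e1 [e2 e3]]]] : (a = 5 /\ b = 4 /\ d = 4) \/ (b = 5 /\ a = 4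
  /\ d = 4) \/ (d = 5 /\ a = 4 /\ b = 4) by clear T1 T2 T3; lia.
all: first [exact: T1 | exact: T2 | exact: T3 | clear T1 T2 T3; lia].
Qed.

(* Contracting v into u keeps the pair massed: a separation spoiling this lifts either to one
   of the excluded kinds or to one whose small side is linked by induction. If the contracted
   graph is dominated then u, v and the dominating vertices contain a dense triple. *)
Lemma edge_contraction u v : u \in V -> v \in V -> v \notin X -> e u v ->
  #|[set z in V | [&& z != u, e v z & e u z || (u \in X) && (z \in X)]]| <= 4 ->
  ~ (forall A B, sep e V A B -> X \subset A -> #|A :&: B| = #|X| -> u \in A :&: B -> v \in A :&: B ->
       ~~ heavy c e V A B).
Proof.
move=> uV vV vX uv few_common Hno.
pose V' := V :\ v; pose e' := ctr e u v.
have sym' : symmetric e' by apply: ctr_sym.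
have irr' : irreflexive e' by apply: ctr_irr.
have ee' x y : e x y -> e' x y.
  by move=> xy; rewrite /e' /ctr /= xy andbT; apply: contraTneq xy => ->; rewrite irr.
have vV' : v \notin V' by rewrite !inE eqxx.
have VE : v |: V' = V by apply: setD1K.
have ltV' : #|V'| < #|V| by rewrite -VE cardsU1 vV'.
have XV' : X \subset V' by rewrite subsetD1 XV.
have lift B t : v \notin B -> mlinked B e' t -> mlinked (v |: B) e t.
  move=> vB L; apply: (ctr_mlinked sym uv); first by rewrite !inE eqxx.
  suff -> : (v |: B) :\ v = B by [].
  by rewrite setU1K.
have nL : ~ mlinked V' e' s by move=> /(lift _ _ vV'); rewrite VE.
have M' : Mass e' V' X c.
  split=> //.
    have cV : #|V :\: X| = #|V' :\: X|.+1.
      by rewrite -VE setDUl (setDidPl _) ?disjoints1 // cardsU1 inE (negPf vV') andbF.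
    have := rh_ctr sym irr uV vV uv XV vX; have := density; rewrite cV -/V' -/e' => d1 d2.
    rewrite /heavy; apply/andP; split; last by move: d1 d2 few_common; clear; lia.
    (* If [v] were the only vertex outside [X], it would need 5 + c neighbours in [X], which
       [admissible] makes impossible. *)
    apply/negP=> /eqP V0; move: d1; rewrite V0 cards0 -{1 2}VE rh_add_vertex // V0 rh0 addn0.
    have V'X : V' = X by apply/eqP; rewrite eqEsubset XV' andbT -setD_eq0 V0.
    have := card_nb_le v V'; rewrite V'X; have /and3P[_ _ /implyP cX] := adm.
    have [X5'|X5'] := eqVneq #|X| 5.
      by rewrite X5' eqxx in cX; have /eqP := cX isT; rewrite X5'; clear; lia.
    by move: X5 X5'; clear; lia.
  suff: ~ exists p : {set T} * {set T}, [&& sep e' V' p.1 p.2, X \subset p.1,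
    #|p.1 :&: p.2| < #|X| & heavy c e' V' p.1 p.2].
    move=> H A' B' sAB' XA' lt; apply/negP=> h; apply: H; exists (A', B'); by rewrite /= sAB' XA' lt.
  case=> p0 Pp0.
  case: (@arg_minnP _ p0 (fun p => [&& sep e' V' p.1 p.2, X \subset p.1,
    #|p.1 :&: p.2| < #|X| & heavy c e' V' p.1 p.2]) (fun p => #|p.1 :&: p.2|) Pp0) => -[A B] /=
      /and4P[sAB XA lt h] Hmin {p0 Pp0}.
  have [AE noe] := sepP _ _ _ _ sAB.
  have [AV BV] := sep_sub sAB.
  have BA0 : B :\: A != set0 by case/andP: h.
  have vA : v \notin A by apply: contra vV'; apply: (subsetP AV).
  have vB : v \notin B by apply: contra vV'; apply: (subsetP BV).
  have uV' : u \in V' by rewrite !inE uV andbT; apply: contraTneq uv => ->; rewrite irr.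
  have noe1 x y : x \in A -> x \notin B -> y \in B -> y \notin A -> ~~ e x y.
    by move=> xA xB yB yA; have := noe x y xA xB yB yA; apply: contra; apply: ee'.
  have XvA : X \subset v |: A by apply: subset_trans XA (subsetUr _ _).
  have heavy_lift A1 B1 : B1 :\: A1 = B :\: A -> u \notin B :\: A -> heavy c e V A1 B1.
    move=> dE uBA; move: h; rewrite /heavy dE => /andP[-> le] /=; apply: leq_trans le _.
    by apply: rh_ctr_local; rewrite // !inE (negPf vB) andbF.
  (* When the separation is lifted, [v] follows [u]. If [u] is only in [B], that side is linked by
     induction and the minors lift; if only in [A], the heavy part avoids [u] and [v], and heaviness
     lifts. *)
  have [uA|uA] := boolP (u \in A); last first.
    have uB : u \in B by move: uV'; rewrite -AE inE (negPf uA).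
    have c5 : #|A :&: B| < 5 by apply: leq_trans lt X5.
    have M2 : Mass e' B (A :&: B) c.
      apply: (submass sym' irr' sAB h) => A2 B2 s2 AA2 lt2; apply/negP=> h2.
      have := Hmin (A2, B2); rewrite /= s2 h2 (subset_trans XA AA2) (ltn_trans lt2 lt) => /(_ isT).
      by rewrite leqNgt lt2.
    have ltB : #|B| < #|V| by apply: leq_ltn_trans ltV'; apply: subset_leq_card.
    have LB : Linked B e' (A :&: B).
      case: (IH sym' irr' ltB (admissible_small c1 c5) M2) => // /dominatedP[E _].
      by rewrite E in c5.
    have s2 : sep e V A (v |: B).
      apply/sepP; split; first by rewrite setUCA AE VE.
      move=> x y xA; rewrite !inE negb_or => /andP[xv xB] /predU1P[->|yB] yA; last exact: noe1.
      apply/negP=> xv'; have := noe x u xA xB uB uA; rewrite /e' /ctr /= eqxx xv' !orbT andbT negbK.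
      by move=> /eqP xu; rewrite xu (negPf uA) in xA.
    have iE : A :&: (v |: B) = A :&: B.
      rewrite setIUr; apply/setUidPr/subsetP=> x; rewrite !inE => /andP[xA /eqP xv].
      by rewrite xv (negPf vA) in xA.
    apply: (no_linked_sep s2 XA); rewrite ?iE //.
      by case/set0Pn: BA0 => x /setDP[xB xA]; apply/set0Pn; exists x; rewrite !inE xA xB orbT.
    by move=> t ut tE; apply: lift vB _; apply: LB.
  have [uB|uB] := boolP (u \in B); last first.
    have s2 : sep e V (v |: A) B.
      apply/sepP; split; first by rewrite -setUA AE VE.
      move=> x y; rewrite !inE negb_or => /predU1P[->|xA] xB yB /andP[yv yA]; last exact: noe1.
      apply/negP=> vy; have := noe u y uA uB yB yA; rewrite /e' /ctr /= eqxx vy !orbT andbT negbK.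
      by move=> /eqP uy; rewrite -uy (negPf uB) in yB.
    have iE : (v |: A) :&: B = A :&: B.
      rewrite setIUl; apply/setUidPr/subsetP=> x; rewrite !inE => /andP[/eqP xv xB].
      by rewrite xv (negPf vB) in xB.
    have := not_heavy s2 XvA; rewrite iE => /(_ lt)/negP; apply; apply: heavy_lift.
      by apply/setP=> x; rewrite !inE; case: eqP => // ->; rewrite (negPf vB) !andbF.
    by rewrite inE uA.
  (* Here [v] joins both sides and the order grows by one, possibly up to |X|: the case that [Hno]
     excludes. *)
  have s2 : sep e V (v |: A) (v |: B).
    apply/sepP; split; first by rewrite setUACA setUid AE VE.
    move=> x y; rewrite !inE !negb_or => /predU1P[->|xA] /andP[xv xB]; first by rewrite eqxx in xv.
    by move=> /predU1P[->|yB] /andP[yv yA]; [rewrite eqxx in yv | apply: noe1].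
  have iE : (v |: A) :&: (v |: B) = v |: (A :&: B) by rewrite setUIr.
  have hv : heavy c e V (v |: A) (v |: B).
    apply: heavy_lift; last by rewrite inE uA.
    by apply/setP=> x; rewrite !inE; case: eqP => // ->; rewrite (negPf vB) !andbF.
  have cI : #|(v |: A) :&: (v |: B)| = #|A :&: B|.+1.
    by rewrite iE cardsU1 inE (negPf vA).
  have [E|lt'] := eqVneq #|A :&: B|.+1 #|X|.
    have := Hno _ _ s2 XvA; rewrite cI => /(_ E); rewrite !inE eqxx uA uB orbT => /(_ isT isT).
    by rewrite hv.
  have := not_heavy s2 XvA; rewrite cI hv ltn_neqAle lt' lt => /(_ isT).
  by [].
case: (IH sym' irr' ltV' adm M') => [L|/dominatedP[X5' [a [b [aV' bV' ab He]]]]].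
  by apply: nL; apply: L.
have cE : c = 1 by case/and3P: adm => _ _; rewrite X5' eqxx => /eqP.
have s5 : size s = 5 by rewrite szs.
have [/setD1P[av aV] aX] := setDP aV'; have [/setD1P[bv bV] bX] := setDP bV'.
have aVX : a \in V :\: X by rewrite inE aX.
have bVX : b \in V :\: X by rewrite inE bX.
have vVX : v \in V :\: X by rewrite inE vX.
(* Only edges at [u] are new. If [u] is neither a root nor one of [a], [b], these two already
   dominate in [e]. *)
have Hu : u \in X \/ u = a \/ u = b.
  have [uX|uX] := boolP (u \in X); first by left.
  have [ua|ua] := eqVneq u a; first by right; left.
  have [ub|ub] := eqVneq u b; first by right; right.
  case: not_dominated; apply/dominatedP; split=> //; exists a, b; split=> // x xX.
  have xu : x != u by apply: contraNneq uX => <-.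
  have /andP[] := He x xX;
    rewrite /e' /ctr /= (negPf xu) ![_ == u]eq_sym (negPf ua) (negPf ub) /= !orbF.
  by move=> /andP[_ ->] /andP[_ ->].
(* As [u] is a root, [a] or [b], this set is [X] together with exactly three vertices, and
   [dense_component] applies to them. *)
pose W := u |: (v |: (a |: (b |: X))).
have comp D : D \subset V :\: W -> D != set0 -> connected_in e D ->
    (forall x y, x \in D -> y \in V :\: W -> e x y -> y \in D) -> rh e V D <= 5 * #|D|.
  move=> DU D0 cD clD.
  have DV : D \subset V by apply: subset_trans DU (subsetDl _ _).
  have DW x : x \in D -> x \notin W by move=> /(subsetP DU)/setDP[].
  have cD' : connected_in e' D by apply: connS cD => x y; apply: ee'.
  have DV' : D \subset V' :\: (a |: (b |: X)).
    apply/subsetP=> x xD; have := DW x xD; rewrite !inE !negb_or => /and3P[_ -> ->].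
    exact: (subsetP DV).
  have [I I2 HI] := attachment_card sym' us sX s5 XV' aV' bV' ab He nL DV' cD'.
  pose J := [set a; b] :|: I.
  have J4 : #|J| <= 4.
    by apply: leq_trans (leq_card_setU _ _) _; rewrite cards2 ab (leq_add2l 2 _ 2).
  have NJ : nbs e V D \subset v |: J.
    apply/subsetP=> z; rewrite !inE => /andP[/andP[zD zV] /existsP[y /andP[yD yz]]].
    have zW : z \in W by apply: contraR zD => zW; apply: clD yD _ yz; rewrite inE zW.
    have zX : z \in X -> z \in I.
      by move=> zX; apply: HI => //; apply/touchP; exists y, z; split; rewrite ?inE // ee'.
    move: zW; rewrite !inE => /or4P[zu|->|->|/orP[->|/zX->]]; rewrite ?orbT //.
    case: Hu => [uX|[ua|ub]].
    - by rewrite -(eqP zu) in uX; rewrite (zX uX) !orbT.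
    - by rewrite (eqP zu) ua eqxx !orbT.
    - by rewrite (eqP zu) ub eqxx !orbT.
  have [sD iD dD] := sep_nbs sym DV.
  have XD : X \subset V :\: D.
    rewrite subsetD XV /= disjoint_sym; apply/pred0P=> x /=; apply/negP=> /andP[xD xX].
    by have := DW _ xD; rewrite !inE xX !orbT.
  have small : #|nbs e V D| < 5 -> rh e V D <= 5 * #|D|.
    move=> lt; have := not_heavy sD XD; rewrite iD X5' => /(_ lt).
    by rewrite /heavy dD D0 /= -ltnNge cE addn1 ltnS.
  (* The neighbours of [D] lie in [v |: J] with |J| at most 4. If [v] is among them, then [u] is in
     [J]. So five neighbours force both [u] and [v] to occur, and [Hno] bounds the density of
     [D]. *)
  have [vN|vN] := boolP (v \in nbs e V D); last first.
    apply: small; apply: (@leq_ltn_trans #|J|) => //; apply: subset_leq_card; apply/subsetP=> z zN.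
    have := subsetP NJ z zN; rewrite !inE => /predU1P[zv|//]; by rewrite -zv zN in vN.
  have uJ : u \in J.
    case: Hu => [uX|[->|->]]; rewrite !inE ?eqxx ?orbT //.
    rewrite HI ?orbT //; move: vN; rewrite inE => /andP[_ /existsP[y /andP[yD yv]]].
    apply/touchP; exists y, u; rewrite inE eqxx; split=> //.
    have yu : y != u by apply: contraTneq yD => ->; apply/negP=> /DW; rewrite !inE eqxx.
    by rewrite /e' /ctr /= yu eqxx yv !orbT.
  have [uN|uN] := boolP (u \in nbs e V D); last first.
    apply: small; apply: (@leq_ltn_trans #|v |: (J :\ u)|).
      apply: subset_leq_card; apply/subsetP=> z zN; have := subsetP NJ z zN.
      rewrite !inE => /predU1P[->|zJ]; first by rewrite eqxx.
      by rewrite zJ andbT; case: (eqVneq z u) => [zu|]; [rewrite -zu zN in uN | rewrite orbT].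
    have := cardsD1 u J; rewrite uJ => JE; rewrite cardsU1.
    by move: J4 JE; case: (_ \notin _); clear; lia.
  have [lt|ge] := ltnP #|nbs e V D| 5; first exact: small.
  have c5 : #|nbs e V D| = #|X|.
    apply/eqP; rewrite eqn_leq X5' ge andbT; apply: leq_trans (subset_leq_card NJ) _.
    by rewrite cardsU1; move: J4; case: (_ \notin _); clear; lia.
  have := Hno _ _ sD XD; rewrite iD => /(_ c5 uN vN).
  by rewrite /heavy dD D0 /= -ltnNge cE addn1 ltnS.
have uv' : u != v by apply: contraTneq uv => ->; rewrite irr.
case: Hu => [uX|[ua|ub]].
- have WE : v |: (a |: (b |: X)) = W by rewrite /W; apply/esym/setUidPr; rewrite sub1set !inE uX !orbT.
  by apply: (@dense_component v a b); rewrite ?WE //= !inE negb_or ![v == _]eq_sym av bv ab.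
- have WE : u |: (v |: (b |: X)) = W by rewrite /W ua; apply/setP=> x; rewrite !inE;
  case: (x == a); rewrite ?orbT.
  by apply: (@dense_component u v b); rewrite ?WE //= ?ua // !inE negb_or av ab eq_sym bv.
- have WE : u |: (v |: (a |: X)) = W by rewrite /W ub; apply/setP=> x; rewrite !inE;
  case: (x == b); rewrite ?orbT.
  by apply: (@dense_component u v a); rewrite ?WE //= ?ub // !inE negb_or bv eq_sym ab eq_sym av.
Qed.

(** By [no_rigid_sep] the side [B] is not linked, so induction makes it dominated. Any further
    component in [B] has at most four neighbours and is strictly below density five by [no_heavy0].
    As [a] and [b] contribute at most 11 edges, the required excess leaves no such component and
    forces the edge [ab]. *)
Lemma heavy_structure A B : sep e V A B -> X \subset A -> #|A :&: B| = #|X| -> heavy c e V A B ->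
  B != V ->
  exists a b t, [/\ #|X| = 5, B :\: A = [set a; b], a != b, e a b &
    {in A :&: B, forall x, e a x && e b x}] /\ [/\ uniq t, t =i A :&: B & ~ mlinked B e t].
Proof.
set S := A :&: B => sAB XA cS h BV'.
have [AV BV] := sep_sub sAB; have [ABV noe] := sepP _ _ _ _ sAB.
have BA0 : B :\: A != set0 by case/andP: h.
have SB : S \subset B by apply: subsetIr.
have BSA : B :\: S = B :\: A by rewrite /S setDIr setDv setU0.
have [t [ut tE nt]] : exists t, [/\ uniq t, t =i S & ~ mlinked B e t].
  apply: NNPP => H; apply: (no_rigid_sep sAB XA BA0) => t ut tS _ _.
  apply: (Linked_sub (X := S)) => // t' ut' tE'; apply: NNPP => nt; apply: H; by exists t'.
have ltB : #|B| < #|V| by apply: proper_card; rewrite properEneq BV' BV.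
have M : Mass e B S c.
  apply: (submass sym irr sAB h) => A2 B2 s2 AA2; rewrite -/S cS => lt.
  by apply: not_heavy => //; apply: subset_trans XA AA2.
have admS : admissible S c by rewrite /admissible cS.
case: (IH sym irr ltB admS M) => [L|/dominatedP[S5 [a [b [aBS bBS ab He]]]]].
  by case: nt; apply: L.
have X5' : #|X| = 5 by rewrite -cS.
have cE : c = 1 by case/and3P: adm => _ _; rewrite X5' eqxx => /eqP.
have [aB aS] := setDP aBS; have [bB bS] := setDP bBS.
pose A0 := a |: (b |: S); pose U := B :\: A0.
have A0B : A0 \subset B by rewrite !subUset !sub1set aB bB.
have SA0 : S \subset A0 by do 2!apply: subset_trans (subsetUr _ _).
have abS : a \notin b |: S by rewrite in_setU1 negb_or ab.
have cBS : #|B :\: S| = #|U| + 2.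
  rewrite /U !cardsD (setIidPr SB) (setIidPr A0B) S5 !cardsU1 abS bS S5.
  have := subset_leq_card A0B; rewrite !cardsU1 abS bS S5; clear; lia.
have rE : rh e B (B :\: S) = rh e B U + (e a b + #|nb e S a| + #|nb e S b|).
  rewrite (rh_restrict sym irr SA0 A0B) -/U /A0 rh_add_vertex ?subsetUr // rh_add_vertex // setDv
    rh0 addn0.
  by rewrite card_nb_setU1.
have hB : 5 * (#|U| + 2) + 1 <= rh e B U + (e a b + #|nb e S a| + #|nb e S b|).
  by rewrite -rE -cBS BSA -(rh_sep sym irr sAB); move: h; rewrite /heavy cE => /andP[].
have da := card_nb_le a S; have db := card_nb_le b S; rewrite S5 in da db.
have [U0|U0] := eqVneq U set0.
  exists a, b, t; split=> //; split=> //.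
    have BE : B = A0 by apply/eqP; rewrite eqEsubset A0B andbT -setD_eq0 -/U U0.
    rewrite -BSA {1}BE; apply/setP=> x; rewrite in_setD !in_setU1 in_set1.
    have [->|_] := eqVneq x a; first by rewrite aS.
    have [->|_] := eqVneq x b; first by rewrite bS.
    by case: (x \in S).
  by move: hB; rewrite U0 rh0 cards0; case: (e a b) => //; move: da db; clear; lia.
have rU : rh e V U + 1 <= 5 * #|U|.
  apply: (rh_components_slack sym irr) U0 => D DU D0 cD clD.
  have t5 : size t = 5 by rewrite -S5 -(eq_card tE) (card_uniqP ut).
  have [I I2 HI] := attachment_card sym ut tE t5 SB aBS bBS ab He nt DU cD.
  have DBA : D \subset B :\: A.
    rewrite -BSA; apply: subset_trans DU _; apply: setDS; exact: SA0.
  have DV : D \subset V by apply: subset_trans DBA (subset_trans (subsetDl _ _) BV).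
  have [sD iD dD] := sep_nbs sym DV.
  have XD : X \subset V :\: D.
    rewrite subsetD XV /= disjoint_sym; apply/pred0P=> x /=; apply/negP=> /andP[xD xX].
    by have := subsetP DBA _ xD; rewrite !inE (subsetP XA).
  have := no_heavy0 sD XD; rewrite iD /heavy dD D0 addn0 /= -ltnNge addn1; apply.
  rewrite X5'; apply: (@leq_ltn_trans #|[set a; b] :|: I|); last first.
    by rewrite ltnS; apply: leq_trans (leq_card_setU _ _) _; rewrite cards2 ab (leq_add2l 2 _ 2).
  apply: subset_leq_card; apply/subsetP=> z;
    rewrite !inE => /andP[/andP[zD zV] /existsP[y /andP[yD yz]]].
  have /setDP[yB yA] := subsetP DBA y yD.
  have zB : z \in B.
    apply/negPn/negP=> zB; have zA : z \in A by move: zV; rewrite -ABV inE (negPf zB) orbF.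
    by have := noe z y zA zB yB yA; rewrite sym yz.
  have zA0 : z \in A0 by apply: contraR zD => zA0; apply: clD yD _ yz; rewrite inE zA0.
  move: zA0; rewrite !in_setU1 => /or3P[->|->|zS]; rewrite ?orbT //.
  by rewrite HI ?orbT //; apply/touchP; exists y, z; rewrite inE.
have := rh_sub_vertices sym irr U BV; move: rU hB da db.
by case: (e a b) => /=; clear; lia.
Qed.

(* Otherwise B consists of S = A :&: B and two dominating vertices a, b, and contracting a into
   a vertex of S outside X is possible. *)
Lemma no_heavy A B : sep e V A B -> X \subset A -> #|A :&: B| = #|X| -> heavy c e V A B -> B = V.
Proof.
move=> sAB XA cS h; apply/eqP/negPn/negP=> BV'.
have [a [b [t [[X5' BAE ab eab He] [ut tE nt]]]]] := heavy_structure sAB XA cS h BV'.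
have [AV BV] := sep_sub sAB; have [ABV noe] := sepP _ _ _ _ sAB.
set S := A :&: B in cS He tE.
have /setDP[aB aA] : a \in B :\: A by rewrite BAE !inE eqxx.
have /setDP[bB bA] : b \in B :\: A by rewrite BAE !inE eqxx orbT.
have [aV bV] := (subsetP BV a aB, subsetP BV b bB).
have aX : a \notin X by apply: contra aA; apply: (subsetP XA).
have bX : b \notin X by apply: contra bA; apply: (subsetP XA).
(* If the separator is [X] itself, [a] and [b] dominate the whole pair; otherwise a vertex [s0]
   outside [X] is available for contraction. *)
have [XS|] := boolP (S \subset X).
  have SX : S = X by apply/eqP; rewrite eqEcard XS cS leqnn.
  apply: not_dominated; apply/dominatedP; split=> //; exists a, b.
  by rewrite !inE aX bX aV bV -SX; split.
case/subsetPn=> s0 s0S s0X.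
have t5 : size t = 5 by rewrite -X5' -cS -(eq_card tE) (card_uniqP ut).
have SB : S \subset B by apply: subsetIr.
have aS : a \notin S by rewrite inE (negPf aA).
have bS : b \notin S by rewrite inE (negPf bA).
have cyt : cycle (fun x y => ~~ e x y) t.
  apply: (nonadjacent_roots sym ut t5 _ aB bB ab _ _ _ nt); rewrite ?tE //.
  - by move=> x; rewrite tE; apply: (subsetP SB).
  - by move=> x; rewrite tE => /He.
have [sp tri] := sparse_roots sym irr t5 cyt.
have nbS x : x \in S -> #|nb e S x| <= 2.
  rewrite -tE => /sp; apply: leq_trans; rewrite -size_filter -(card_uniqP (filter_uniq _ ut)).
  by apply: subset_leq_card; apply/subsetP=> y; rewrite inE mem_filter tE andbC.
have nba x : x \in V -> e a x -> x = b \/ x \in S.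
  move=> xV ax; have xB : x \in B.
    apply/negPn/negP=> xB; have xA : x \in A by move: xV; rewrite -ABV inE (negPf xB) orbF.
    by have := noe x a xA xB aB aA; rewrite sym ax.
  have [xA|xA] := boolP (x \in A); first by right; rewrite inE xA.
  have : x \in B :\: A by rewrite inE xA.
  by rewrite BAE !inE => /orP[/eqP xa|/eqP->]; [rewrite xa irr in ax | left].
have nbb x : x \in V -> e b x -> x = a \/ x \in S.
  move=> xV bx; have xB : x \in B.
    apply/negPn/negP=> xB; have xA : x \in A by move: xV; rewrite -ABV inE (negPf xB) orbF.
    by have := noe x b xA xB bB bA; rewrite sym bx.
  have [xA|xA] := boolP (x \in A); first by right; rewrite inE xA.
  have : x \in B :\: A by rewrite inE xA.
  by rewrite BAE !inE => /orP[/eqP->|/eqP xb]; [left | rewrite xb irr in bx].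
have s0V : s0 \in V by apply: (subsetP BV); apply: (subsetP SB).
have /andP[as0 bs0] := He s0 s0S.
apply: (@edge_contraction s0 a) => //; first by rewrite sym.
  (* All neighbours of [a] are [b] and [S], and [s0] has at most two neighbours in [S]: three common
     neighbours at most. *)
  apply: (@leq_trans #|b |: nb e S s0|).
    apply: subset_leq_card; apply/subsetP=> z; rewrite in_set (negPf s0X) /= orbF.
    case/and4P=> zV zs0 az s0z; rewrite in_setU1 in_nb s0z andbT.
    by case: (nba z zV az) => [->|->]; rewrite ?eqxx ?orbT.
  rewrite cardsU1; have := nbS s0 s0S; case: (_ \notin _); clear; lia.
move=> A2 B2 sA2 XA2 cS2 s0S2 aS2; apply/negP=> h2.
have B2V : B2 != V.
  apply: contraNneq aX => B2V; have A2X : A2 = X.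
    apply/esym/eqP; rewrite eqEcard XA2 -cS2 B2V; have [A2V _] := sep_sub sA2.
    by rewrite (setIidPl A2V) leqnn.
  by move: aS2; rewrite A2X inE => /andP[].
have [a2 [b2 [_ [[_ BAE2 ab2 eab2 He2] _]]]] := heavy_structure sA2 XA2 cS2 h2 B2V.
set S2 := A2 :&: B2 in cS2 He2 s0S2 aS2.
have /setDP[a2B a2A] : a2 \in B2 :\: A2 by rewrite BAE2 !inE eqxx.
have /setDP[b2B b2A] : b2 \in B2 :\: A2 by rewrite BAE2 !inE eqxx orbT.
have [_ B2V'] := sep_sub sA2.
have [a2V b2V] := (subsetP B2V' a2 a2B, subsetP B2V' b2 b2B).
have /andP[a2a b2a] := He2 a aS2; have /andP[a2s b2s] := He2 s0 s0S2.
(* A vertex of [S] and the other dominating vertex have at most three common neighbours. *)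
have clash y : y \in S -> {in S2, forall x, e y x && e b x} -> False.
  move=> yS H; have : #|S2| <= #|a |: nb e S y|.
    apply: subset_leq_card; apply/subsetP=> x xS2; have /andP[yx bx] := H x xS2.
    have xV : x \in V by apply: (subsetP B2V'); move: xS2; rewrite inE => /andP[].
    by rewrite in_setU1 in_nb yx andbT; case: (nbb x xV bx) => [->|->]; rewrite ?eqxx ?orbT.
  by rewrite cS2 X5' cardsU1; have := nbS y yS; case: (_ \notin _); clear; lia.
(* Both [a2] and [b2] are neighbours of [a]. If one is [b], the other is in [S] and [clash] applies;
   otherwise they form a triangle with [s0] inside [S]. *)
have [a2b|a2S] : a2 = b \/ a2 \in S by apply: nba; rewrite // sym.
  have [b2b|b2S] : b2 = b \/ b2 \in S by apply: nba; rewrite // sym.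
    by rewrite a2b b2b eqxx in ab2.
  by apply: (clash b2 b2S) => x /He2; rewrite a2b andbC.
have [b2b|b2S] : b2 = b \/ b2 \in S by apply: nba; rewrite // sym.
  by apply: (clash a2 a2S) => x /He2; rewrite b2b.
by apply: (tri a2 b2 s0); rewrite ?tE.
Qed.

(* Neighbours in X are counted twice, so that the weights add up to exactly twice the density;
   this is the trade-off required by [neighbourhood_linked]. *)
Lemma low_degree : rh e V (V :\: X) = 5 * #|V :\: X| + c ->
  exists2 v, v \in V :\: X & #|nb e V v| + #|nb e X v| <= 10.
Proof.
move=> exact_rh; case: (boolP [exists v in V :\: X,
  #|nb e V v| + #|nb e X v| <= 10]) => [/exists_inP//|].
move=> /exists_inPn H; exfalso.
have H11 v : v \in V :\: X -> 11 <= #|nb e V v| + #|nb e X v| by move=> /H; rewrite -ltnNge.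
(* With n vertices outside [X], weights of at least 11 would give 11 n <= 10 n + 2 c. *)
have n2 : #|V :\: X| <= 2.
  have : 11 * #|V :\: X| <= (rh e V (V :\: X)).*2.
    by rewrite -(degree_sum sym irr XV) mulnC -sum_nat_const; apply: leq_sum.
  by rewrite exact_rh; move: c1; clear; lia.
have n0 : #|V :\: X| != 0 by rewrite cards_eq0; case: massed => _ /andP[].
have cV : #|V| = #|X| + #|V :\: X|.
  by rewrite cardsD (setIidPr XV) subnKC // subset_leq_card.
(* A degree is at most |V| - 1 <= 6 and at most 5 neighbours lie in [X], so weight 11 forces
   equality everywhere. *)
have full v : v \in V :\: X -> [/\ #|V :\: X| = 2, #|X| = 5 & #|nb e X v| = 5].
  move=> vVX; have [vV vX] := setDP vVX; have h := H11 v vVX.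
  have dV : #|nb e V v| < #|V|.
    apply: proper_card; apply/properP; split; first by apply/subsetP=> x; rewrite inE => /andP[].
    by exists v; rewrite // inE irr andbF.
  have dX := card_nb_le v X.
  by split; move: n2 n0 cV h dV dX X5; clear; lia.
have /set0Pn[v0 v0VX] : V :\: X != set0 by rewrite -cards_eq0.
have [n2' X5' _] := full v0 v0VX.
have /eqP/cards2P[a [b [ab abE]]] := n2'.
have aVX : a \in V :\: X by rewrite abE !inE eqxx.
have bVX : b \in V :\: X by rewrite abE !inE eqxx orbT.
apply: not_dominated; apply/dominatedP; split=> //; exists a, b; split=> // x xX.
have [_ _ da] := full a aVX; have [_ _ db] := full b bVX.
by rewrite (@card_nb_full a X) ?(@card_nb_full b X) ?da ?db.
Qed.

Lemma exact_density_absurd : rh e V (V :\: X) = 5 * #|V :\: X| + c -> False.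
Proof.
move=> exact_rh; have [v vVX deg_v] := low_degree exact_rh.
have [vV vX] := setDP vVX; pose N := nb e V v.
pose C u := [set z in V | [&& z != u, e v z & e u z || (u \in X) && (z \in X)]].
(* By [no_heavy] a heavy separation of order |X| has second side [V], hence first side [X], which
   does not contain [v]. So only too many common neighbours can block the contraction of [uv]. *)
have C5 u : u \in N -> 5 <= #|C u|.
  rewrite in_nb => /andP[uV vu]; rewrite leqNgt; apply/negP=> lt.
  apply: (@edge_contraction u v) => //; first by rewrite sym.
  move=> A B sAB XA cAB uAB vAB; apply/negP=> h.
  have BV := no_heavy sAB XA cAB h; have [AV _] := sep_sub sAB.
  have AX : A = X by apply/esym/eqP; rewrite eqEcard XA -cAB BV (setIidPl AV) leqnn.
  by move: vAB; rewrite AX inE (negPf vX).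
have vN : v \notin N by rewrite in_nb irr andbF.
have NV : N \subset V by apply/subsetP=> x; rewrite in_nb => /andP[].
(* If [v] had no neighbour, the rest would keep all edges with one vertex less, giving a heavy
   separation that [no_heavy] forbids. *)
have [N0|[u uN]] := set_0Vmem N.
  pose B := V :\ v; have vB : v \notin B by rewrite !inE eqxx.
  have VE : v |: B = V by apply: setD1K.
  have XB : X \subset B by rewrite subsetD1 XV.
  have sB : sep e V (v |: X) B.
    apply/sepP; split; first by rewrite -setUA (setUidPr XB) VE.
    move=> x y /setU1P[->|xX] xB yB yA; last by rewrite (subsetP XB) in xB.
    apply/negP=> vy; have : y \in N by rewrite in_nb vy andbT; move: yB; rewrite inE => /andP[].
    by rewrite N0 inE.
  have iE : (v |: X) :&: B = X.
    apply/setP=> x; rewrite !inE; have := subsetP XB x; rewrite !inE.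
    case: (x \in X) => [/(_ isT)->|_]; first by rewrite orbT.
    by rewrite orbF; case: (x == v).
  have dE : B :\: (v |: X) = B :\: X.
    by apply/setP=> x; rewrite !inE negb_or; case: (x == v); rewrite ?andbF ?andbT.
  have nB : nb e B v = set0.
    apply/setP=> x; rewrite in_nb in_set0; apply/negP=> /andP[xB vx].
    have : x \in N by rewrite in_nb vx andbT; move: xB; rewrite inE => /andP[].
    by rewrite N0 inE.
  have rE : rh e V (V :\: X) = rh e B (B :\: X).
    by rewrite -{1 2}VE rh_add_vertex // nB cards0.
  have cE : #|V :\: X| = #|B :\: X|.+1.
    by rewrite -VE setDUl (setDidPl _) ?disjoints1 // cardsU1 inE (negPf vB) andbF.
  have hB : heavy c e V (v |: X) B.
    rewrite /heavy (rh_sep sym irr sB) dE -rE exact_rh cE; apply/andP; split; last by clear; lia.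
    apply/negP=> /eqP B0; move: exact_rh; rewrite rE cE B0 rh0 cards0; clear; lia.
  have := no_heavy sB (subsetUr _ _); rewrite iE => /(_ erefl hB) BV.
  by rewrite BV vV in vB.
have C_sub w : w \in N -> C w \subset N :\ w.
  by move=> wN; apply/subsetP=> z; rewrite in_set in_setD1 in_nb => /and4P[-> -> -> _].
have N6 : 6 <= #|N|.
  rewrite (cardsD1 u) uN add1n ltnS; apply: leq_trans (C5 u uN) _.
  exact: subset_leq_card (C_sub u uN).
pose K := nb e X v.
have KE x : x \in N -> (x \in K) = (x \in X).
  by rewrite !in_nb => /andP[_ ->]; rewrite andbT.
(* The vertices missed by [w] and the at least five in [C w] are disjoint among the |N| - 1 other
   vertices of [N]. *)
have few : {in N, forall w,
    #|[set z in N | [&& z != w, ~~ e w z & ~~ ((w \in K) && (z \in K))]]| <= #|N| - 6}.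
  move=> w wN; set M := [set z in N | _].
  have : #|M| + #|C w| <= #|N :\ w|.
    rewrite -cardsUI (_ : M :&: C w = set0) ?cards0 ?addn0.
      apply: subset_leq_card; rewrite subUset C_sub // andbT; apply/subsetP=> z.
      by rewrite in_set in_setD1 => /and4P[-> -> _ _].
    apply/setP=> z; rewrite in_setI in_set0; apply/negP=> /andP[].
    rewrite [z \in M]in_set [z \in C w]in_set => /and4P[zN _ nwz nK] /and4P[_ _ _].
    by rewrite (negPf nwz) /= -!KE // (negPf nK).
  by have := C5 w wN; have := cardsD1 w N; rewrite wN; clear; lia.
have sA : sep e V (V :\ v) (v |: N).
  apply/sepP; split.
    apply/setP=> x; rewrite in_setU in_setD1 in_setU1 in_nb.
    by case: eqP => [->|_] /=; rewrite ?vV //; case: (x \in V).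
  move=> x y; rewrite in_setD1 in_setU1 negb_or => /andP[xv xV] /andP[_ xN] yB yA.
  have yv : y = v.
    apply/eqP; apply: contraR yA => yv; rewrite in_setD1 yv /=; apply: (subsetP NV).
    by move: yB; rewrite in_setU1 (negPf yv).
  by apply: contra xN => xy; rewrite in_nb xV sym -yv.
have iE : (V :\ v) :&: (v |: N) = N.
  apply/setP=> x; rewrite in_setI in_setD1 in_setU1; have := subsetP NV x.
  by case: eqP => [->|_] /=; [rewrite (negPf vN) | case: (x \in N) => [->|]; rewrite ?andbF].
apply: (no_rigid_sep sA).
- by rewrite subsetD1 XV.
- by apply/set0Pn; exists v; rewrite in_setD in_setD1 in_setU1 eqxx.
rewrite iE => t ut tN szt Xt.
(* The list is padded to five roots inside [N]; the bags of the padding are absorbed afterwards. *)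
pose ext := take (5 - size t) [seq x <- enum N | x \notin t].
have uext : uniq (t ++ ext).
  rewrite cat_uniq ut /=; apply/andP; split; last by apply/take_uniq/filter_uniq/enum_uniq.
  by apply/hasPn=> x /mem_take; rewrite mem_filter => /andP[].
apply: (@mlinked_catl _ _ _ t ext) => //.
have extN : {subset t ++ ext <= N}.
  move=> x; rewrite mem_cat => /orP[/tN//|/mem_take]; by rewrite mem_filter mem_enum => /andP[].
apply: (@neighbourhood_linked _ e v N K) => //.
- by move=> x; rewrite in_nb => /andP[].
- have : size t + size [seq x <- enum N | x \notin t] = #|N|.
    rewrite [RHS]cardE -(count_predC (mem t) (enum N)) !size_filter; congr (_ + _).
    rewrite -size_filter; apply/eqP;
      rewrite -(card_uniqP ut) -(card_uniqP (filter_uniq _ (enum_uniq _))).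
    by apply/eqP; apply: eq_card => x; rewrite mem_filter mem_enum; rewrite /=;
      case: (boolP (x \in t)) => [/tN->|].
  have t5 := leq_trans szt X5.
  rewrite size_cat size_take; case: ltnP => lt; first by rewrite subnKC.
  by move=> E; apply/eqP; rewrite eqn_leq E -{1}(subnKC t5) -E leq_add2l lt E (ltnW N6).
- move=> x xK; rewrite mem_cat; move: xK; rewrite in_nb => /andP[xX vx].
  by rewrite (Xt x xX) // in_nb vx (subsetP XV).
Qed.

(* Only edges avoiding X may be deleted: removing the last edge at a root can destroy (M2). *)
Lemma inner_edge : exists u v, [/\ u \in V :\: X, v \in V :\: X & e u v].
Proof.
apply: NNPP => H.
have rhX : (rh e V (V :\: X)).*2 <= #|V :\: X| * #|X|.*2.
  rewrite -(degree_sum sym irr XV) -sum_nat_const; apply: leq_sum => v vVX.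
  have -> : nb e V v = nb e X v; last by rewrite addnn leq_double card_nb_le.
  apply/setP=> x; rewrite !in_nb; case vx: (e v x); rewrite ?andbF // !andbT.
  apply/idP/idP => [xV|/(subsetP XV)//]; apply/negPn/negP=> xX; apply: H.
  by exists v, x; rewrite vVX inE xX xV.
have n0 : #|V :\: X| != 0 by rewrite cards_eq0; case: massed => _ /andP[].
move: rhX density adm n0; rewrite /admissible.
move: (rh e V _) #|V :\: X| #|X| => R n k; clear => h1 h2 /and3P[k5 _ hc] n0.
have : n * k.*2 <= n * 5.*2 by rewrite leq_mul2l leq_double k5 orbT.
have [k5'|k5'] := eqVneq k 5; first by move: hc; rewrite k5' => /implyP/(_ isT)/eqP c1; lia.
have : n * k.*2 <= n * 4.*2 by rewrite leq_mul2l leq_double; lia.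
lia.
Qed.

(** A separation that becomes heavy only after the deletion is crossed by the deleted edge. Adding
    the end in [A] to the other side yields a separation of [e] with order at most |X|, excluded by
    (M2) or, for order |X|, by [no_heavy], since that end is not in [X]. *)
Lemma del_massed u v : u \in V :\: X -> v \in V :\: X -> e u v ->
  5 * #|V :\: X| + c < rh e V (V :\: X) ->
  Mass (del e u v) V X c /\ rh (del e u v) V (V :\: X) < rh e V (V :\: X).
Proof.
move=> uVX vVX uv gt.
have [[uV uX] [vV vX]] := (setDP uVX, setDP vVX).
have sym' := del_sym u v sym; have irr' := del_irr u v irr.
have rE := rh_del sym irr uV vV uv (_ : (u \in V :\: X) || (v \in V :\: X)).
rewrite {}rE ?uVX // in gt *; split=> //; split=> //.
  by rewrite /heavy -ltnS gt andbT; case: massed => _ /andP[].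
move=> A B sAB XA lt; apply/negP=> /andP[BA0 h].
have h' : 5 * #|B :\: A| + c <= rh e V (B :\: A).
  apply: leq_trans h _; apply: rh_le => //; apply/subsetP=> -[x y]; rewrite !incE.
  by case/and4P=> -> -> /del_sub-> ->.
have [ABV noe] := sepP _ _ _ _ sAB; have [AV BV] := sep_sub sAB.
have [se|] := boolP (sep e V A B).
  by have := not_heavy se XA lt; rewrite /heavy BA0 h'.
rewrite /sep ABV eqxx /= negbK => /touchP[x [y []]].
rewrite !inE => /andP[xB xA] /andP[yA yB] xy.
have xyuv : (x == u) && (y == v) || (x == v) && (y == u).
  by have := noe x y xA xB yB yA; rewrite /del /= xy negbK.
have xX : x \notin X by case/orP: xyuv => /andP[/eqP->].
have only x' y' : x' \in A -> x' \notin B -> y' \in B -> y' \notin A -> e x' y' -> x' = x.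
  move=> xA' xB' yB' yA' xy'; have := noe x' y' xA' xB' yB' yA'; rewrite /del /= xy' negbK.
  case/orP: xyuv => /andP[/eqP ex /eqP ey] /orP[]/andP[/eqP ex' /eqP ey'].
  - by rewrite ex ex'.
  - by move: xA'; rewrite ex' -ey (negPf yA).
  - by move: xA'; rewrite ex' -ey (negPf yA).
  - by rewrite ex ex'.
have s2 : sep e V A (x |: B).
  apply/sepP; split; first by rewrite setUCA ABV; apply/setUidPr; rewrite sub1set (subsetP AV).
  move=> x' y' xA'; rewrite !inE negb_or => /andP[xx xB'] /predU1P[->|yB'] yA';
    first by rewrite xA in yA'.
  by apply/negP=> /(only _ _ xA' xB' yB' yA') E; rewrite E eqxx in xx.
have iE : A :&: (x |: B) = x |: (A :&: B).
  by rewrite setIUr; congr (_ :|: _); apply/setIidPr; rewrite sub1set.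
have dE : (x |: B) :\: A = B :\: A.
  by apply/setP=> z; rewrite !inE; case: eqP => // ->; rewrite xA.
have cI : #|A :&: (x |: B)| = #|A :&: B|.+1 by rewrite iE cardsU1 inE (negPf xB) andbF.
have h2 : heavy c e V A (x |: B) by rewrite /heavy dE BA0 h'.
have [E|ne] := eqVneq #|A :&: B|.+1 #|X|.
  have BE := no_heavy s2 XA (etrans cI E) h2.
  have AX : A = X by apply/esym/eqP; rewrite eqEcard XA -E -cI BE (setIidPl AV) leqnn.
  by rewrite -AX xA in xX.
have := not_heavy s2 XA; rewrite cI ltn_neqAle ne lt => /(_ isT).
by rewrite h2.
Qed.

End Minimal.

(** The outer induction is on vertices. The inner one deletes edges until the density is exact; both
    outcomes persist when an edge is put back. *)
Theorem massed_linked e V X c : symmetric e -> irreflexive e -> admissible X c -> Mass e V X c ->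
  Linked V e X \/ dominated e V X.
Proof.
have [n] := ubnP #|V|; elim: n e V X c => // n IHn e V X c ltV sym irr adm.
have IH e' V' X' c' : symmetric e' -> irreflexive e' -> #|V'| < #|V| ->
  admissible X' c' -> Mass e' V' X' c' -> Linked V' e' X' \/ dominated e' V' X'.
  by move=> sym' irr' lt; apply: IHn => //; apply: leq_trans lt _; rewrite -ltnS.
have [m] := ubnP (rh e V (V :\: X)); elim: m e sym irr => // m IHm e sym irr lt_m M.
apply: NNPP => /not_or_and[nL nD].
have [s [us sX ns]] : exists s, [/\ uniq s, s =i X & ~ mlinked V e s].
  by apply: NNPP => H; apply: nL => s us sX; apply: NNPP => ns; apply: H; exists s.
have [_ /andP[_ ge] _] := M.
have [E|ne] := eqVneq (rh e V (V :\: X)) (5 * #|V :\: X| + c).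
  exact: (exact_density_absurd sym irr adm M IH us sX ns nD).
have gt : 5 * #|V :\: X| + c < rh e V (V :\: X) by rewrite ltn_neqAle eq_sym ne.
have [u [v [uVX vVX uv]]] := inner_edge sym irr adm M.
have [M' lt'] := del_massed sym irr adm M IH us sX ns nD uVX vVX uv gt.
have sub := @del_sub _ e u v.
have lt2 : rh (del e u v) V (V :\: X) < m by apply: leq_trans lt' _; rewrite -ltnS.
case: (IHm (del e u v) (del_sym u v sym) (del_irr u v irr) lt2 M') => [L|/dominatedP[X5 [a [b [aV
  bV ab He]]]]].
  by apply: ns; apply: mlinkedS (L s us sX).
apply: nD; apply/dominatedP; split=> //; exists a, b; split=> // x /He/andP[/sub-> /sub->] //.
Qed.

End Main.

(** * Translation to the notions of the theorem *)

Section Bridge.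
Variable T : finType.
Implicit Types (e : rel T) (s : seq T) (V X Y A B C D : {set T}).

Lemma rh_setT e Y : rh e [set: T] Y = rho e Y.
Proof.
rewrite /rh /rho /edges; apply: eq_card => F; rewrite !inE; congr (_ && _).
by apply: eq_existsb => x; apply: eq_existsb => y; rewrite /adj_in /= !inE !andbT.
Qed.

Lemma massed_Mass e X : massed e 5 X -> Mass e [set: T] X 1.
Proof.
rewrite /massed -setTD; case=> M1 M2; split; first exact: subsetT.
  rewrite /heavy rh_setT addn1 M1 andbT; apply: contraTneq M1 => ->.
  by rewrite -rh_setT rh0.
move=> A B /andP[/eqP ABT noe] XA lt; have := M2 A B (conj ABT (conj XA noe)) lt.
by rewrite /heavy rh_setT addn1 leqNgt => /negPf->; rewrite andbF.
Qed.

Lemma mlinked_Ck_minor V e s : uniq s -> 1 < size s -> mlinked V e s -> Ck_minor e s.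
Proof.
move=> us s2 [F [F1 F2 F3 F4 F5]].
have [x0 x0s] : exists x0, x0 \in s by case: (s) s2 => // x s' _; exists x; rewrite inE eqxx.
have ms i : i < size s -> nth x0 s i \in s by apply: mem_nth.
exists (fun i => F (nth x0 s i)); split; [|split; [|split]].
- by move=> i j lti ltj ij; apply: F4; rewrite ?ms // nth_uniq.
- by move=> i lti; apply: F3; apply: ms.
- by move=> y i lti; rewrite (set_nth_default x0) //; apply: F1; apply: ms.
move=> i lti; have ltj : i.+1 %% size s < size s by rewrite ltn_mod (leq_trans _ s2).
(* With at least two roots the successor is a different root, so the equality clause of [tie] cannot
   occur. *)
have ij : i != i.+1 %% size s.
  have [lt|] := ltnP i.+1 (size s); first by rewrite modn_small // neq_ltn ltnSn.
  rewrite leq_eqVlt ltnS leqNgt lti orbF => /eqP E; rewrite -E modnn.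
  by move: s2; rewrite E; case: (i).
have : tie e F (nth x0 s i) (nth x0 s (i.+1 %% size s)).
  move: F5 lti; case: (s) => // x p /(pathP x0)/(_ i); rewrite size_rcons => H lti.
  have := H lti; rewrite -rcons_cons nth_rcons /= lti nth_rcons.
  have [lt|] := ltnP i (size p); first by rewrite modn_small.
  rewrite leq_eqVlt ltnNge -ltnS lti orbF => /eqP ->; by rewrite eqxx modnn.
by rewrite /tie nth_uniq // (negPf ij).
Qed.

Lemma Linked_cycle_linked e X : symmetric e -> 1 <= #|X| -> Linked [set: T] e X -> cycle_linked e X.
Proof.
move=> sym X1 L; have [X3|X2] := leqP 3 #|X|.
  left; split=> // s us sX; have sX' : s =i X by move=> x; rewrite -sX inE.
  apply: mlinked_Ck_minor (L s us sX') => //.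
  by rewrite -(card_uniqP us) (eq_card sX') (ltn_trans _ X3).
right; split; first by move: X1 X2; case: #|X| => [|[|[|]]].
move=> x y xX yX; have [->|xy] := eqVneq x y; first exact: connect0.
have us : uniq [:: x; y] by rewrite /= inE xy.
have sX : {subset [:: x; y] <= X} by move=> z; rewrite !inE => /orP[]/eqP->.
have [F [F1 F2 F3 F4 F5]] := Linked_sub sym L us sX.
move: F5; rewrite /= {1}/tie (negPf xy) => /andP[/touchP[a [b [aF bF ab]]] _].
have [xs ys] : x \in [:: x; y] /\ y \in [:: x; y] by rewrite !inE !eqxx orbT.
have sub Y : subrel (connect (adj_in e Y)) (connect e).
  by apply: connect_sub => u v /andP[/andP[uv _] _]; apply: connect1.
apply: connect_trans (sub _ _ _ (F3 x xs x a (F1 x xs) aF)) _.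
apply: connect_trans (connect1 ab) _; exact: sub _ _ _ (F3 y ys b y bF (F1 y ys)).
Qed.

End Bridge.

Theorem theorem2 (T : finType) (adj : rel T)
  (adj_sym : symmetric adj) (adj_irr : irreflexive adj)
  (X : {set T}) :
  1 <= #|X| <= 5 ->
  massed adj 5 X ->
  ~ cycle_linked adj X ->
  #|X| = 5 /\
  rho adj (~: X) = 5 * #|~: X| + 1 /\
  exists s : seq T,
    [/\ size s = 5, uniq s, [set x in s] = X,
        (forall x0 i, i < 5 -> ~~ adj (nth x0 s i) (nth x0 s (i.+1 %% 5))) &
        exists a b : T,
          [/\ a \notin X, b \notin X, adj a b,
              (forall x0 i, i < 5 -> adj a (nth x0 s i) && adj b (nth x0 s i)) &
              forall v, v \in ~: (X :|: [set a; b]) ->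
                let C := component_in adj (~: (X :|: [set a; b])) v in
                rho adj C = 5 * #|C| /\
                exists x0 i, i < 5 /\
                  nbhd adj C \subset [set a; b; nth x0 s i; nth x0 s ((i + 2) %% 5)]]].
Proof.
move=> /andP[X1 X5] M ncl; have M' := massed_Mass M.
have adm : admissible X 1 by rewrite /admissible X5 /= implybT.
case: (massed_linked adj_sym adj_irr adm M') => [L|/dominatedP[cX [a [b [aVX bVX ab He]]]]].
  by case: ncl; apply: Linked_cycle_linked.
have [s [us sX ns]] : exists s, [/\ uniq s, s =i X & ~ mlinked [set: T] adj s].
  apply: NNPP => H; apply: ncl; apply: Linked_cycle_linked => // s us sX.
  by apply: NNPP => ns; apply: H; exists s.
have s5 : size s = 5 by rewrite -cX -(eq_card sX) (card_uniqP us).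
have dense : 5 * #|[set: T] :\: X| + 1 <= rh adj [set: T] ([set: T] :\: X).
  by have [_ /andP[_]] := M'.
have aX : a \notin X by case/setDP: aVX.
have bX : b \notin X by case/setDP: bVX.
have HE x : x \in s -> adj a x && adj b x by rewrite sX => /He.
split=> //; split.
  apply/eqP; rewrite -setTD -rh_setT eqn_leq dense andbT.
  exact: (dominators_count adj_sym adj_irr cX us sX M' aVX bVX ab He ns).
exists s; split=> //; first by apply/setP=> x; rewrite inE sX.
  have : cycle (fun x y => ~~ adj x y) s.
    by apply: (nonadjacent_roots adj_sym us s5 _ _ _ ab _ _ HE ns) => [x||||]; rewrite ?sX ?inE.
  case: s s5 {us sX ns HE} => [|x0 [|x1 [|x2 [|x3 [|x4 []]]]]] //= _.
  case/and5P=> h0 h1 h2 h3; rewrite andbT => h4 x i; by do 5?[case: i => [|i] //].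
exists a, b; split=> //.
- exact: (dominators_adjacent adj_sym adj_irr cX us sX M' aVX bVX ab He ns dense).
- by move=> x0 i i5; apply: HE; rewrite mem_nth ?s5.
move=> v; have -> : ~: (X :|: [set a; b]) = [set: T] :\: (a |: (b |: X)).
  by apply/setP=> x; rewrite !inE andbT orbC -orbA.
set U := _ :\: _ => vU C.
have CU : C \subset U by apply: component_sub.
have C0 : C != set0 by apply/set0Pn; exists v; apply: component_self.
have cC : connected_in adj C by apply: component_conn.
have clC x y : x \in C -> y \in U -> adj x y -> y \in C by apply: component_closed.
split.
  by rewrite -rh_setT; apply: (dominated_component_eq adj_sym adj_irr cX us sX M' aVX bVX ab He ns
    dense).
have CX y : y \in C -> [&& y \notin s, y != a & y != b].
  by move=> /(subsetP CU); rewrite !inE !negb_or sX andbT => /and3P[-> -> ->].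
have [x||||||i i5 Hi] := @attachment _ _ adj_sym [set: T] a b s C us s5 _ _ _ ab _ _ HE ns _ cC CX;
  rewrite ?sX ?inE ?subsetT //.
exists a, i; split=> //; apply/subsetP=> z; rewrite inE => /andP[zC /existsP[y /andP[yC yz]]].
(* A neighbour of [C] outside [C] cannot be in [U], so it is [a], [b] or a root touched by [C]. *)
have [zU|zU] := boolP (z \in U); first by rewrite (clC y z) in zC.
move: zU; rewrite !inE andbT negbK => /or3P[->|->|zX]; rewrite ?orbT //.
rewrite -sX in zX; have lt : index z s < 5 by rewrite -s5 index_mem.
have := Hi a _ lt; rewrite nth_index // => H.
have {H} : index z s = i \/ index z s = (i + 2) %% 5.
  by apply: H; apply/touchP; exists y, z; rewrite inE.
by case=> <-; rewrite nth_index // eqxx ?orbT.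
Qed.
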